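(* Under the standing assumptions of the context, let $X$ be the solution of the killed McKean–Vlasov equation, $\nu_t(A)=\mathbb P(X_t\in A,\ t<\tau)$, and let $v(t,\cdot)$ be the Lebesgue density of $\nu_t$ for $t\in(0,T]$, with $v(0,\cdot):=\rho_0$. Then for every $f\in C_b^2(\mathbb{R})$ and every $t\in[0,T]$, $$\int_{\mathbb{R}}f(x)v(t,x)\,dx=\int_{\mathbb{R}}f(x)\rho_0(x)\,dx+\int_0^t\!\!\int_{\mathbb{R}}\Delta f(x)v(s,x)\,dx\,ds+\int_0^t\!\!\int_{\mathbb{R}}\nabla f(x)\,b\big(K*v(\cdot,x)(s),\nabla K*v(\cdot,x)(s)\big)v(s,x)\,dx\,ds-\int_0^t\!\!\int_{\mathbb{R}}f(x)\lambda c_0\exp\big(-\lambda K*v(\cdot,x)(s)\big)v(s,x)\,dx\,ds,$$ i.e. $v$ is a weak solution of $\partial_t\rho=\Delta\rho-\nabla\cdot[b(K*\rho(\cdot,x)(t),\nabla K*\rho(\cdot,x)(t))\rho]-\lambda c_0e^{-\lambda K*\rho(\cdot,x)(t)}\rho$ with $\rho(0,\cdot)=\rho_0$.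
   Context: Standing assumptions. $T>0$; $(\Omega,\mathcal F,(\mathcal F_t),\mathbb P)$ is a filtered probability space carrying a one-dimensional Brownian motion $W$, an $\mathcal F_0$-measurable real random variable $X_0$ independent of $W$ with $\mathbb E|X_0|^2<\infty$ and law $\nu_0(dx)=\rho_0(x)dx$, $\rho_0\in L^2(\mathbb{R})\cap C_b(\mathbb{R})$, and a random variable $Z\sim\mathrm{Exp}(1)$ independent of $X_0$ and $W$. $\Delta$ (as a state) is a cemetery state isolated from $\mathbb{R}$; functions on $\mathbb{R}$ are extended by $f(\Delta)=0$; $\Delta f$ for a function denotes its second derivative. $K:\mathbb{R}\to\mathbb{R}_+$ is a smooth mollifier: $K\in C^\infty$; $|K|\le M_K$, $|\nabla K|\le M_K'$, $|\nabla^2K|\le M_K''$; $K$ and $\nabla K$ are Lipschitz with constants $L_K,L_K'$; $\int K=1$. Parameters $\lambda>0$, $c_0>0$, $\varphi_0>0$, $\varphi_1\in\mathbb{R}$ are such that there exist constants $0<m\le M$ with $m\le\varphi_0+\varphi_1c_0e^{-\lambda x}\le M$ for all $x\in[0,M_KT]$. The drift is $b(x,y):=-\varphi_1\lambda c_0\dfrac{e^{-\lambda x}y}{\varphi_0+\varphi_1c_0e^{-\lambda x}}$. For a finite measure $\nu$ on $\mathbb{R}$, $K*\nu(x):=\int K(x-y)\nu(dy)$, $\nabla K*\nu(x):=\int\nabla K(x-y)\nu(dy)$; for a function $v$ on $[0,T]\times\mathbb{R}$, $K*v(\cdot,x)(s):=\int_0^s\int_{\mathbb{R}}K(x-y)v(r,y)\,dy\,dr$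 and similarly for $\nabla K$. The killed McKean–Vlasov equation is: $X_t=X_0+\int_0^t b(\int_0^sK*\nu_r(X_s)dr,\int_0^s\nabla K*\nu_r(X_s)dr)ds+\sqrt2W_t$ for $t\in[0,\tau)\cap[0,T]$, $X_t=\Delta$ for $t\ge\tau$, where $\nu_t(A)=\mathbb P(X_t\in A,t<\tau)$ and $\tau:=\inf\{t\ge0:\int_0^t\lambda c_0\exp(-\lambda\int_0^sK*\nu_r(X_s)dr)ds\ge Z\}$; it has a pathwise unique strong solution, and $\nu_t$ has a Lebesgue density for each $t\in(0,T]$. *)

(* Defs.v *)
From HB Require Import structures.
From mathcomp Require Import all_boot all_order all_algebra.
From mathcomp Require Import all_classical all_reals all_analysis measurable_realfun.
Set Implicit Arguments. Unset Strict Implicit. Unset Printing Implicit Defensive.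
Import Order.TTheory GRing.Theory Num.Theory Num.Def.
Import numFieldNormedType.Exports.
Local Open Scope classical_set_scope.
Local Open Scope ring_scope.

Section defs.
Context {R : realType}.
Notation leb := (@lebesgue_measure R).

Definition indep_sets d (Om : measurableType d) (P : probability Om R)
  (G1 G2 : set (set Om)) : Prop :=
  forall A B, G1 A -> G2 B -> P (A `&` B) = (P A * P B)%E.

Definition sigma_gen (Om : Type) (I : Type) (Y : I -> Om -> R) : set (set Om) :=
  smallest (sigma_algebra setT)
    [set A | exists i B, measurable B /\ A = Y i @^-1` B].

Definition filtration d (Om : measurableType d) (F : R -> set (set Om)) : Prop :=
  (forall t, 0 <= t -> sigma_algebra setT (F t) /\ F t `<=` measurable) /\
  (forall s t, 0 <= s -> s <= t -> F s `<=` F t).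

Definition brownian_motion d (Om : measurableType d) (P : probability Om R)
  (F : R -> set (set Om)) (W : R -> Om -> R) : Prop :=
  [/\ (forall t, 0 <= t -> measurable_fun setT (W t)),
      (forall t B, 0 <= t -> measurable B -> F t (W t @^-1` B)),
      {ae P, forall w, W 0 w = 0},
      {ae P, forall w, {within `[0, +oo[, continuous (W^~ w)}} &
      (forall s t, 0 <= s -> s < t ->
         (forall B, measurable B ->
            P ((fun w => W t w - W s w) @^-1` B) = normal_prob 0 (Num.sqrt (t - s)) B) /\
         indep_sets P (F s)
           (sigma_gen (fun _ : unit => fun w => W t w - W s w)))].

Definition smooth (f : R -> R) : Prop := forall n x, derivable (derive1n n f) x 1.

Definition Cb2 (f : R -> R) : Prop :=
  [/\ (forall x, derivable f x 1), (forall x, derivable (derive1 f) x 1),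
      continuous (derive1n 2 f) &
      exists C, forall x, `|f x| <= C /\ `|derive1 f x| <= C /\ `|derive1n 2 f x| <= C].

Definition lipschitz_const (f : R -> R) (L : R) : Prop :=
  forall x y, `|f x - f y| <= L * `|x - y|.

Definition drift (lam c0 phi0 phi1 : R) (x y : R) : R :=
  - phi1 * lam * c0 * (expR (- lam * x) * y) / (phi0 + phi1 * c0 * expR (- lam * x)).

Definition nu_kill d (Om : measurableType d) (P : probability Om R)
  (X : R -> Om -> R) (tau : Om -> \bar R) (t : R) (A : set R) : \bar R :=
  P [set w | A (X t w) /\ (t%:E < tau w)%E].

(* g * nu_r (x) = \int g(x - y) nu_r(dy) = E[ g(x - X_r) ; r < tau ] *)
Definition conv_nu d (Om : measurableType d) (P : probability Om R)
  (X : R -> Om -> R) (tau : Om -> \bar R) (g : R -> R) (r x : R) : R :=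
  \int[P]_(w in [set w | (r%:E < tau w)%E]) g (x - X r w).

Definition tconv_nu d (Om : measurableType d) (P : probability Om R)
  (X : R -> Om -> R) (tau : Om -> \bar R) (g : R -> R) (s x : R) : R :=
  \int[leb]_(r in [set r | 0 <= r <= s]) conv_nu P X tau g r x.

Definition tconv_v (v : R -> R -> R) (g : R -> R) (s x : R) : R :=
  \int[leb]_(r in [set r | 0 <= r <= s]) \int[leb]_(y in setT) (g (x - y) * v r y).

End defs.

(* Main.v *)
(* Given the solution, b and k (drift and killing rate evaluated at the occupation integrals of
   nu) are fixed functions of (s, x), bounded and Lipschitz, so X solves a linear killed
   diffusion. Along the Euler scheme Y_n driven by W, with Euler clock A_n for the integral of k,
   one Gaussian step and a second-order Taylor expansion show that E[f(Y_n) exp(-A_n)] changes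
   by h times the expectation of an approximate generator; Z being exponential and independent
   of (Y_n, A_n), this equals E[f(Y_n); A_n < Z]. As h -> 0 the scheme converges pathwise to X
   before tau, and the clock strictly before or after tau, while P(tau = s) = 0; dominated
   convergence yields Dynkin's formula for E[f(X_t); t < tau] without any stochastic integral.
   Rewriting these expectations with the densities v gives the weak equation. *)
Require Import Defs.
From HB Require Import structures.
From mathcomp Require Import all_boot all_order all_algebra.
From mathcomp Require Import all_classical all_reals all_analysis measurable_realfun.
From mathcomp Require Import ring lra.
Import Order.TTheory GRing.Theory Num.Theory Num.Def.
Import numFieldNormedType.Exports.
Local Open Scope classical_set_scope.
Local Open Scope ring_scope.

Set Implicit Arguments. Unset Strict Implicit. Unset Printing Implicit Defensive.

(** From [tau] on the values of [X] are arbitrary, yet [tau] is a hitting time for the integral of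
    [k s (X s w)], and at those times nothing makes this integrand measurable along a path. The
    clock of [X] is therefore handled through lower integrals, which are monotone and Lipschitz in
    the upper limit by boundedness alone, and the Euler clock past [tau] is controlled by a lower
    bound [k0 > 0] on the rate, which drives it strictly beyond [Z]. The event [A_n < Z] has a
    discontinuous indicator, so the borderline [tau = s] must be null: there the Euler clock comes
    within any [eps] of [Z], and an exponential variable independent of the scheme falls in a window
    of length [2 * eps] with probability at most [2 * eps]. Measurability in time is the other
    obstacle, as [X] is measurable only at each fixed time. It comes from continuity for functions
    along a path before [tau], from right-continuity for the convolutions with [nu], and from limits
    of step functions for the expectations. *)

(** * Lower integrals of nonnegative functions *)

Section lower_integral.
Context d (T : measurableType d) (R : realType).
Context (mu : {measure set T -> \bar R}).

Import HBNNSimple.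

(* No measurability is required: [\int] of an arbitrary nonnegative function is its lower integral. *)
Lemma le_lower_integral (D : set T) (f g : T -> \bar R) :
  (forall x, D x -> 0 <= f x)%E -> (forall x, D x -> f x <= g x)%E ->
  (\int[mu]_(x in D) f x <= \int[mu]_(x in D) g x)%E.
Proof.
move=> f0 fg.
have g0 x : D x -> (0 <= g x)%E by move=> Dx; exact: le_trans (f0 _ Dx) (fg _ Dx).
rewrite !ge0_integralE//; apply: ereal_sup_le => _ [h hf <-].
exists h => // x; apply: le_trans (hf x) _.
by rewrite /patch; case: ifPn => // /set_mem; exact: fg.
Qed.

Lemma le_lower_integral_subset (D E : set T) (f : T -> \bar R) :
  D `<=` E -> (forall x, 0 <= f x)%E ->
  (\int[mu]_(x in D) f x <= \int[mu]_(x in E) f x)%E.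
Proof.
move=> DE f0; rewrite (integral_mkcond D) (integral_mkcond E).
apply: le_lower_integral => x _; first by apply: erestrict_ge0 => y _.
by rewrite /patch; case: ifPn => [/set_mem/DE/mem_set ->//|_]; case: ifPn.
Qed.

(** Lower integrals are not additive, but every simple function [h] below [f] is measurable, so its
    own integral splits over [A] and [B], and on [B] it is at most [c]. *)
Lemma lower_integral_setU_le (A B : set T) (f : T -> \bar R) (c : R) :
  measurable A -> measurable B -> [disjoint A & B] ->
  (forall x, 0 <= f x)%E -> (forall x, B x -> f x <= c%:E)%E ->
  (\int[mu]_(x in A `|` B) f x <= \int[mu]_(x in A) f x + c%:E * mu B)%E.
Proof.
move=> mA mB AB f0 fc.
rewrite [leLHS]ge0_integralE//; apply: ge_ereal_sup => _ [h hf <-].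
have mAB : measurable (A `|` B) by exact: measurableU.
(* Off the union, [h] is nonnegative and below the zero extension of [f], hence zero. *)
have hE : h = h \_ (A `|` B) :> (T -> R).
  apply/funext => x; rewrite /patch; case: ifPn => // xAB.
  apply/eqP; rewrite eq_le fun_ge0 andbT -lee_fin.
  by have := hf x; rewrite /patch (negbTE xAB).
rewrite hE -integral_nnsfun// ge0_integral_setU//=; last 2 first.
  by apply/measurable_EFinP; exact: measurable_funTS.
  by move=> x _; rewrite lee_fin.
have hf' x : ((h x)%:E <= f x)%E.
  apply: le_trans (hf x) _; rewrite /patch.
  by case: ifPn.
rewrite leeD//.
  by apply: le_lower_integral => x _; rewrite ?lee_fin.
rewrite -integral_cst//; apply: le_lower_integral => x Bx; first by rewrite lee_fin.
exact: le_trans (hf' x) (fc _ Bx).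
Qed.

End lower_integral.

(** * Integrals over [[0, t]] as functions of [t], by boundedness alone *)

Section lower_integral_time.
Context (R : realType).
Notation leb := (@lebesgue_measure R).

Lemma set_leleE (s : R) : [set r | 0 <= r <= s] = `[0, s]%classic.
Proof. by apply/seteqP; split => x /=; rewrite in_itv. Qed.

Lemma setT_leleU (s t : R) : 0 <= s <= t ->
  [set r | 0 <= r <= t] = [set r | 0 <= r <= s] `|` `]s, t]%classic.
Proof.
move=> /andP[s0 st]; apply/seteqP; split => x /=; rewrite in_itv/=.
  by move=> /andP[-> ->]; rewrite andbT; case: (leP x s); [left|right].
move=> [/andP[-> xs]|/andP[sx ->]]; first exact: le_trans xs st.
by rewrite (le_trans s0) ?ltW.
Qed.

Lemma leb_oc (s t : R) : s <= t -> leb `]s, t] = (t - s)%:E.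
Proof.
by move=> st; rewrite lebesgue_measure_itv/= lte_fin; case: ltgtP st => // -> _; rewrite subrr.
Qed.

Lemma leb_cc (t : R) : 0 <= t -> leb [set r | 0 <= r <= t] = t%:E.
Proof.
by rewrite set_leleE lebesgue_measure_itv/= lte_fin; case: ltgtP => // [t0|<-] _; rewrite ?subr0 ?sube0.
Qed.

Lemma leb_cc_lty (t : R) : 0 <= t -> (leb [set r | (0 <= r <= t)%R] < +oo)%E.
Proof. by move=> t0; rewrite leb_cc// ltry. Qed.

Lemma measurable_lele (t : R) : measurable [set r | 0 <= r <= t].
Proof. by rewrite set_leleE. Qed.

Lemma lower_integral_bound (D : set R) (f : R -> \bar R) (B : R) :
  measurable D -> (forall x, 0 <= f x <= B%:E)%E ->
  (0 <= \int[leb]_(x in D) f x <= B%:E * leb D)%E.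
Proof.
move=> mD fB; apply/andP; split.
  by apply: integral_ge0 => x _; case/andP: (fB x).
by rewrite -integral_cst//; apply: le_lower_integral => x _; case/andP: (fB x).
Qed.

Lemma lower_integral_lele (f : R -> \bar R) (B s t : R) :
  0 <= s <= t -> (forall x, 0 <= f x <= B%:E)%E ->
  [/\ (\int[leb]_(x in [set r | (0 <= r <= t)%R]) f x \is a fin_num)%E,
    (\int[leb]_(x in [set r | (0 <= r <= s)%R]) f x \is a fin_num)%E,
    0 <= fine (\int[leb]_(x in [set r | (0 <= r <= s)%R]) f x)%E <= B * s,
    fine (\int[leb]_(x in [set r | (0 <= r <= s)%R]) f x)%E <=
    fine (\int[leb]_(x in [set r | (0 <= r <= t)%R]) f x)%E &
    fine (\int[leb]_(x in [set r | (0 <= r <= t)%R]) f x)%E <=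
    fine (\int[leb]_(x in [set r | (0 <= r <= s)%R]) f x)%E + B * (t - s)].
Proof.
move=> /andP[s0 st] fB.
have fin u : 0 <= u -> (\int[leb]_(x in [set r | (0 <= r <= u)%R]) f x \is a fin_num)%E.
  move=> u0; have /andP[i0 iB] := lower_integral_bound (measurable_lele u) fB.
  by rewrite ge0_fin_numE// (le_lt_trans iB)// leb_cc// -EFinM ltry.
have t0 := le_trans s0 st.
split; [exact: fin|exact: fin| | |].
- have /andP[i0 iB] := lower_integral_bound (measurable_lele s) fB.
  rewrite -!lee_fin fineK ?fin// i0/= EFinM.
  by rewrite -(leb_cc s0).
- rewrite fine_le ?fin//; apply: le_lower_integral_subset.
    by move=> x /= /andP[-> /le_trans]; exact.
  by move=> x; case/andP: (fB x).
- rewrite -lee_fin EFinD !fineK ?fin// (setT_leleU (s := s)) ?s0//.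
  rewrite EFinM -(leb_oc st); apply: lower_integral_setU_le => //.
  + exact: measurable_lele.
  + apply/disj_setPS => x [/= /andP[_ xs]]; rewrite in_itv/= => /andP[].
    by rewrite ltNge xs.
  + by move=> x; case/andP: (fB x).
  + by move=> x _; case/andP: (fB x).
Qed.

Lemma ge0_Rintegral_lele (h : R -> R) (B s t : R) :
  0 <= s <= t -> (forall x, 0 <= h x <= B) ->
  [/\ 0 <= \int[leb]_(x in [set r | 0 <= r <= s]) h x <= B * s,
    \int[leb]_(x in [set r | 0 <= r <= s]) h x <=
    \int[leb]_(x in [set r | 0 <= r <= t]) h x &
    \int[leb]_(x in [set r | 0 <= r <= t]) h x <=
    \int[leb]_(x in [set r | 0 <= r <= s]) h x + B * (t - s)].
Proof.
move=> st hB; have hB' x : (0 <= (h x)%:E <= B%:E)%E by rewrite !lee_fin.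
by have [] := lower_integral_lele st hB'.
Qed.

(** The lower integrals of the positive and of the negative part each grow by an amount in
    [[0, B * (t - s)]], so their difference moves by at most [B * (t - s)], without a factor 2. *)
Lemma Rintegral_lele_lipschitz (h : R -> R) (B s t : R) :
  0 <= s <= t -> (forall x, 0 <= x <= t -> `|h x| <= B) ->
  `|\int[leb]_(x in [set r | 0 <= r <= t]) h x -
    \int[leb]_(x in [set r | 0 <= r <= s]) h x| <= B * (t - s).
Proof.
move=> st hB0.
have /andP[s0 st'] := st.
have B0 : 0 <= B by apply: (le_trans (normr_ge0 (h 0))); rewrite hB0 ?lexx ?(le_trans s0).
pose h' x := if 0 <= x <= t then h x else 0.
have hh' u : u <= t -> \int[leb]_(x in [set r | 0 <= r <= u]) h x =
                       \int[leb]_(x in [set r | 0 <= r <= u]) h' x.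
  move=> ut; apply: eq_Rintegral => x; rewrite inE/= => /andP[x0 xu].
  by rewrite /h' x0 (le_trans xu ut).
rewrite !hh'//.
have hB x : `|h' x| <= B by rewrite /h'; case: ifPn => [/hB0//|_]; rewrite normr0.
move: h' hB {hh'} => {hB0}h hB.
pose f x := (h x)%:E.
have fp x : (0 <= f^\+ x <= B%:E)%E.
  rewrite funeposE le_max lexx orbT/= ge_max !lee_fin B0 andbT.
  exact: le_trans (ler_norm _) (hB x).
have fn x : (0 <= f^\- x <= B%:E)%E.
  rewrite funenegE le_max lexx orbT/= ge_max !lee_fin B0 andbT.
  by apply: le_trans (ler_norm _) _; rewrite normrN.
have [pt ps _ p1 p2] := lower_integral_lele st fp.
have [nt ns _ n1 n2] := lower_integral_lele st fn.
have E u : \int[leb]_(x in [set r | 0 <= r <= u]) h x =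
    fine (\int[leb]_(x in [set r | (0 <= r <= u)%R]) f^\+ x -
          \int[leb]_(x in [set r | (0 <= r <= u)%R]) f^\- x)%E.
  by rewrite /Rintegral integralE.
rewrite !E (fineB pt nt) (fineB ps ns) ler_norml.
apply/andP; split; lra.
Qed.

Lemma Rintegral_lele_bound (h : R -> R) (B t : R) :
  0 <= t -> (forall x, 0 <= x <= t -> `|h x| <= B) ->
  `|\int[leb]_(x in [set r | 0 <= r <= t]) h x| <= B * t.
Proof.
move=> t0 hB; have := @Rintegral_lele_lipschitz h B 0 t _ hB.
rewrite lexx t0 => /(_ isT).
have -> : [set r : R | 0 <= r <= 0] = [set 0].
  by apply/seteqP; split => x /=; [move=> x0; apply/esym/le_anti|move=> ->; rewrite lexx].
by rewrite Rintegral_set1 !subr0.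
Qed.

End lower_integral_time.

(** * Bounds and dominated convergence for real-valued integrals *)

Section bounded_integrals.
Context d (T : measurableType d) (R : realType).
Context (mu : {measure set T -> \bar R}).

Lemma integrable_bounded (D : set T) (f : T -> R) (C : R) :
  measurable D -> (mu D < +oo)%E -> measurable_fun D f ->
  (forall x, D x -> `|f x| <= C) -> mu.-integrable D (EFin \o f).
Proof.
move=> mD Dfin mf fC; apply: measurable_bounded_integrable => //.
by exists C; split; [exact: num_real|move=> M CM x /fC /le_trans; apply; exact: ltW].
Qed.

Lemma Rintegral_dominated_cvg (D : set T) (f_ : nat -> T -> R) (f g : T -> R) :
  measurable D -> (forall n, measurable_fun D (f_ n)) -> measurable_fun D f ->
  mu.-integrable D (EFin \o g) ->
  {ae mu, forall x, D x -> f_ ^~ x @ \oo --> f x} ->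
  (forall n x, D x -> `|f_ n x| <= g x) ->
  \int[mu]_(x in D) f_ n x @[n --> \oo] --> \int[mu]_(x in D) f x.
Proof.
move=> mD mf_ mf ig cf fg.
have mEf_ n : measurable_fun D (EFin \o f_ n) by exact/measurable_EFinP.
have mEf : measurable_fun D (EFin \o f) by exact/measurable_EFinP.
have cEf : {ae mu, forall x, D x -> (EFin \o f_ n) x @[n --> \oo] --> (EFin \o f) x}.
  case: cf => N [mN N0 sub]; exists N; split => //; apply: subset_trans sub => x /= nx cx.
  by apply: nx => Dx; apply: cvg_EFin; [exact: nearW|exact: cx].
have fEg : {ae mu, forall x n, D x -> (`|(EFin \o f_ n) x| <= (EFin \o g) x)%E}.
  by apply: aeW => x n Dx /=; rewrite lee_fin fg.
have [intf _ H] := dominated_convergence mD mEf_ mEf cEf ig fEg.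
apply: fine_cvg.
by rewrite /Rintegral fineK//; exact: integrable_fin_num.
Qed.

Lemma Rintegral_bounded_cvg (D : set T) (f_ : nat -> T -> R) (f : T -> R) (C : R) :
  measurable D -> (mu D < +oo)%E ->
  (forall n, measurable_fun D (f_ n)) -> measurable_fun D f ->
  {ae mu, forall x, D x -> f_ ^~ x @ \oo --> f x} ->
  (forall n x, D x -> `|f_ n x| <= C) ->
  \int[mu]_(x in D) f_ n x @[n --> \oo] --> \int[mu]_(x in D) f x.
Proof.
move=> mD Dfin mf_ mf cf fC; apply: (Rintegral_dominated_cvg (g := cst C)) => //.
exact: (@integrable_bounded _ _ `|C|).
Qed.

Lemma Rintegral_bound (D : set T) (f : T -> R) (C : R) :
  measurable D -> (mu D < +oo)%E -> measurable_fun D f ->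
  (forall x, D x -> `|f x| <= C) ->
  `|\int[mu]_(x in D) f x| <= C * fine (mu D).
Proof.
move=> mD Dfin mf fC.
have fi := integrable_bounded mD Dfin mf fC.
apply: le_trans (le_normr_Rintegral mD fi) _.
rewrite -Rintegral_cst//; apply: le_Rintegral => //.
  by apply: (@integrable_bounded _ _ C) => // [|x /fC]; [exact: measurableT_comp|rewrite normr_id].
by apply: (@integrable_bounded _ _ `|C|).
Qed.

End bounded_integrals.

Section probability_bounds.
Context d (T : measurableType d) (R : realType).
Context (P : probability T R).

Lemma prob_fin (D : set T) : measurable D -> (P D < +oo)%E.
Proof. by move=> mD; rewrite -ge0_fin_numE// fin_num_measure. Qed.

Lemma integrable_boundedP (D : set T) (f : T -> R) (C : R) :
  measurable D -> measurable_fun D f -> (forall x, D x -> `|f x| <= C) ->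
  P.-integrable D (EFin \o f).
Proof. by move=> mD mf fC; apply: (integrable_bounded _ _ _ fC) => //; exact: prob_fin. Qed.

Lemma Rintegral_boundP (D : set T) (f : T -> R) (C : R) : 0 <= C ->
  measurable D -> measurable_fun D f -> (forall x, D x -> `|f x| <= C) ->
  `|\int[P]_(x in D) f x| <= C.
Proof.
move=> C0 mD mf fC; apply: le_trans (Rintegral_bound mD (prob_fin mD) mf fC) _.
rewrite ler_piMr// -lee_fin fineK ?fin_num_measure//.
exact: probability_le1.
Qed.

End probability_bounds.

(** * Expectations rewritten with densities *)

Section density.
Context d (T : measurableType d) (R : realType).
Context (leb : {sigma_finite_measure set T -> \bar R}).

(** The density [v] has no prescribed sign. It has the same integral as the Radon-Nikodym derivative
    of [nu] on every measurable set, so the two agree almost everywhere, and the change of variables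
    is carried out with the derivative. *)
Lemma integral_density (nu : {finite_measure set T -> \bar R}) (v phi : T -> R) (C : R) :
  measurable_fun setT v ->
  (forall A, measurable A -> nu A = \int[leb]_(x in A) (v x)%:E)%E ->
  measurable_fun setT phi -> (forall x, `|phi x| <= C) ->
  leb.-integrable setT (EFin \o (fun x => phi x * v x)) /\
  (\int[leb]_x (phi x * v x)%:E = \int[nu]_x (phi x)%:E)%E.
Proof.
move=> mv nuE mphi phiC.
have numu : nu `<< leb.
  apply/null_content_dominatesP => A mA A0; rewrite nuE//.
  by apply: null_set_integral => //; exact/measurable_EFinP/measurable_funTS.
have numuc : charge_of_finite_measure nu `<< leb by exact: numu.
have mRN : measurable_fun setT (Radon_Nikodym (charge_of_finite_measure nu) leb).
  by have /integrableP[] := Radon_Nikodym_integrable numuc.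
have mEv : measurable_fun setT (EFin \o v) by exact/measurable_EFinP.
have iv : leb.-integrable setT (EFin \o v).
  apply/integrableP; split => //.
  (* For a measurable function a finite integral already forces an integrable absolute value. *)
  apply/abse_integralP => //; rewrite -nuE//.
  by rewrite gee0_abs// -ge0_fin_numE// fin_num_measure.
have aev : ae_eq leb setT (EFin \o v) (Radon_Nikodym (charge_of_finite_measure nu) leb).
  apply: integral_ae_eq => //.
  by move=> E _ mE; rewrite -Radon_Nikodym_integral// -nuE.
have iphi : nu.-integrable setT (EFin \o phi).
  apply: (@integrable_bounded _ _ _ _ _ _ C) => //.
  by rewrite -ge0_fin_numE// fin_num_measure.
split.
  have -> : EFin \o (fun x => phi x * v x) = (fun x => (phi x)%:E * (v x)%:E)%E.
    by apply/funext => x; rewrite /= EFinM.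
  apply: (@integrableMr _ _ _ _ _ measurableT) => //.
  by exists C; split; [exact: num_real|move=> M CM x _; exact: le_trans (phiC x) (ltW CM)].
rewrite -(Radon_Nikodym_change_of_variables numu)//.
apply: ae_eq_integral => //.
- by apply/measurable_EFinP/measurable_funM.
- apply: emeasurable_funM; first exact/measurable_EFinP.
  exact: mRN.
- case: aev => N [mN N0 sub]; exists N; split => // x /= nx; apply: sub => /= H.
  by apply: nx => xT; rewrite EFinM H.
Qed.

End density.

Section law_density.
Context d d' (Om : measurableType d) (T : measurableType d') (R : realType).
Context (P : probability Om R) (E : set Om) (X : {mfun Om >-> T}).
Context (mE : measurable E) (leb : {sigma_finite_measure set T -> \bar R}).

(** The sub-probability law of [X] on the event [E]; for the position at time [t] and the event of
    being alive, this is [nu_t]. *)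
Let restricted_law := pushforward (mrestr P mE) X.

Let restricted_law0 : restricted_law set0 = 0%E.
Proof. exact: measure0. Qed.

Let restricted_law_ge0 A : (0 <= restricted_law A)%E.
Proof. exact: measure_ge0. Qed.

Let restricted_law_additive : semi_sigma_additive restricted_law.
Proof. exact: measure_semi_sigma_additive. Qed.

HB.instance Definition _ := isMeasure.Build _ _ _ restricted_law
  restricted_law0 restricted_law_ge0 restricted_law_additive.

Let restricted_law_fin : fin_num_fun restricted_law.
Proof.
move=> A mA; rewrite /restricted_law /pushforward /mrestr fin_num_measure//.
by apply: measurableI => //; rewrite -[X in measurable X]setTI; exact: measurable_funP.
Qed.

HB.instance Definition _ :=
  Measure_isFinite.Build _ _ _ restricted_law restricted_law_fin.

Lemma Rintegral_law_density_mfun (v phi : T -> R) (C : R) :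
  measurable_fun setT v ->
  (forall A, measurable A -> P (X @^-1` A `&` E) = \int[leb]_(x in A) (v x)%:E)%E ->
  measurable_fun setT phi -> (forall x, `|phi x| <= C) ->
  \int[leb]_x (phi x * v x) = \int[P]_(w in E) phi (X w).
Proof.
move=> mv vE mphi phiC.
have [_ H] := @integral_density _ _ _ leb restricted_law v phi C mv vE mphi phiC.
rewrite /Rintegral H; congr fine.
have phiXi : (mrestr P mE).-integrable setT (EFin \o (phi \o X)).
  apply: (@integrable_bounded _ _ _ _ _ _ C) => //=.
    by rewrite /mrestr prob_fin//; exact: measurableI.
  by apply: measurableT_comp => //; exact: measurable_funP.
rewrite integral_pushforward//=.
(* The restricted measure ignores the complement of [E] and coincides with [P] on subsets of [E]. *)
- rewrite preimage_setT (@negligible_integral _ _ _ _ setT (~` E))//=.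
  + rewrite setTD setCK; apply: eq_measure_integral => A mA AE.
    by rewrite /= /mrestr setIidl.
  + exact: measurableC.
  + by rewrite /= /mrestr setICl measure0.
- exact/measurable_EFinP.
Qed.

End law_density.

Lemma Rintegral_law_density d d' (Om : measurableType d) (T : measurableType d') (R : realType)
    (P : probability Om R) (leb : {sigma_finite_measure set T -> \bar R})
    (E : set Om) (X : Om -> T) (v phi : T -> R) (C : R) :
  measurable E -> measurable_fun setT X -> measurable_fun setT v ->
  (forall A, measurable A ->
     P (X @^-1` A `&` E) = \int[leb]_(x in A) (v x)%:E)%E ->
  measurable_fun setT phi -> (forall x, `|phi x| <= C) ->
  \int[leb]_x (phi x * v x) = \int[P]_(w in E) phi (X w).
Proof.
move=> mE mX; pose X' : {mfun Om >-> T} := HB.pack X (isMeasurableFun.Build _ _ _ _ X mX).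
exact: (Rintegral_law_density_mfun (X := X')).
Qed.

(** * Integrating out an independent variable *)

Section independence.
Context d d1 d2 (Om : measurableType d) (T1 : measurableType d1) (T2 : measurableType d2).
Context (R : realType) (P : probability Om R).

(** The joint law agrees with the product of the marginals on rectangles, hence everywhere, and
    Fubini applies. The measurability of the inner integral is kept as a conclusion: the approximate
    generator gets its measurability from it. *)
Lemma Rintegral_indep (U : Om -> T1) (V : Om -> T2) (m2 : probability T2 R)
    (f : T1 * T2 -> R) (C : R) :
  measurable_fun setT U -> measurable_fun setT V ->
  (forall B, measurable B -> P (V @^-1` B) = m2 B) ->
  (forall A B, measurable A -> measurable B ->
    P (U @^-1` A `&` V @^-1` B) = (P (U @^-1` A) * P (V @^-1` B))%E) ->
  measurable_fun setT f -> (forall x, `|f x| <= C) ->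
  \int[P]_w f (U w, V w) = \int[P]_w \int[m2]_y f (U w, y) /\
  measurable_fun setT (fun x => \int[m2]_y f (x, y)).
Proof.
move=> mU mV lawV indep mf fC.
pose U' : {mfun Om >-> T1} := HB.pack U (isMeasurableFun.Build _ _ _ _ U mU).
have mUV : measurable_fun setT (fun w => (U w, V w)) by exact: measurable_fun_pair.
have mEf : measurable_fun setT (EFin \o f) by exact/measurable_EFinP.
pose m1 := distribution P U'.
have prodE : forall A, measurable A -> (m1 \x m2)%E A = pushforward P (fun w => (U w, V w)) A.
  move=> A mA; apply: (@product_measure_unique _ _ _ _ _ m1 m2
    (pushforward P (fun w => (U w, V w)))) => // A1 A2 mA1 mA2.
  by rewrite /= /m1 /distribution /pushforward -lawV// -indep//; congr (P _); apply/seteqP; split.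
have fi : (m1 \x m2)%E.-integrable setT (EFin \o f).
  exact: (@integrable_boundedP _ _ _ (m1 \x m2)%E _ _ C).
have FE x : fubini_F m2 (EFin \o f) x = (\int[m2]_y f (x, y))%:E.
  rewrite /fubini_F /Rintegral fineK//; apply: integrable_fin_num => //.
  apply: (@integrable_boundedP _ _ _ m2 _ _ C) => //.
  exact: measurableT_comp.
have mF : measurable_fun setT (fun x => \int[m2]_y f (x, y)).
  apply/measurable_EFinP; rewrite (_ : _ \o _ = fubini_F m2 (EFin \o f)).
    exact: (measurable_fubini_F fi).
  by apply/funext => x; rewrite FE.
split => //; rewrite /Rintegral; congr fine.
transitivity (\int[m1 \x m2]_z (EFin \o f) z)%E; last first.
  rewrite -integral12_prod_meas1//.
  rewrite (eq_integral (fun x => (\int[m2]_y f (x, y))%:E)); last first.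
    by move=> x _; exact: FE.
  rewrite integral_distribution//; first exact/measurable_EFinP.
  apply: (@integrable_boundedP _ _ _ P _ (fun w => \int[m2]_y f (U w, y)) C) => //.
    exact: (measurableT_comp mF mU).
  move=> w _; apply: Rintegral_boundP => //.
    exact: le_trans (normr_ge0 _) (fC (U w, V w)).
  exact: measurableT_comp.
rewrite (eq_measure_integral (pushforward P (fun w => (U w, V w)))); last first.
  by move=> A mA _; exact: prodE.
rewrite integral_pushforward// preimage_setT.
apply: (@integrable_boundedP _ _ _ P _ (fun w => f (U w, V w)) C) => //.
exact: (measurableT_comp mf mUV).
Qed.

End independence.

(** * Step functions of time and continuity on a segment *)

Section step_functions.
Context (R : realType).
Notation leb := (@lebesgue_measure R).

Lemma measurable_step (u : nat -> R) (c : R) :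
  measurable_fun setT (fun s : R => u (Num.truncn (s * c))).
Proof.
move=> _ Y mY; rewrite setTI.
have -> : (fun s : R => u (Num.truncn (s * c))) @^-1` Y =
    \bigcup_(k in [set k | Y (u k)])
      ([set s | (k%:R <= (Num.truncn (s * c))%:R :> R)%R] `&`
       [set s | ((Num.truncn (s * c))%:R < k.+1%:R :> R)%R]).
  apply/seteqP; split => s /=.
    move=> Ys; exists (Num.truncn (s * c)) => //=; split; first by [].
    by rewrite /= ltr_nat.
  by move=> [k /= Yk]; rewrite ler_nat ltr_nat ltnS => -[k1 k2];
    rewrite (_ : Num.truncn _ = k)//; apply/eqP; rewrite eqn_leq k1 k2.
have mtr : measurable_fun setT (fun s : R => (Num.truncn (s * c))%:R : R).
  have mfl : measurable_fun setT (fun x : R => (Num.truncn x)%:R : R).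
    by apply: nondecreasing_measurable => // x y xy; rewrite ler_nat le_truncn.
  have mc : measurable_fun setT (fun s : R => s * c) by exact: measurable_funM.
  exact: (measurableT_comp mfl mc).
apply: bigcup_measurable => k _; apply: measurableI.
  rewrite -[X in measurable X]setTI.
  have -> : [set s | (k%:R <= (Num.truncn (s * c))%:R :> R)%R] =
    (fun s : R => (Num.truncn (s * c))%:R : R) @^-1` `[k%:R, +oo[%classic.
    by apply/seteqP; split => x /=; rewrite in_itv/= andbT.
  exact: mtr.
rewrite -[X in measurable X]setTI.
have -> : [set s | ((Num.truncn (s * c))%:R < k.+1%:R :> R)%R] =
  (fun s : R => (Num.truncn (s * c))%:R : R) @^-1` `]-oo, k.+1%:R[%classic.
  by apply/seteqP; split => x /=; rewrite in_itv.
exact: mtr.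
Qed.

Lemma Rintegral_step (u : nat -> R) (C h : R) (n : nat) : 0 < h ->
  (forall k, `|u k| <= C) ->
  \int[leb]_(s in [set s | 0 <= s <= n%:R * h]) u (Num.truncn (s * h^-1)) =
  h * \sum_(k < n) u k.
Proof.
move=> h0 uC; set g := fun s : R => u (Num.truncn (s * h^-1)).
have mg : measurable_fun setT g by exact: measurable_step.
have ig (a b : R) b0 b1 : leb.-integrable [set` Interval (BSide b0 a) (BSide b1 b)] (EFin \o g).
  have fin : (leb [set` Interval (BSide b0 a) (BSide b1 b)] < +oo)%E.
    by rewrite lebesgue_measure_itv/=; case: ifPn => // _; rewrite -EFinD ltry.
  apply: (@integrable_bounded _ _ _ leb _ g C) => //; first exact: measurable_funTS.
  by move=> x _; exact: uC.
(* The right endpoint is dropped: there the truncation already equals [n], an index outside the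
   sum. *)
rewrite set_leleE -Rintegral_itv_bndo_bndc//.
elim: n => [|n IH].
  by rewrite mul0r big_ord0 mulr0 set_itv_ge ?bnd_simp// Rintegral_set0.
rewrite (@itv_bndbnd_setU _ _ _ (BLeft (n%:R * h))); last 2 first.
- by rewrite bnd_simp mulr_ge0// ltW.
- by rewrite bnd_simp ler_wpM2r ?ler_nat// ltW.
rewrite Rintegral_setU//=; last 2 first.
- rewrite -itv_bndbnd_setU ?bnd_simp; first exact: ig.
    by rewrite mulr_ge0// ltW.
  by rewrite ler_wpM2r ?ler_nat// ltW.
- apply/disj_setPS => y [/=]; rewrite !in_itv/= => /andP[_ yx] /andP[].
  by rewrite leNgt yx.
rewrite IH big_ord_recr/= mulrDr; congr (_ + _).
rewrite (@eq_Rintegral _ _ _ _ _ (cst (u n))); last first.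
  move=> x; rewrite inE/= in_itv/= => /andP[x1 x2]; congr u.
  apply: truncn_def; rewrite ler_pdivlMr// x1/=.
  by rewrite ltr_pdivrMr.
rewrite Rintegral_cst//= lebesgue_measure_itv/= lte_fin ltr_pM2r// ltr_nat ltnSn.
by rewrite /= -mulrBl -natrB// subSnn mul1r mulrC.
Qed.

Lemma cvg_truncn_mul (c : nat -> R) (s : R) : 0 <= s ->
  (forall n, 0 < c n) -> c n @[n --> \oo] --> 0 ->
  (Num.truncn (s * (c n)^-1))%:R * c n @[n --> \oo] --> s.
Proof.
move=> s0 c0 cc; apply/cvgrPdist_le => e e0; near=> n.
have cn : 0 < c n by exact: c0.
have cn' : 0 <= (c n)^-1 by rewrite invr_ge0 ltW.
have /andP[k1 k2] := truncn_itv (mulr_ge0 s0 cn').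
move: k1 k2; rewrite ler_pdivlMr// ltr_pdivrMr// -natr1 mulrDl mul1r => k1 k2.
rewrite ger0_norm ?subr_ge0// lerBlDl (le_trans (ltW k2))// lerD2l.
near: n; move/cvgrPdist_le : cc => /(_ e e0); apply: filterS => n.
by rewrite sub0r normrN ger0_norm// ltW.
Unshelve. all: by end_near. Qed.

Lemma cvgn_min_succ (T s : R) : 0 <= s <= T ->
  (fun n : nat => Num.min T ((Num.truncn (s * n.+1%:R)).+1%:R / n.+1%:R)) @ \oo --> s.
Proof.
move=> /andP[s0 sT]; apply/cvgrPdist_le => e e0; near=> n.
have /andP[k1 k2] := truncn_itv (mulr_ge0 s0 (ler0n R n.+1)).
have n0 : 0 < n.+1%:R :> R by [].
have sle : s <= Num.min T ((Num.truncn (s * n.+1%:R)).+1%:R / n.+1%:R).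
  by rewrite le_min sT/= ler_pdivlMr// ltW.
rewrite distrC ger0_norm ?subr_ge0// lerBlDl ge_min; apply/orP; right.
rewrite ler_pdivrMr// mulrDl -natr1 lerD// -ler_pdivrMr// mul1r ltW//.
by near: n; exact: near_infty_natSinv_lt (PosNum e0).
Unshelve. all: by end_near. Qed.

(* Right-continuity, phrased with sequences converging from the right inside [0, T]. *)
Lemma right_continuous_measurable (T : R) (u : R -> R) : 0 <= T ->
  (forall r (r_ : nat -> R), 0 <= r <= T -> (forall n, r <= r_ n <= T) ->
    r_ @ \oo --> r -> u (r_ n) @[n --> \oo] --> u r) ->
  measurable_fun [set r | 0 <= r <= T] u.
Proof.
move=> T0 ru.
(* Rounding up to the next grid point, capped at [T], approaches [r] from the right, so
   right-continuity makes [u] a limit of step functions. *)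
pose u_ (n : nat) (r : R) := u (Num.min T ((Num.truncn (r * n.+1%:R)).+1%:R / n.+1%:R)).
have mu_ n : measurable_fun [set r | 0 <= r <= T] (u_ n).
  apply: measurable_funTS.
  exact: (measurable_step (fun k => u (Num.min T (k.+1%:R / n.+1%:R)))).
refine (measurable_fun_cvg mu_ _).
move=> r /= rT; have /andP[r0 rT'] := rT; apply: ru => //; last exact: cvgn_min_succ.
move=> n; rewrite ge_min lexx/= andbT le_min rT'/= ler_pdivlMr//.
by have /andP[_ /ltW] := truncn_itv (mulr_ge0 r0 (ler0n R n.+1)).
Qed.

Lemma uniform_continuity_segment (T : R) (f : R -> R) :
  {within `[0, T], continuous f} ->
  forall e : R, 0 < e -> exists2 del : R, 0 < del &
    forall x y : R, 0 <= x <= T -> 0 <= y <= T -> `|x - y| <= del -> `|f x - f y| <= e.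
Proof.
move=> /subspace_continuousP fc e e0.
have := @segment_compact R 0 T => /compact_near_coveringP.
move=> /(_ R (0^'+) (fun del x => forall y, 0 <= x <= T -> 0 <= y <= T ->
   `|x - y| <= del -> `|f x - f y| <= e) _).
have H x : `[0, T]%classic x -> \forall x' \near x & del \near 0^'+,
    forall y, 0 <= x' <= T -> 0 <= y <= T -> `|x' - y| <= del -> `|f x' - f y| <= e.
  move=> xT; have /cvgrPdist_le /(_ (e / 2)) := fc x xT.
  rewrite divr_gt0// => /(_ isT) [r /= r0 rP].
  (* Half the radius for [x'] and half for [del] keep both [x'] and [y] within [r] of [x]. *)
  exists ([set x' | `|x - x'| < r / 2], [set del | del < r / 2]).
    split; last by apply: nbhs_right_lt; rewrite divr_gt0.
    by exists (r / 2); rewrite /= ?divr_gt0.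
  move=> [x' del] [/= xx' dr] y x'T yT x'y.
  have A : `|f x - f x'| <= e / 2.
    by apply: rP; rewrite /= ?in_itv//=; apply: lt_le_trans xx' _; lra.
  have B : `|f x - f y| <= e / 2.
    apply: rP; rewrite /= ?in_itv//=.
    by rewrite (le_lt_trans (ler_distD x' _ _))//; lra.
  by rewrite (le_trans (ler_distD (f x) _ _))// (distrC _ (f x)); lra.
move=> /(_ H)[del0 /= del00 dP].
exists (del0 / 2); first by rewrite divr_gt0.
move=> x y xT yT xy; apply: (dP (del0 / 2)) => //=.
- by rewrite sub0r normrN ger0_norm ?ltW ?divr_gt0//; lra.
- by rewrite divr_gt0.
Qed.

End step_functions.

(** * Taylor expansion, exponential bounds and limits of sequences *)

Section taylor.
Context (R : realType).

(* Rolle's theorem for the remainder whose quadratic coefficient is chosen so that it vanishes at both ends. *)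
Lemma taylor_lagrange2 (f : R -> R) (a d : R) :
  (forall x, derivable f x 1) -> (forall x, derivable (derive1 f) x 1) ->
  exists2 c, `|c - a| <= `|d| &
    f (a + d) = f a + derive1 f a * d + derive1n 2 f c * d ^+ 2 / 2.
Proof.
move=> df ddf.
have [->|d0] := eqVneq d 0.
  by exists a; rewrite ?subrr ?normr0// addr0 mulr0 expr0n/= mulr0 mul0r !addr0.
pose b := a + d.
pose q := (f b - f a - derive1 f a * d) / d ^+ 2.
pose g x := f b - f x - derive1 f x * (b - x) - q * (b - x) ^+ 2.
have ga : g a = 0.
  rewrite /g /q (_ : b - a = d) ?divfK ?subrr ?expf_neq0//.
  by rewrite /b addrAC subrr add0r.
have gb : g b = 0 by rewrite /g !subrr expr0n/= !mulr0 !subr0.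
have idf (x : R) : is_derive x 1 f (derive1 f x).
  by rewrite derive1E; exact: derivableP.
have iddf (x : R) : is_derive x 1 (derive1 f) (derive1n 2 f x).
  by rewrite derive1nS/= derive1E; exact: derivableP.
have idg (x : R) : is_derive x 1 g (- derive1n 2 f x * (b - x) + 2 * q * (b - x)).
  rewrite /g; apply: is_derive_eq.
  rewrite /GRing.scale/= !(mulr1, scaler0, sub0r, add0r, addr0).
  by ring.
have dg (x : R) : derivable g x 1 by case: (idg x).
have cg x y : {within `[x, y], continuous g}.
  apply: continuous_subspaceT => z.
  by apply/differentiable_continuous/derivable1_diffP; case: (idg z).
have main c : (- derive1n 2 f c * (b - c) + 2 * q * (b - c)) = 0 -> b - c != 0 ->
    f (a + d) = f a + derive1 f a * d + derive1n 2 f c * d ^+ 2 / 2.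
  move=> E bc.
  have qE : derive1n 2 f c = 2 * q.
    apply: (mulIf bc); lra.
  have qd : q * d ^+ 2 = f b - f a - derive1 f a * d by rewrite /q divfK ?expf_neq0.
  have -> : derive1n 2 f c * d ^+ 2 / 2 = q * d ^+ 2 by rewrite qE; field.
  by rewrite qd /b; ring.
have [d1|d1] : d < 0 \/ 0 < d by apply/orP; rewrite -neq_lt.
- have [||c] := @Rolle _ g b a _ (fun x _ => dg x) (cg _ _) _.
  + by rewrite /b gtrDl.
  + by rewrite ga gb.
  rewrite in_itv/= => /andP[c1 c2] cg0; exists c.
    by rewrite ltr0_norm ?subr_lt0// ltr0_norm//; move: c1; rewrite /b; lra.
  apply: main; last by rewrite subr_eq0 lt_eqF.
  have H1 := @derive_val _ _ _ _ _ _ _ (idg c).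
  have H2 := @derive_val _ _ _ _ _ _ _ cg0.
  by rewrite -H1 H2.
- have [||c] := @Rolle _ g a b _ (fun x _ => dg x) (cg _ _) _.
  + by rewrite /b ltrDl.
  + by rewrite ga gb.
  rewrite in_itv/= => /andP[c1 c2] cg0; exists c.
    by rewrite gtr0_norm ?subr_gt0// gtr0_norm//; move: c2; rewrite /b; lra.
  apply: main; last by rewrite subr_eq0 gt_eqF.
  have H1 := @derive_val _ _ _ _ _ _ _ (idg c).
  have H2 := @derive_val _ _ _ _ _ _ _ cg0.
  by rewrite -H1 H2.
Qed.

(** The upper bound follows from [1 + x <= expR x] and [(1 + x) * (1 - x + x ^+ 2) = 1 + x ^+ 3 >=
    1]. *)
Lemma expRN_bounds (x : R) : 0 <= x -> 1 - x <= expR (- x) <= 1 - x + x ^+ 2.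
Proof.
move=> x0; apply/andP; split; first exact: expR_ge1Dx.
rewrite expRN invf_ple ?posrE ?expR_gt0//; last by nra.
apply: le_trans (expR_ge1Dx x); rewrite -div1r ler_pdivrMr; last by nra.
by nra.
Qed.

Lemma cvgnD (u v : nat -> R) (a c : R) : u @ \oo --> a -> v @ \oo --> c ->
  (fun n => u n + v n) @ \oo --> a + c.
Proof. by move=> ua vc; exact: cvgD. Qed.

Lemma cvgnM (u v : nat -> R) (a c : R) : u @ \oo --> a -> v @ \oo --> c ->
  (fun n => u n * v n) @ \oo --> a * c.
Proof. by move=> ua vc; exact: cvgM. Qed.

Lemma cvgn_cst (a : R) : (fun=> a) @ \oo --> a.
Proof. exact: cvg_cst. Qed.

End taylor.

Arguments cvgn_cst {R} a.

(** * First and second moments of the standard Gaussian *)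

Section gaussian_moments.
Context (R : realType).
Notation leb := (@lebesgue_measure R).
Notation phi := (@normal_pdf R 0 1).

Lemma std_normal_pdfE (x : R) : phi x = normal_peak 1 * expR (- x ^+ 2 / 2).
Proof. by rewrite normal_pdfE ?oner_neq0// /normal_fun subr0 expr1n. Qed.

Lemma is_derive_std_normal_pdf (x : R) : is_derive x 1 phi (- x * phi x).
Proof.
have -> : phi = (fun x : R => normal_peak 1 * expR (- x ^+ 2 / 2)).
  by apply/funext => y; rewrite std_normal_pdfE.
have D : is_derive x 1 (fun y : R => - y ^+ 2 / 2) (- x).
  apply: is_derive_eq.
  by rewrite /GRing.scale/= !(mulr1, scaler0, sub0r, add0r, addr0); field.
have E : is_derive x 1 (fun y : R => expR (- y ^+ 2 / 2)) (- x * expR (- x ^+ 2 / 2)).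
  have H := @is_derive1_comp R expR (fun y : R => (- y ^+ 2 / 2 : R)) x _ _
    (is_derive_expR (- x ^+ 2 / 2)) D.
  by rewrite mulrC; exact: H.
apply: is_derive_eq.
by rewrite /GRing.scale/=; ring.
Qed.

Lemma continuous_std_normal_pdf : continuous phi.
Proof. by apply: continuous_normal_pdf; rewrite oner_neq0. Qed.

Let itvn (n : nat) := `[- n.+1%:R, n.+1%:R : R]%classic.

Let itvn_nd : nondecreasing_seq itvn.
Proof.
move=> m n mn; rewrite subsetEset => x; rewrite /itvn/= !in_itv/= => /andP[x1 x2].
have mn' : m.+1%:R <= n.+1%:R :> R by rewrite ler_nat.
by rewrite (le_trans _ x1) ?lerN2//= (le_trans x2).
Qed.

Let itvnT : \bigcup_n itvn n = setT.
Proof.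
apply/seteqP; split => // x _; exists (Num.truncn `|x|) => //.
by rewrite /itvn/= in_itv/= -ler_norml ltW// truncnS_gt.
Qed.

Let FTC_itvn (F f : R -> R) (n : nat) : continuous f ->
  (forall x : R, is_derive x 1 F (f x)) ->
  (\int[leb]_(x in itvn n) (f x)%:E = (F n.+1%:R - F (- n.+1%:R))%:E)%E.
Proof.
move=> cf dF; rewrite EFinB; apply: continuous_FTC2.
- by rewrite (@lt_trans _ _ 0)// oppr_lt0.
- exact: continuous_subspaceT.
- have cF x : F y @[y --> x] --> F x.
    by apply/differentiable_continuous/derivable1_diffP; case: (dF x).
  split; first by move=> x _; case: (dF x).
    exact: cvg_at_right_filter.
  exact: cvg_at_left_filter.
- by move=> x _; rewrite derive1E; exact: derive_val.
Qed.

Let continuous_x2phi : continuous (fun x : R => x ^+ 2 * phi x).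
Proof.
move=> x; apply: cvgM; last exact: continuous_std_normal_pdf.
exact: exprn_continuous.
Qed.

Let continuous_xphi : continuous (fun x : R => x * phi x).
Proof. by move=> x; apply: cvgM; [exact: cvg_id|exact: continuous_std_normal_pdf]. Qed.

(** The crude bound [1 + x <= expR x] at [x = n ^ 2 / 2] already gives decay of order [1 / n],
    enough for the boundary term of the integration by parts. *)
Let nphi_cvg : (n.+1%:R * phi n.+1%:R) @[n --> \oo] --> (0 : R).
Proof.
apply: (@squeeze_cvgr _ _ _ _ (fun=> 0) (fun n => 2 * normal_peak 1 * n.+1%:R^-1)).
- near=> n; rewrite mulr_ge0 ?normal_pdf_ge0//= std_normal_pdfE.
  rewrite mulrCA (mulrC 2) -mulrA ler_wpM2l ?normal_peak_ge0//.
  rewrite mulNr expRN ler_pdivrMr ?expR_gt0//.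
  rewrite mulrAC ler_pdivlMr//.
  by have := expR_ge1Dx (n.+1%:R ^+ 2 / 2 : R); rewrite expr2; lra.
- exact: cvg_cst.
- rewrite -[X in _ --> X](mulr0 (2 * normal_peak 1)); apply: cvgM; first exact: cvg_cst.
  exact: cvg_harmonic.
Unshelve. all: by end_near. Qed.

(** Integration by parts: [x * phi x] has derivative [phi x - x ^+ 2 * phi x], so on [[-n, n]] the
    second moment is the Gaussian mass minus [2 * n * phi n]. *)
Lemma std_normal_second_moment :
  (\int[leb]_x (x ^+ 2 * phi x)%:E = 1)%E.
Proof.
have mf (f : R -> R) i : continuous f -> measurable_fun (itvn i) (EFin \o f).
  move=> cf; apply/measurable_EFinP; apply: measurable_funTS; exact: continuous_measurable_fun.
have x2phi0 (i : nat) (x : R) : itvn i x -> (0 <= (x ^+ 2 * phi x)%:E)%E.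
  by move=> _; rewrite lee_fin mulr_ge0 ?sqr_ge0 ?normal_pdf_ge0.
have phi0 (i : nat) (x : R) : itvn i x -> (0 <= (phi x)%:E)%E.
  by move=> _; rewrite lee_fin normal_pdf_ge0.
have mI i : measurable (itvn i : set (measurableTypeR R)) by exact: measurable_itv.
have c1 := @ge0_nondecreasing_set_cvg_integral _ (measurableTypeR R) R itvn _ leb itvn_nd mI
  (fun i => mf _ i continuous_x2phi) x2phi0.
have c2 := @ge0_nondecreasing_set_cvg_integral _ (measurableTypeR R) R itvn _ leb itvn_nd mI
  (fun i => mf _ i continuous_std_normal_pdf) phi0.
rewrite itvnT in c1 c2; rewrite integral_normal_pdf in c2.
have E i : (\int[leb]_(x in itvn i) (x ^+ 2 * phi x)%:E)%E =
    (\int[leb]_(x in itvn i) (phi x)%:E - (2 * (i.+1%:R * phi i.+1%:R))%:E)%E.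
  have ic (f : R -> R) : continuous f -> leb.-integrable (itvn i) (EFin \o f).
    move=> cf; apply: continuous_compact_integrable; first exact: segment_compact.
    exact: continuous_subspaceT.
  have phiN : phi (- i.+1%:R) = phi i.+1%:R by rewrite !std_normal_pdfE sqrrN.
  have <- : (\int[leb]_(x in itvn i) (phi x - x ^+ 2 * phi x)%:E =
      (2 * (i.+1%:R * phi i.+1%:R))%:E)%E.
    have cf : continuous (fun x : R => phi x - x ^+ 2 * phi x).
      by move=> x; apply: cvgB; [exact: continuous_std_normal_pdf|exact: continuous_x2phi].
    have dF (x : R) : is_derive x 1 (fun x : R => x * phi x) (phi x - x ^+ 2 * phi x).
      have dphi := is_derive_std_normal_pdf x.
      by apply: is_derive_eq; rewrite /GRing.scale/=; ring.
    by rewrite (FTC_itvn _ cf dF) phiN; congr EFin; ring.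
  have i1 := ic _ continuous_std_normal_pdf.
  have i2 := ic _ continuous_x2phi.
  have fin1 := integrable_fin_num (mI i) i1.
  have fin2 := integrable_fin_num (mI i) i2.
  rewrite (integralB_EFin (mI i) i1 i2).
  by rewrite -(fineK fin1) -(fineK fin2) -!EFinB; congr EFin; ring.
have c3 : (2 * (i.+1%:R * phi i.+1%:R))%:E @[i --> \oo] --> 0%:E.
  apply: cvg_EFin; first exact: nearW.
  by rewrite -[X in _ --> X](mulr0 2); apply: cvgM; [exact: cvg_cst|exact: nphi_cvg].
have c4 : (\int[leb]_(x in itvn i) (x ^+ 2 * phi x)%:E)%E @[i --> \oo] --> (1 - 0%:E)%E.
  by under eq_fun do rewrite E; apply: cvgeB.
by rewrite -(cvg_lim _ c1)// (cvg_lim _ c4)// sube0.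
Qed.

Lemma integrable_std_normal_second_moment :
  leb.-integrable setT (EFin \o (fun x => x ^+ 2 * phi x)).
Proof.
apply/integrableP; split.
  by apply/measurable_EFinP; exact: (continuous_measurable_fun continuous_x2phi).
suff -> : (\int[leb]_x `|(EFin \o (fun x : R => x ^+ 2 * phi x)%R) x| = 1)%E by rewrite ltry.
rewrite -std_normal_second_moment; apply: eq_integral => x _.
by rewrite /= ger0_norm// mulr_ge0 ?sqr_ge0 ?normal_pdf_ge0.
Qed.

Lemma integrable_std_normal_pdf : leb.-integrable setT (EFin \o phi).
Proof. exact: integrable_normal_pdf. Qed.

Lemma integrable_std_normal_first_moment :
  leb.-integrable setT (EFin \o (fun x => x * phi x)).
Proof.
apply: (@le_integrable _ _ _ leb setT measurableT _
    (fun x : R => (phi x)%:E + (x ^+ 2 * phi x)%:E)%E).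
- by apply/measurable_EFinP; exact: (continuous_measurable_fun continuous_xphi).
- move=> x _ /=; rewrite lee_fin normrM (ger0_norm (normal_pdf_ge0 _ _ _)).
  (* Domination by [|x| <= 1 + x ^+ 2], from the square of [|x| - 1]. *)
  apply: le_trans (ler_norm _).
  have := normal_pdf_ge0 0 1 x; have := sqr_ge0 (`|x| - 1).
  by rewrite sqrrB1 real_normK ?num_real//; nra.
- apply: integrableD => //; first exact: integrable_std_normal_pdf.
  exact: integrable_std_normal_second_moment.
Qed.

(** The antiderivative [- phi] is even, so the integral vanishes on every symmetric interval;
    dominated convergence passes to the line. *)
Lemma std_normal_first_moment : \int[leb]_x (x * phi x) = 0.
Proof.
have mr n : measurable_fun setT ((fun x : R => x * phi x) \_ (itvn n)).
  apply/measurable_restrict => //; first exact: measurable_itv.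
  apply: measurable_funTS.
  exact: (continuous_measurable_fun continuous_xphi).
have /cvg_lim <-// : \int[leb]_x (((fun x : R => x * phi x) \_ (itvn n)) x) @[n --> \oo] --> \int[leb]_x (x * phi x).
  apply: (@Rintegral_dominated_cvg _ _ _ leb _ _ _ (fun x : R => `|x * phi x|)) => //.
  - exact: (continuous_measurable_fun continuous_xphi).
  - by apply: integrable_norm; exact: integrable_std_normal_first_moment.
  - apply: aeW => x _; have : (\bigcup_n itvn n) x by rewrite itvnT.
    move=> [N _ xN]; apply: cvg_near_cst; near=> n; rewrite /patch mem_set//.
    have : (itvn N <= itvn n)%O by apply: itvn_nd; near: n; exact: nbhs_infty_ge.
    by rewrite subsetEset; exact.
  - by move=> n x _; rewrite /patch; case: ifP => // _; rewrite normr0.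
rewrite (_ : (fun n => _) = cst 0) ?lim_cst//; apply/funext => n.
have dF (x : R) : is_derive x 1 (fun x : R => - phi x) (x * phi x).
  have dphi := is_derive_std_normal_pdf x.
  by apply: is_derive_eq; rewrite mulNr opprK.
rewrite -Rintegral_mkcond /Rintegral (FTC_itvn _ continuous_xphi dF).
by rewrite !std_normal_pdfE sqrrN subrr.
Unshelve. all: by end_near. Qed.

End gaussian_moments.

(** * One Euler step and its approximate generator *)

Section generator.
Context (R : realType) (f : R -> R) (C : R).
Notation leb := (@lebesgue_measure R).
Notation phi := (@normal_pdf R 0 1).
Context (df : forall x, derivable f x 1) (ddf : forall x, derivable (derive1 f) x 1).
Context (cddf : continuous (derive1n 2 f)).
Context (fC : forall x, `|f x| <= C) (dfC : forall x, `|derive1 f x| <= C)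
  (ddfC : forall x, `|derive1n 2 f x| <= C).

(** Discounted payoff of one Euler step from [u]: [beta] and [kappa] are the drift and the killing
    rate frozen at its start, [y] is the Brownian increment. *)
Definition shifted (h beta kappa u y : R) :=
  expR (- (kappa * h)) * f (u + beta * h + Num.sqrt 2 * y).

(** The increment is [Num.sqrt h * z] with [z] standard Gaussian. The linear noise term is removed
    because, divided by [h], it is of order [h ^ (-1/2)] and would prevent a domination uniform in
    [h]; its mean is zero. *)
Definition quotient (h beta kappa u z : R) :=
  (shifted h beta kappa u (Num.sqrt h * z) - f u -
    derive1 f u * (Num.sqrt 2 * (Num.sqrt h * z))) / h.

(** In [del ^+ 2 / h] only [2 * z ^+ 2] survives as [h] tends to 0. With Taylor's factor 1/2 it
    leaves the second derivative times [z ^+ 2], of mean one: this is why the noise [Num.sqrt 2 * W]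
    yields the Laplacian with coefficient 1. *)
Lemma quotientE (h beta kappa u z : R) : 0 < h ->
  let del := beta * h + Num.sqrt 2 * (Num.sqrt h * z) in
  exists2 xi, `|xi - u| <= `|del| &
    quotient h beta kappa u z =
    (expR (- (kappa * h)) - 1) / h * f (u + del) + derive1 f u * beta +
    derive1n 2 f xi * (beta ^+ 2 * h + 2 * Num.sqrt 2 * beta * Num.sqrt h * z + 2 * z ^+ 2) / 2.
Proof.
move=> h0 del; have [xi xi1 xi2] := taylor_lagrange2 u del df ddf.
have uE : u + beta * h + Num.sqrt 2 * (Num.sqrt h * z) = u + del by rewrite /del addrA.
exists xi => //; rewrite /quotient /shifted uE.
have s2 : Num.sqrt 2 ^+ 2 = 2 :> R by rewrite sqr_sqrtr.
have sh : Num.sqrt h ^+ 2 = h by rewrite sqr_sqrtr// ltW.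
have delE : del ^+ 2 / h = beta ^+ 2 * h + 2 * Num.sqrt 2 * beta * Num.sqrt h * z + 2 * z ^+ 2.
  have -> : del ^+ 2 = beta ^+ 2 * h ^+ 2 + 2 * Num.sqrt 2 * beta * h * Num.sqrt h * z +
    Num.sqrt 2 ^+ 2 * Num.sqrt h ^+ 2 * z ^+ 2 by rewrite /del; ring.
  by rewrite s2 sh; field; rewrite gt_eqF.
rewrite -delE.
have -> : expR (- (kappa * h)) * f (u + del) =
  (expR (- (kappa * h)) - 1) * f (u + del) + f (u + del) by ring.
rewrite [X in _ + X - f u]xi2 /del.
by field; rewrite gt_eqF.
Qed.

Lemma expRN_quot_bound (h kappa : R) : 0 < h -> 0 <= kappa ->
  `|(expR (- (kappa * h)) - 1) / h| <= kappa /\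
  `|(expR (- (kappa * h)) - 1) / h + kappa| <= kappa ^+ 2 * h.
Proof.
move=> h0 k0; have kh : 0 <= kappa * h by rewrite mulr_ge0// ltW.
have /andP[e1 e2] := expRN_bounds kh.
have e3 : expR (- (kappa * h)) <= 1 by rewrite -expR0 ler_expR oppr_le0.
have -> : (expR (- (kappa * h)) - 1) / h + kappa = (expR (- (kappa * h)) - 1 + kappa * h) / h.
  by field; rewrite gt_eqF.
split; rewrite normrM (ger0_norm (_ : 0 <= h^-1)) ?invr_ge0 ?(ltW h0)// ler_pdivrMr//.
  by rewrite ler_norml; apply/andP; split; lra.
by rewrite ler_norml; apply/andP; split; [lra|]; move: e2; rewrite exprMn !expr2; lra.
Qed.

Context (B k1 : R).

(** The bound is free of [h] and quadratic in [z], hence integrable against the Gaussian: it is the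
    dominating function for the limit of small steps. *)
Lemma quotient_bound (h beta kappa u z : R) : 0 < h <= 1 -> `|beta| <= B -> 0 <= kappa <= k1 ->
  `|quotient h beta kappa u z| <= C * (k1 + B + B ^+ 2) + 2 * C * z ^+ 2.
Proof.
move=> /andP[h0 h1] bB /andP[k0 kk1].
have [xi _ ->] := quotientE beta kappa u z h0.
set del := _ + _ * (_ * z).
have C0 : 0 <= C by exact: le_trans (normr_ge0 _) (fC u).
have [e1 _] := expRN_quot_bound h0 k0.
have T1 : `|(expR (- (kappa * h)) - 1) / h * f (u + del)| <= C * k1.
  rewrite normrM mulrC; apply: ler_pM => //; exact: le_trans e1 kk1.
have T2 : `|derive1 f u * beta| <= C * B by rewrite normrM; apply: ler_pM.
set q := (_ ^+ 2 * h + _ + _).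
have B0 : 0 <= B by exact: le_trans bB.
have s2 : Num.sqrt 2 ^+ 2 = 2 :> R by rewrite sqr_sqrtr.
have sh : Num.sqrt h ^+ 2 = h by rewrite sqr_sqrtr// ltW.
have bB2 : beta ^+ 2 <= B ^+ 2.
  by move: bB; rewrite ler_norml => /andP[b1 b2]; rewrite !expr2; nra.
(* [q] is the square of [beta * Num.sqrt h + Num.sqrt 2 * z], and a squared sum is at most twice the
   sum of the squares. *)
have q0 : `|q| <= 2 * B ^+ 2 + 4 * z ^+ 2.
  have qE : q = (beta * Num.sqrt h + Num.sqrt 2 * z) ^+ 2.
    by rewrite sqrrD !exprMn s2 sh /q -mulr_natl; ring.
  rewrite qE ger0_norm ?sqr_ge0//.
  have := sqr_ge0 (beta * Num.sqrt h - Num.sqrt 2 * z).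
  rewrite sqrrB sqrrD !exprMn s2 sh.
  have : beta ^+ 2 * h <= B ^+ 2 * 1 by apply: ler_pM => //; [exact: sqr_ge0|exact: ltW].
  lra.
have T3 : `|derive1n 2 f xi * q / 2| <= C * (B ^+ 2 + 2 * z ^+ 2).
  rewrite -mulrA normrM; apply: ler_pM => //.
  by rewrite normrM (ger0_norm (_ : 0 <= 2^-1))//; lra.
rewrite (le_trans (ler_normD _ _))// (le_trans (lerD (ler_normD _ _) (lexx _)))//.
lra.
Qed.

Lemma derivable_continuous (g : R -> R) : (forall x, derivable g x 1) -> continuous g.
Proof. by move=> dg z; exact/differentiable_continuous/derivable1_diffP. Qed.

Lemma continuous_shifted (h beta kappa u : R) : continuous (shifted h beta kappa u).
Proof.
move=> y; apply: cvgM; first exact: cvg_cst.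
apply: (@cvg_comp _ _ _ (fun y => u + beta * h + Num.sqrt 2 * y) f); last exact: (derivable_continuous df).
by apply: cvgD; [exact: cvg_cst|apply: cvgM; [exact: cvg_cst|exact: cvg_id]].
Qed.

Lemma continuous_quotient (h beta kappa u : R) : continuous (quotient h beta kappa u).
Proof.
move=> z; have cs : Num.sqrt h * y @[y --> z] --> Num.sqrt h * z.
  by apply: cvgM; [exact: cvg_cst|exact: cvg_id].
apply: cvgM; last exact: cvg_cst.
apply: cvgB; last by apply: cvgM; [exact: cvg_cst|apply: cvgM; [exact: cvg_cst|exact: cs]].
apply: cvgB; last exact: cvg_cst.
by apply: (@cvg_comp _ _ _ (fun y => Num.sqrt h * y) (shifted h beta kappa u)); [exact: cs|exact: continuous_shifted].
Qed.

Lemma measurable_quotient_pdf (h beta kappa u : R) :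
  measurable_fun setT (fun z => quotient h beta kappa u z * phi z).
Proof.
apply: measurable_funM; last exact: measurable_normal_pdf.
exact: (continuous_measurable_fun (@continuous_quotient _ _ _ _)).
Qed.

Lemma integrable_quadratic_pdf (a b : R) :
  leb.-integrable setT (EFin \o (fun z : R => (a + b * z ^+ 2) * phi z)).
Proof.
have -> : EFin \o (fun z : R => (a + b * z ^+ 2) * phi z) =
    (fun z => a%:E * (EFin \o phi) z + b%:E * (EFin \o (fun z => (z ^+ 2 * phi z)%R)) z)%E.
  by apply/funext => z /=; rewrite -!EFinM -EFinD; congr EFin; ring.
apply: integrableD => //; apply: integrableZl => //.
  exact: integrable_std_normal_pdf.
exact: integrable_std_normal_second_moment.
Qed.

Lemma Rintegral_quadratic_pdf (a b : R) :
  \int[leb]_z ((a + b * z ^+ 2) * phi z) = a + b.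
Proof.
have i1 := @integrable_std_normal_pdf R.
have i2 := @integrable_std_normal_second_moment R.
under eq_Rintegral do rewrite mulrDl -(mulrA b).
rewrite RintegralD//.
- rewrite RintegralZl// RintegralZl//.
  rewrite {1}/Rintegral integral_normal_pdf/= mulr1.
  by rewrite /Rintegral std_normal_second_moment/= mulr1.
- by apply: (integrableZl measurableT a i1).
- by apply: (integrableZl measurableT b i2).
Qed.

Lemma integrable_quotient_pdf (h beta kappa u : R) :
  0 < h <= 1 -> `|beta| <= B -> 0 <= kappa <= k1 ->
  leb.-integrable setT (EFin \o (fun z => quotient h beta kappa u z * phi z)).
Proof.
move=> hh bB kk.
apply: (le_integrable measurableT _ _ (integrable_quadratic_pdf (C * (k1 + B + B ^+ 2)) (2 * C))).
  by apply/measurable_EFinP; exact: measurable_quotient_pdf.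
move=> z _ /=; rewrite lee_fin normrM [X in _ <= X]normrM ler_wpM2r//.
exact: (le_trans (quotient_bound u z hh bB kk) (ler_norm _)).
Qed.

(** The linear term taken out of [quotient] has Gaussian mean zero, so the one-step expectation is
    recovered exactly, with no remainder. *)
Lemma one_stepE (h beta kappa u : R) : 0 < h <= 1 -> `|beta| <= B -> 0 <= kappa <= k1 ->
  \int[leb]_z (shifted h beta kappa u (Num.sqrt h * z) * phi z) =
  f u + h * \int[leb]_z (quotient h beta kappa u z * phi z).
Proof.
move=> hh bB kk; have /andP[h0 _] := hh.
have i0 := @integrable_std_normal_pdf R.
have i1 := @integrable_std_normal_first_moment R.
have iq := integrable_quotient_pdf u hh bB kk.
pose c := derive1 f u * (Num.sqrt 2 * Num.sqrt h).
transitivity (\int[leb]_z ((f u * phi z + c * (z * phi z)) + h * (quotient h beta kappa u z * phi z))).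
  apply: eq_Rintegral => z _; rewrite /quotient /c; field.
  by rewrite gt_eqF.
have j0 := integrableZl measurableT (f u) i0.
have j1 := integrableZl measurableT c i1.
have jq := integrableZl measurableT h iq.
have j01 : leb.-integrable setT (EFin \o (fun z => f u * phi z + c * (z * phi z))).
  exact (integrableD measurableT j0 j1).
rewrite (RintegralD measurableT j01 jq).
rewrite (RintegralD measurableT j0 j1) !RintegralZl//.
by rewrite std_normal_first_moment mulr0 addr0 {1}/Rintegral integral_normal_pdf/= mulr1.
Qed.

Lemma quotient_cvg (h beta kappa u : nat -> R) (bet kap x z : R) :
  (forall n, 0 < h n) -> (forall n, 0 <= kappa n <= k1) ->
  h @ \oo --> 0 -> beta @ \oo --> bet -> kappa @ \oo --> kap -> u @ \oo --> x ->
  quotient (h n) (beta n) (kappa n) (u n) z @[n --> \oo] -->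
  (- kap * f x + derive1 f x * bet) + derive1n 2 f x * z ^+ 2.
Proof.
move=> h0 kk ch cb ck cu.
have H n := quotientE (beta n) (kappa n) (u n) z (h0 n).
pose del n := beta n * h n + Num.sqrt 2 * (Num.sqrt (h n) * z).
(* The Taylor points are chosen for all [n] at once; lying within [|del n|] of [u n], they converge
   to [x], where the second derivative is continuous. *)
have [xi xiP] : {xi : nat -> R & forall n, `|xi n - u n| <= `|del n| /\
    quotient (h n) (beta n) (kappa n) (u n) z =
    (expR (- (kappa n * h n)) - 1) / h n * f (u n + del n) + derive1 f (u n) * beta n +
    derive1n 2 f (xi n) * (beta n ^+ 2 * h n + 2 * Num.sqrt 2 * beta n * Num.sqrt (h n) * z + 2 * z ^+ 2) / 2}.
  exists (fun n => sval (cid2 (H n))) => n.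
  by case: (cid2 (H n)).
have csh : Num.sqrt (h n) @[n --> \oo] --> (0 : R).
  by rewrite -sqrtr0; apply: (@cvg_comp _ _ _ h Num.sqrt _ _ _ ch); exact: sqrt_continuous.
have cdel : del @ \oo --> (0 : R).
  rewrite (_ : 0 = bet * 0 + Num.sqrt 2 * (0 * z)); last by ring.
  apply: cvgD; first exact: cvgM.
  by apply: cvgM; [exact: cvg_cst|apply: cvgM => //; exact: cvg_cst].
have cxi : xi @ \oo --> x.
  have -> : xi = (fun n => (xi n - u n) + u n) by apply/funext => n; rewrite subrK.
  rewrite -[X in _ --> X]add0r; apply: cvgD => //.
  apply/norm_cvg0P; apply: (@squeeze_cvgr _ _ _ _ (fun=> 0) (fun n => `|del n|)).
  - by apply: nearW => n; rewrite normr_ge0/=; have [] := xiP n.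
  - exact: cvg_cst.
  - by apply/norm_cvg0P.
have ce : (expR (- (kappa n * h n)) - 1) / h n @[n --> \oo] --> - kap.
  have -> : (fun n => (expR (- (kappa n * h n)) - 1) / h n) =
     (fun n => ((expR (- (kappa n * h n)) - 1) / h n + kappa n) - kappa n).
    by apply/funext => n; rewrite addrK.
  rewrite -[X in _ --> X]add0r; apply: cvgB => //.
  apply/norm_cvg0P; apply: (@squeeze_cvgr _ _ _ _ (fun=> 0) (fun n => kappa n ^+ 2 * h n)).
  - apply: nearW => n; rewrite normr_ge0/=.
    by have /andP[k0 _] := kk n; have [] := expRN_quot_bound (h0 n) k0.
  - exact: cvg_cst.
  - by rewrite -[X in _ --> X](mulr0 (kap ^+ 2)); exact: (cvgnM (cvgnM ck ck) ch).
under eq_fun do rewrite (xiP _).2.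
have -> : - kap * f x + derive1 f x * bet + derive1n 2 f x * z ^+ 2 =
  - kap * f (x + 0) + derive1 f x * bet +
  derive1n 2 f x * (bet ^+ 2 * 0 + 2 * Num.sqrt 2 * bet * 0 * z + 2 * z ^+ 2) / 2.
  by rewrite addr0; field.
have cf (g : R -> R) (w : nat -> R) y : continuous g -> w @ \oo --> y -> g (w n) @[n --> \oo] --> g y.
  by move=> cg cw; apply: (@cvg_comp _ _ _ w g _ _ _ cw); exact: cg.
have ca := cf f _ _ (derivable_continuous df) (cvgnD cu cdel).
have cd := cf _ _ _ (derivable_continuous ddf) cu.
have cdd := cf _ _ _ cddf cxi.
have q1 := cvgnM (cvgnM cb cb) ch.
have q2 := cvgnM (cvgnM (cvgnM (cvgn_cst (2 * Num.sqrt 2)) cb) csh) (cvgn_cst z).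
have q := cvgnD (cvgnD q1 q2) (cvgn_cst (2 * z ^+ 2)).
exact: (cvgnD (cvgnD (cvgnM ce ca) (cvgnM cd cb)) (cvgnM (cvgnM cdd q) (cvgn_cst 2^-1))).
Qed.

(** Base point and coefficients vary with [n] because along the scheme the Euler state and the grid
    time move with the mesh. *)
Lemma generator_cvg (h beta kappa u : nat -> R) (bet kap x : R) :
  (forall n, 0 < h n <= 1) -> (forall n, `|beta n| <= B) -> (forall n, 0 <= kappa n <= k1) ->
  h @ \oo --> 0 -> beta @ \oo --> bet -> kappa @ \oo --> kap -> u @ \oo --> x ->
  \int[leb]_z (quotient (h n) (beta n) (kappa n) (u n) z * phi z) @[n --> \oo] -->
  (- kap * f x + derive1 f x * bet) + derive1n 2 f x.
Proof.
move=> hh bB kk ch cb ck cu.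
rewrite -Rintegral_quadratic_pdf.
apply: (@Rintegral_dominated_cvg _ _ _ leb setT _ _
  (fun z => (C * (k1 + B + B ^+ 2) + 2 * C * z ^+ 2) * phi z)) => //.
- by move=> n; exact: measurable_quotient_pdf.
- by have /integrableP[/measurable_EFinP] := integrable_quadratic_pdf (- kap * f x + derive1 f x * bet) (derive1n 2 f x).
- exact: integrable_quadratic_pdf.
- apply: aeW => z _; apply: cvgM; last exact: cvg_cst.
  by apply: quotient_cvg => // n; case/andP: (hh n).
- move=> n z _; rewrite normrM (ger0_norm (normal_pdf_ge0 _ _ _)) ler_wpM2r ?normal_pdf_ge0//.
  exact: quotient_bound.
Qed.

Lemma generator_bound (h beta kappa u : R) :
  0 < h <= 1 -> `|beta| <= B -> 0 <= kappa <= k1 ->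
  `|\int[leb]_z (quotient h beta kappa u z * phi z)| <= C * (k1 + B + B ^+ 2) + 2 * C.
Proof.
move=> hh bB kk; rewrite -(Rintegral_quadratic_pdf (C * (k1 + B + B ^+ 2)) (2 * C)).
have iq := integrable_quotient_pdf u hh bB kk.
apply: le_trans (le_normr_Rintegral measurableT iq) _.
apply: (@le_Rintegral _ _ _ leb setT (fun z => `|quotient h beta kappa u z * phi z|)
  (fun z => (C * (k1 + B + B ^+ 2) + 2 * C * z ^+ 2) * phi z)) => //.
- exact: (integrable_norm iq).
- exact: integrable_quadratic_pdf.
- move=> z _; rewrite normrM (ger0_norm (normal_pdf_ge0 _ _ _)) ler_wpM2r ?normal_pdf_ge0//.
  exact: quotient_bound.
Qed.

End generator.

(** * Gaussian of variance [h] rescaled to the standard one *)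

Section normal_scaling.
Context (R : realType).
Notation leb := (@lebesgue_measure R).
Notation phi := (@normal_pdf R 0 1).

Lemma normal_pdf_scale (s z : R) : 0 < s -> normal_pdf 0 s (s * z) * s = phi z.
Proof.
move=> s0; rewrite !normal_pdfE ?gt_eqF//.
have s2 : s ^+ 2 != 0 by rewrite expf_neq0// gt_eqF.
have -> : normal_fun 0 s (s * z) = normal_fun 0 1 z.
  rewrite /normal_fun !subr0 expr1n -[s ^+ 2 *+ 2]mulr_natr -[1 *+ 2]mulr_natr.
  by congr (expR _); field; rewrite gt_eqF.
have -> : normal_peak s = s^-1 * normal_peak (1 : R).
  rewrite /normal_peak -mulrnAr sqrtrM ?sqr_ge0// sqrtr_sqr gtr0_norm// invfM.
  by rewrite expr1n mul1r.
by field; rewrite gt_eqF.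
Qed.

Lemma ge0_integral_normal_scale (G : R -> R) (s : R) : 0 < s -> continuous G ->
  (forall x, 0 <= G x) ->
  (\int[leb]_x (G x)%:E = \int[leb]_z (G (s * z) * s)%:E)%E.
Proof.
move=> s0 cG G0.
have dF (x : R) : is_derive x 1 (fun z : R => s * z) s.
  by apply: is_derive_eq; rewrite /GRing.scale/= mulr1.
have FE : (fun z : R => s * z)^`()%classic = cst s.
  by apply/funext => x; rewrite derive1E; have dFx := dF x; exact: derive_val.
rewrite (@increasing_ge0_integration_by_substitutionT R (fun z => s * z) G)//.
- by apply: eq_integral => x _; rewrite FE.
- by move=> x y xy; rewrite ltr_pM2l.
- by rewrite FE => x; exact: cvg_cst.
- by rewrite FE; exact: is_cvg_cst.
- by rewrite FE; exact: is_cvg_cst.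
- apply/gt0_cvgMrNy => //; exact: cvg_id.
- apply/gt0_cvgMry => //; exact: cvg_id.
Qed.

Lemma Rintegral_normal_scale (g : R -> R) (M h : R) : 0 < h ->
  continuous g -> (forall x, `|g x| <= M) ->
  \int[normal_prob 0 (Num.sqrt h)]_y g y = \int[leb]_z (g (Num.sqrt h * z) * phi z).
Proof.
move=> h0 cg gM; set s := Num.sqrt h.
have s0 : 0 < s by rewrite sqrtr_gt0.
have cpdf := @continuous_normal_pdf R 0 s (lt0r_neq0 s0).
have mg : measurable_fun setT g by exact: continuous_measurable_fun.
have ipdf (G : R -> R) (t : R) : measurable_fun setT G -> (forall x, `|G x| <= M) ->
    leb.-integrable setT (EFin \o (fun x => G x * normal_pdf 0 t x)).
  move=> mG GM.
  by have [] := @integral_density _ _ _ leb (normal_prob 0 t) (normal_pdf 0 t) G M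
    (measurable_normal_pdf 0 t) (fun A _ => erefl) mG GM.
have [i1 E1] := @integral_density _ _ _ leb (normal_prob 0 s) (normal_pdf 0 s) g M
    (measurable_normal_pdf 0 s) (fun A _ => erefl) mg gM.
transitivity (\int[leb]_x (g x * normal_pdf 0 s x)).
  by rewrite /Rintegral E1.
have M0 : 0 <= M by exact: le_trans (gM 0).
have i2 t : leb.-integrable setT (EFin \o (fun x : R => M * normal_pdf 0 t x)).
  by apply: ipdf => // x; rewrite ger0_norm.
have cgs : continuous (fun z => g (s * z)).
  move=> z; apply: (@cvg_comp _ _ _ (fun y => s * y) g); last exact: cg.
  by apply: cvgM; [exact: cvg_cst|exact: cvg_id].
have i3 : leb.-integrable setT (EFin \o (fun z => g (s * z) * phi z)).
  by apply: ipdf => //; exact: continuous_measurable_fun.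
have MI t : \int[leb]_x (M * normal_pdf 0 t x) = M.
  have it := @integrable_normal_pdf R 0 t.
  by rewrite (RintegralZl M measurableT it) /Rintegral integral_normal_pdf/= mulr1.
(* Adding [M] makes the integrand nonnegative, as the substitution rule demands; both densities have
   mass one, so the same [M] appears on the two sides. *)
apply: (addIr M); rewrite -{1}(MI s) -{2}(MI 1).
rewrite -(RintegralD measurableT i1 (i2 s)) -(RintegralD measurableT i3 (i2 1)).
rewrite /Rintegral; congr fine.
rewrite (@ge0_integral_normal_scale _ s)//.
- apply: eq_integral => z _; congr EFin; rewrite -!mulrDl -(normal_pdf_scale z s0).
  by ring.
- move=> x; apply: cvgD; apply: cvgM; [exact: cg|exact: cpdf|exact: cvg_cst|exact: cpdf].
- move=> x; rewrite -mulrDl mulr_ge0 ?normal_pdf_ge0//.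
  by have := gM x; rewrite ler_norml => /andP[]; lra.
Qed.

End normal_scaling.

(** * The Euler scheme along one path and its error *)

Section euler_scheme.
Context (R : realType) (b k : R -> R -> R).
Notation leb := (@lebesgue_measure R).

(** The pair of the state and of the clock, the latter being the left-endpoint Riemann sum of the
    killing rate along the scheme. *)
Fixpoint euler (h x0 : R) (W : R -> R) (n : nat) : R * R :=
  if n is n'.+1 then
    let Y := (euler h x0 W n').1 in
    (Y + b (n'%:R * h) Y * h + Num.sqrt 2 * (W (n'.+1%:R * h) - W (n'%:R * h)),
     (euler h x0 W n').2 + k (n'%:R * h) Y * h)
  else (x0, 0).

Lemma Rintegral_lele_increment (g : R -> R) (C s t c e : R) : 0 <= s <= t ->
  measurable_fun [set r | 0 <= r <= t] g ->
  (forall r : R, 0 <= r <= t -> `|g r| <= C) ->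
  (forall r : R, s <= r <= t -> `|g r - c| <= e) ->
  `|\int[leb]_(r in [set r | 0 <= r <= t]) g r -
    \int[leb]_(r in [set r | 0 <= r <= s]) g r - (t - s) * c| <= e * (t - s).
Proof.
move=> st mg gC ge; have /andP[s0 st'] := st.
have ig : leb.-integrable [set r | 0 <= r <= t] (EFin \o g).
  apply: (@integrable_bounded _ _ _ leb _ g C) => //; first exact: measurable_lele.
  by apply: leb_cc_lty; exact: le_trans s0 st'.
have sub : `]s, t]%classic `<=` [set r | 0 <= r <= t].
  by move=> x /=; rewrite in_itv/= => /andP[sx ->]; rewrite (le_trans s0) ?ltW.
have fin : (leb `]s, t] < +oo)%E by rewrite leb_oc// ltry.
have lE : fine (leb `]s, t]) = t - s by rewrite leb_oc.
have E : \int[leb]_(r in [set r | 0 <= r <= t]) g r =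
    \int[leb]_(r in [set r | 0 <= r <= s]) g r + \int[leb]_(r in `]s, t]) g r.
  rewrite (setT_leleU st) Rintegral_setU//.
  - exact: measurable_lele.
  - by rewrite -setT_leleU.
  - apply/disj_setPS => x [/= /andP[_ xs]]; rewrite in_itv/= => /andP[].
    by rewrite ltNge xs.
have ig' : leb.-integrable `]s, t] (EFin \o g).
  by apply: integrableS ig => //; exact: measurable_lele.
have ic : leb.-integrable `]s, t] (EFin \o cst c).
  by apply: (@integrable_bounded _ _ _ leb _ (cst c) `|c|).
have -> : \int[leb]_(r in [set r | 0 <= r <= t]) g r -
    \int[leb]_(r in [set r | 0 <= r <= s]) g r - (t - s) * c =
    \int[leb]_(r in `]s, t]) (g r - c).
  have cE : \int[leb]_(r in `]s, t]) (cst c r) = c * (t - s).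
    by rewrite Rintegral_cst//; congr (_ * _); exact: lE.
  rewrite E RintegralB//= cE; ring.
rewrite -lE.
apply: Rintegral_bound => //.
  by apply: measurable_funB => //; by apply: (measurable_funS _ sub mg); exact: measurable_lele.
by move=> x /=; rewrite in_itv/= => /andP[sx xt]; rewrite ge// xt ltW.
Qed.

Context (T B k0 k1 L : R).
Context (L0 : 0 <= L) (B0 : 0 <= B) (k0_gt0 : 0 < k0) (k1_gt0 : 0 < k1).
Context (bB : forall s x : R, 0 <= s <= T -> `|b s x| <= B).
Context (kB : forall s x : R, 0 <= s -> 0 <= k s x <= k1).
Context (kB0 : forall s x : R, 0 <= s <= T -> k0 <= k s x).
Context (bL : forall s s' x y : R, 0 <= s <= T -> 0 <= s' <= T ->
  `|b s x - b s' y| <= L * (`|s - s'| + `|x - y|)).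
Context (kL : forall s s' x y : R, 0 <= s <= T -> 0 <= s' <= T ->
  `|k s x - k s' y| <= L * (`|s - s'| + `|x - y|)).

Section one_path.
Context (x W : R -> R) (x0 : R).
Context (W0 : W 0 = 0) (cW : {within `[0, T], continuous W}).
Notation A := (fun t => \int[leb]_(r in [set r | 0 <= r <= t]) k r (x r)).
Notation solution_at t := (x t = x0 +
  \int[leb]_(r in [set r | 0 <= r <= t]) b r (x r) + Num.sqrt 2 * W t).

Lemma sqrt2_le2 : Num.sqrt 2 <= 2 :> R.
Proof.
rewrite -[leRHS]ger0_norm// -sqrtr_sqr ler_sqrt// expr2; lra.
Qed.

(** The drift integral is Lipschitz in its upper limit by boundedness alone. This breaks a circle:
    continuity of the path comes first, and measurability of the coefficients along it is then
    deduced. *)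
Lemma solution_increment (q r : R) : 0 <= q <= T -> 0 <= r <= T ->
  solution_at q -> solution_at r ->
  `|x r - x q| <= B * `|r - q| + 2 * `|W r - W q|.
Proof.
have wlg q' r' : 0 <= q' <= r' -> r' <= T -> solution_at q' -> solution_at r' ->
    `|x r' - x q'| <= B * `|r' - q'| + 2 * `|W r' - W q'|.
  move=> qr rT -> ->.
  set I := \int[leb]_(_ in [set r | 0 <= r <= r']) _; set J := \int[leb]_(_ in [set r | 0 <= r <= q']) _.
  have -> : x0 + I + Num.sqrt 2 * W r' - (x0 + J + Num.sqrt 2 * W q') =
    (I - J) + Num.sqrt 2 * (W r' - W q') by ring.
  apply: le_trans (ler_normD _ _) _; apply: lerD.
    have /andP[_ qr'] := qr.
    rewrite [X in _ <= _ * X]ger0_norm ?subr_ge0//.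
    apply: Rintegral_lele_lipschitz => // y /andP[y0 yr]; apply: bB.
    by rewrite y0 (le_trans yr).
  rewrite normrM ger0_norm ?sqrtr_ge0//.
  by apply: ler_wpM2r => //; exact: sqrt2_le2.
move=> /andP[q0 qT] /andP[r0 rT] hq hr; have [qr|/ltW rq] := leP q r.
  by apply: wlg => //; rewrite q0.
by rewrite distrC (distrC r) (distrC (W r)); apply: wlg => //; rewrite r0.
Qed.

Lemma measurable_along_solution (g : R -> R -> R) (s : R) : 0 <= s <= T ->
  (forall r : R, 0 <= r <= s -> solution_at r) ->
  (forall s s' x y : R, 0 <= s <= T -> 0 <= s' <= T ->
    `|g s x - g s' y| <= L * (`|s - s'| + `|x - y|)) ->
  measurable_fun [set r | 0 <= r <= s] (fun r => g r (x r)).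
Proof.
move=> /andP[s0 sT] xE gL; rewrite set_leleE.
apply: subspace_continuous_measurable_fun => //.
apply/subspace_continuousP => r /=; rewrite in_itv/= => /andP[r0 rs].
apply/cvgrPdist_le => e e0.
have rT : 0 <= r <= T by rewrite r0 (le_trans rs).
have L1 : 0 < L + 1 by rewrite ltr_wpDl.
have B1 : 0 < 1 + B by rewrite ltr_pwDl.
have := (subspace_continuousP _ _).1 cW r; rewrite /= in_itv/= rT => /(_ isT).
(* The variation is at most [L * ((1 + B) * |r - q| + 2 * |W r - W q|)], each part being given
   [e / 2]; [L + 1] keeps the denominators positive. *)
move=> /cvgrPdist_le/(_ (e / (4 * (L + 1)))).
rewrite divr_gt0// ?mulr_gt0// => /(_ isT)[d1 /= d10 d1P].
exists (Num.min d1 (e / (2 * (L + 1) * (1 + B)))) => /=.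
  by rewrite lt_min d10/= divr_gt0// !mulr_gt0.
move=> q /= rq; rewrite in_itv/= => /andP[q0 qs].
move: rq; rewrite lt_min => /andP[rq1 rq2].
have qT : 0 <= q <= T by rewrite q0 (le_trans qs).
have qW := d1P q rq1; rewrite in_itv/= qT in qW; have {}qW := qW isT.
apply: le_trans (gL _ _ _ _ rT qT) _.
have H := solution_increment qT rT (xE _ _) (xE _ _).
have {}H := H _ _; rewrite q0 qs r0 rs in H; have {}H := H isT isT.
move: qW; rewrite ler_pdivlMr ?mulr_gt0// => qW.
move: rq2; rewrite ltr_pdivlMr ?mulr_gt0// => rq2.
have := normr_ge0 (r - q); have := normr_ge0 (W r - W q).
move: (`|x r - x q|) (`|r - q|) (`|W r - W q|) H qW rq2 => u v w H qW rq2 w0 v0.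
have p1 : 0 <= L * (B * v + 2 * w - u) by rewrite mulr_ge0// subr_ge0.
have p2 : 0 <= B * v by exact: mulr_ge0.
lra.
Qed.

(** Discrete Gronwall. Scheme and solution share [W], so the noise cancels at grid times and only
    the freezing of the coefficients costs. If [c] bounds the time and space increments within a
    step, the errors obey [e' <= e + L * h * (c + e)], whence the bound
    [c * (expR (L * n * h) - 1)], for the state and the clock alike. *)
Lemma euler_error (s h om : R) (n : nat) : 0 <= s <= T ->
  (forall r : R, 0 <= r <= s -> solution_at r) -> 0 < h ->
  (forall r q : R, 0 <= r <= T -> 0 <= q <= T -> `|r - q| <= h -> `|W r - W q| <= om) ->
  n%:R * h <= s ->
  let bound := (h + (B * h + 2 * om)) * (expR (L * (n%:R * h)) - 1) in
  `|(euler h x0 W n).1 - x (n%:R * h)| <= bound /\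
  `|(euler h x0 W n).2 - A (n%:R * h)| <= bound.
Proof.
move=> /andP[s0 sT] xE h0 Wom; set c := h + (B * h + 2 * om).
have om0 : 0 <= om.
  have T0 : 0 <= (0 : R) <= T by apply/andP; split; [exact: lexx|exact: le_trans s0 sT].
  by have := Wom 0 0 T0 T0; rewrite !subrr !normr0; apply; exact: ltW.
have c0 : 0 <= c by rewrite /c !addr_ge0// ?mulr_ge0// ltW.
elim: n => [|n IH] ns /=.
  rewrite mul0r mulr0 expR0 subrr mulr0; split.
    have := xE 0; rewrite lexx s0 => /(_ isT) ->; rewrite W0 mulr0 addr0.
    have -> : [set r : R | 0 <= r <= 0] = [set 0].
      by apply/seteqP; split => y /=; [move=> y0; apply/esym/le_anti|move=> ->; rewrite lexx].
    by rewrite Rintegral_set1 addr0 subrr normr0.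
  have -> : [set r : R | 0 <= r <= 0] = [set 0].
    by apply/seteqP; split => y /=; [move=> y0; apply/esym/le_anti|move=> ->; rewrite lexx].
  by rewrite Rintegral_set1 subr0 normr0.
set t := n%:R * h; set t' := n.+1%:R * h; rewrite -/t' in ns.
have tt' : t' = t + h by rewrite /t' /t -natr1 mulrDl mul1r.
have t0 : 0 <= t by rewrite mulr_ge0// ltW.
have ts : t <= s by rewrite (le_trans _ ns)// tt' lerDl ltW.
have [IH1 IH2] := IH ts.
rewrite -/t in IH1 IH2.
set Y := (euler h x0 W n).1 in IH1 *; set a := (euler h x0 W n).2 in IH2 *.
have tT : 0 <= t <= T by rewrite t0 (le_trans ts).
have t'0 : 0 <= t' by rewrite tt' addr_ge0// ltW.
have tt'' : 0 <= t <= t' by rewrite t0 tt' lerDl ltW.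
set E := expR (L * t) in IH1 IH2 *.
have E0 : 0 < E by exact: expR_gt0.
have EE' : E * (1 + L * h) <= expR (L * t').
  have -> : L * t' = L * t + L * h by rewrite tt' mulrDr.
  by rewrite expRD -/E ler_pM2l//; exact: expR_ge1Dx.
(* One increment in time and space, at most [c], plus the error [c * (E - 1)] inherited at time
   [t]. *)
have near_Y r : t <= r <= t' -> `|r - t| + `|x r - Y| <= c * E.
  move=> /andP[tr rt'].
  have rs : r <= s by exact: le_trans ns.
  have r0 : 0 <= r by exact: le_trans tr.
  have rT : 0 <= r <= T by rewrite r0 (le_trans rs).
  have rth : `|r - t| <= h by rewrite ger0_norm ?subr_ge0// lerBlDl -tt'.
  have H1 : `|x r - x t| <= B * `|r - t| + 2 * `|W r - W t|.
    by apply: solution_increment => //; apply: xE; rewrite ?r0 ?t0.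
  have H2 := Wom r t rT tT rth.
  have H3 := ler_distD (x t) (x r) Y.
  have H4 : B * `|r - t| <= B * h by apply: ler_wpM2l.
  rewrite (distrC Y) in IH1.
  have H5 : `|x r - Y| <= (B * h + 2 * om) + c * (E - 1).
    lra.
  have -> : c * E = (h + (B * h + 2 * om)) + c * (E - 1) by rewrite -/c; ring.
  by lra.
have step (g : R -> R -> R) C : (forall r : R, 0 <= r <= t' -> `|g r (x r)| <= C) ->
    (forall s s' x y : R, 0 <= s <= T -> 0 <= s' <= T ->
      `|g s x - g s' y| <= L * (`|s - s'| + `|x - y|)) ->
    `|\int[leb]_(r in [set r | 0 <= r <= t']) g r (x r) -
      \int[leb]_(r in [set r | 0 <= r <= t]) g r (x r) - h * g t Y| <= L * (c * E) * h.
  move=> gC gL; have -> : h = t' - t by rewrite tt' addrC addKr.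
  apply: (@Rintegral_lele_increment (fun r => g r (x r)) C) => //.
    apply: measurable_along_solution => //; first by rewrite t'0 (le_trans ns).
    by move=> r /andP[r0 rt]; apply: xE; rewrite r0 (le_trans rt).
  move=> r tr; have /andP[tr1 tr2] := tr.
  have rT : 0 <= r <= T by rewrite (le_trans t0)//= (le_trans tr2)// (le_trans ns).
  apply: le_trans (gL _ _ _ _ rT tT) _.
  by apply: ler_wpM2l => //; exact: near_Y.
(* The recursion closes because [E * (1 + L * h)] is at most the exponential at the next grid
   time. *)
have fin : c * (E - 1) + L * (c * E) * h <= c * (expR (L * t') - 1).
  have : c * (E * (1 + L * h)) <= c * expR (L * t') by apply: ler_wpM2l.
  lra.
split; apply: le_trans fin.
- have H := step b B.
  have /H/(_ bL) {}H : forall r : R, 0 <= r <= t' -> `|b r (x r)| <= B.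
    by move=> r /andP[r0 rt]; apply: bB; rewrite r0 (le_trans rt)// (le_trans ns).
  have Et := xE t; rewrite t0 ts in Et; have {}Et := Et isT.
  have Et' := xE t'; rewrite t'0 ns in Et'; have {}Et' := Et' isT.
  move: IH1; rewrite Et Et' => IH1.
  set I' := \int[leb]_(_ in [set r | 0 <= r <= t']) _ in H *.
  set I := \int[leb]_(_ in [set r | 0 <= r <= t]) _ in H IH1 *.
  have -> : Y + b t Y * h + Num.sqrt 2 * (W t' - W t) - (x0 + I' + Num.sqrt 2 * W t') =
    (Y - (x0 + I + Num.sqrt 2 * W t)) - (I' - I - h * b t Y) by ring.
  by apply: le_trans (ler_normB _ _) _; apply: lerD.
- have H := step k k1.
  have /H/(_ kL) {}H : forall r : R, 0 <= r <= t' -> `|k r (x r)| <= k1.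
    by move=> r /andP[r0 _]; have /andP[? ?] := kB (x r) r0; rewrite ger0_norm.
  set I' := \int[leb]_(_ in [set r | 0 <= r <= t']) _ in H *.
  set I := \int[leb]_(_ in [set r | 0 <= r <= t]) _ in H IH2 *.
  have -> : a + k t Y * h - I' = (a - I) - (I' - I - h * k t Y) by ring.
  by apply: le_trans (ler_normB _ _) _; apply: lerD.
Qed.

End one_path.

(** The bounds on [k] hold at every state, so the discrete clock keeps running at a rate between
    [k0] and [k1] even after the solution has been killed. *)
Lemma euler_increment (x0 h : R) (W : R -> R) (i j : nat) : 0 < h -> (i <= j)%N ->
  j%:R * h <= T ->
  k0 * ((j%:R - i%:R) * h) <= (euler h x0 W j).2 - (euler h x0 W i).2
    <= k1 * ((j%:R - i%:R) * h).
Proof.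
move=> h0; elim: j => [|j IH].
  by rewrite leqn0 => /eqP -> _; rewrite !subrr mul0r !mulr0 lexx.
rewrite leq_eqVlt => /predU1P[<- _|]; first by rewrite !subrr mul0r !mulr0 lexx.
rewrite ltnS => ij jT /=.
have jT' : j%:R * h <= T by rewrite (le_trans _ jT)// ler_wpM2r ?ler_nat// ltW.
have j0 : 0 <= j%:R * h by rewrite mulr_ge0// ltW.
have /andP[e1 e2] := IH ij jT'.
have jT2 : 0 <= j%:R * h <= T by rewrite j0.
have k0b := kB0 (euler h x0 W j).1 jT2.
have /andP[_ k1b] := kB (euler h x0 W j).1 j0.
have p1 : k0 * h <= k (j%:R * h) (euler h x0 W j).1 * h by rewrite ler_pM2r.
have p2 : k (j%:R * h) (euler h x0 W j).1 * h <= k1 * h by rewrite ler_pM2r.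
by rewrite -natr1; apply/andP; split; lra.
Qed.

(** * Pathwise limit of the scheme before and after killing *)

Section euler_limit.
Context (x W : R -> R) (x0 : R).
Context (W0 : W 0 = 0) (cW : {within `[0, T], continuous W}).
Notation A := (fun t => \int[leb]_(r in [set r | 0 <= r <= t]) k r (x r)).
Notation solution_at t := (x t = x0 +
  \int[leb]_(r in [set r | 0 <= r <= t]) b r (x r) + Num.sqrt 2 * W t).
Context (h : nat -> R) (h0 : forall n, 0 < h n) (ch : h @ \oo --> 0).

(** True along an arbitrary path [x], so also past killing: the lower integral of a function with
    values in [[0, k1]] is all that is used. *)
Lemma clock_lipschitz (s t : R) : 0 <= s <= t -> A s <= A t <= A s + k1 * (t - s).
Proof.
move=> st; have /andP[s0 st'] := st.
(* The bounds on [k] are given at nonnegative times, so the integrand is set to zero before time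
   0. *)
pose g r := if 0 <= r then k r (x r) else 0.
have gE u : \int[leb]_(r in [set r | 0 <= r <= u]) k r (x r) =
    \int[leb]_(r in [set r | 0 <= r <= u]) g r.
  by apply: eq_Rintegral => r; rewrite inE/= /g => /andP[-> _].
have gB r : 0 <= g r <= k1.
  by rewrite /g; case: ifPn => [/kB//|_]; rewrite lexx ltW.
by rewrite !gE; have [_ -> ->] := ge0_Rintegral_lele st gB.
Qed.

Lemma euler_cvg (s : R) (m : nat -> nat) : 0 <= s <= T ->
  (forall r : R, 0 <= r <= s -> solution_at r) ->
  (forall n, (m n)%:R * h n <= s) -> (m n)%:R * h n @[n --> \oo] --> s ->
  (euler (h n) x0 W (m n)).1 @[n --> \oo] --> x s /\
  (euler (h n) x0 W (m n)).2 @[n --> \oo] --> A s.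
Proof.
move=> sT xE ms cm; have /andP[s0 sT'] := sT.
have [M ME] : {M | M = expR (L * T)} by exists (expR (L * T)).
have T0 : 0 <= T by exact: le_trans sT'.
have M1 : 1 <= M by rewrite ME -expR0 ler_expR mulr_ge0.
have unif := uniform_continuity_segment cW.
suff H (e : R) : 0 < e -> \forall n \near \oo,
    `|x s - (euler (h n) x0 W (m n)).1| <= e /\ `|A s - (euler (h n) x0 W (m n)).2| <= e.
  split; apply/cvgrPdist_le => e e0; have := H e e0; apply: filterS => n [] //.
move=> e0.
(* Budget: the Euler error [((1 + B) * h + 2 * om) * M] gets [e / 4 + e / 4], and the move from the
   last grid time to [s] gets the other [e / 2]. *)
have om0 : 0 < e / (8 * M) by rewrite divr_gt0// mulr_gt0// (lt_le_trans _ M1).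
have [del del0 delP] := unif _ om0.
have c1 : 0 < (1 + B) * M * 4 by rewrite !mulr_gt0 ?ltr_pwDl// (lt_le_trans _ M1).
have c2 : 0 < 4 * (B + k1 + 1) by rewrite mulr_gt0// ltr_wpDl// addr_ge0// ltW.
near=> n.
have hdel : h n <= del.
  near: n; move/cvgrPdist_le : ch => /(_ _ del0); apply: filterS => n.
  by rewrite sub0r normrN gtr0_norm.
have he : h n <= e / ((1 + B) * M * 4).
  near: n; move/cvgrPdist_le : ch => /(_ (e / ((1 + B) * M * 4))).
  rewrite divr_gt0// => /(_ isT); apply: filterS => n.
  by rewrite sub0r normrN gtr0_norm.
have mdel : `|s - (m n)%:R * h n| <= del.
  by near: n; move/cvgrPdist_le : cm => /(_ _ del0); apply: filterS.
have me : `|s - (m n)%:R * h n| <= e / (4 * (B + k1 + 1)).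
  by near: n; move/cvgrPdist_le : cm => /(_ (e / (4 * (B + k1 + 1)))); rewrite divr_gt0// => /(_ isT); apply: filterS.
have t0 : 0 <= (m n)%:R * h n by rewrite mulr_ge0// ltW.
set t := (m n)%:R * h n in mdel me t0 *.
have ts : t <= s by exact: ms.
have tT : 0 <= t <= T by rewrite t0 (le_trans ts).
have [E1 E2] := euler_error W0 cW sT xE (h0 n)
  (fun r q rT qT rq => delP r q rT qT (le_trans rq hdel)) (ms n).
rewrite -/t in E1 E2.
set Y := (euler (h n) x0 W (m n)).1 in E1 *.
set a := (euler (h n) x0 W (m n)).2 in E2 *.
have EM : expR (L * t) - 1 <= M.
  have : expR (L * t) <= M by rewrite ME ler_expR ler_wpM2l//; case/andP: tT.
  lra.
have E0 : 0 <= expR (L * t) - 1 by rewrite subr_ge0 -expR0 ler_expR mulr_ge0.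
have omM : e / (8 * M) * M = e / 8 by field; rewrite gt_eqF// (lt_le_trans _ M1).
have bnd : (h n + (B * h n + 2 * (e / (8 * M)))) * (expR (L * t) - 1) <= e / 2.
  apply: (@le_trans _ _ ((h n + (B * h n + 2 * (e / (8 * M)))) * M)).
    have hn0 := ltW (h0 n); have om0' := ltW om0.
    by apply: ler_wpM2l => //; rewrite addr_ge0// addr_ge0// mulr_ge0.
  move: he; rewrite ler_pdivlMr// => he; lra.
have me' : `|s - t| * (4 * (B + k1 + 1)) <= e by rewrite -ler_pdivlMr.
have d0 := normr_ge0 (s - t).
have B1 : 0 <= `|s - t| * B by rewrite mulr_ge0.
have B2 : 0 <= `|s - t| * k1 by rewrite mulr_ge0// ltW.
split.
- have I : `|x s - x t| <= B * `|s - t| + 2 * `|W s - W t|.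
    by apply: solution_increment => //; apply: xE; rewrite ?s0 ?lexx ?t0.
  have Ws := delP s t sT tT mdel.
  have om8 : e / (8 * M) <= e / 8.
    rewrite ler_pdivrMr ?mulr_gt0 ?(lt_le_trans _ M1)//.
    have : e * 1 <= e * M by rewrite ler_wpM2l// ltW.
    lra.
  have := ler_distD (x t) (x s) Y; rewrite (distrC (x t) Y); lra.
- have st : 0 <= t <= s by rewrite t0.
  have /andP[A1 A2] := clock_lipschitz st.
  have I : `|A s - A t| <= k1 * `|s - t|.
    by rewrite !ger0_norm ?subr_ge0//; lra.
  have := ler_distD (A t) (A s) a; rewrite (distrC (A t) a); lra.
Unshelve. all: by end_near. Qed.

Context (z : R) (z0 : 0 < z).
Notation hits := [set t | 0 <= t /\ z <= A t].
Notation tau := (ereal_inf [set t%:E | t in hits]).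
Context (xE : forall t : R, 0 <= t <= T -> (t%:E < tau)%E -> solution_at t).

Lemma clock_lt_before (t : R) : 0 <= t -> (t%:E < tau)%E -> A t < z.
Proof.
move=> t0; apply: contraPlt => zA; apply/negP; rewrite -leNgt.
by apply: ereal_inf_lbound; exists t.
Qed.

(** Attainment of the infimum is not presupposed: a hitting time just after [u] is carried back to
    [t] by the Lipschitz bound, and the excess tends to zero. *)
Lemma clock_ge_limit (t u : R) : 0 <= t <= u -> (tau <= u%:E)%E -> z <= A t + k1 * (u - t).
Proof.
move=> /andP[t0 tu] tauu; apply/ler_addgt0Pr => e e0.
have : (tau < (u + e / k1)%:E)%E.
  by apply: le_lt_trans tauu _; rewrite lte_fin ltrDl divr_gt0.
move=> /ereal_inf_lt[_ [r [r0 zr] <-]]; rewrite lte_fin => ru.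
apply: le_trans zr _; have [rt|/ltW tr] := leP r t.
  have /andP[Ar _] := @clock_lipschitz r t (introT andP (conj r0 rt)).
  have : 0 <= k1 * (u - t) by rewrite mulr_ge0 ?subr_ge0// ltW.
  lra.
have /andP[_ Ar] := @clock_lipschitz t r (introT andP (conj t0 tr)).
have : k1 * r <= k1 * (u + e / k1) by rewrite ler_pM2l// ltW.
rewrite mulrDr mulrCA divff ?gt_eqF//; lra.
Qed.

Lemma tau_gt0 : (0%:E < tau)%E.
Proof.
rewrite ltNge; apply/negP => tau0.
have := @clock_ge_limit 0 0 _ tau0; rewrite lexx => /(_ isT).
have -> : [set r : R | 0 <= r <= 0] = [set 0].
  by apply/seteqP; split => y /=; [move=> y0; apply/esym/le_anti|move=> ->; rewrite lexx].
by rewrite Rintegral_set1 subrr mulr0 addr0 leNgt z0.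
Qed.

Lemma euler_before (s : R) (m : nat -> nat) : 0 <= s <= T -> (s%:E < tau)%E ->
  (forall n, (m n)%:R * h n <= s) -> (m n)%:R * h n @[n --> \oo] --> s ->
  [/\ (euler (h n) x0 W (m n)).1 @[n --> \oo] --> x s,
    (euler (h n) x0 W (m n)).2 @[n --> \oo] --> A s & A s < z].
Proof.
move=> sT st ms cm; have /andP[s0 sT'] := sT.
have [] := euler_cvg sT _ ms cm.
  move=> r /andP[r0 rs]; apply: xE; first by rewrite r0 (le_trans rs).
  by rewrite (le_lt_trans _ st)// lee_fin.
by move=> *; split => //; exact: clock_lt_before.
Qed.

(* Once the clock has reached [z] at time [u <= s], the discrete clock at time [s] is at least
   about [z + k0 * (s - u)]: compare with the Euler clock at an earlier time [t < u]. *)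
Lemma euler_after (s u e : R) (m : nat -> nat) : 0 < u <= s -> s <= T -> tau = u%:E ->
  (forall n, (m n)%:R * h n <= s) -> (m n)%:R * h n @[n --> \oo] --> s -> 0 < e ->
  \forall n \near \oo, z + k0 * (s - u) - e <= (euler (h n) x0 W (m n)).2 <=
    z + k1 * (s - u) + e.
Proof.
move=> /andP[u0 us] sT tauu ms cm e0.
(* The comparison takes place at [u - d]: [u / 2] keeps this time positive, and the other bound
   makes [(k0 + k1) * d] at most [e / 2], which absorbs what the clock still lacks there and what it
   runs during [d]. *)
pose d := Num.min (u / 2) (e / (2 * (k0 + k1))).
have kk : 0 < 2 * (k0 + k1) by rewrite mulr_gt0// addr_gt0.
have d0 : 0 < d by rewrite lt_min !divr_gt0.
have du : d <= u / 2 by rewrite ge_min lexx.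
have de : d * (2 * (k0 + k1)) <= e by rewrite -ler_pdivlMr// ge_min lexx orbT.
pose t := u - d.
have t0 : 0 <= t by rewrite /t; lra.
have tu : t < u by rewrite /t; lra.
have tT : 0 <= t <= T by rewrite t0/=; lra.
have ttau : (t%:E < tau)%E by rewrite tauu lte_fin.
pose l n := Num.truncn (t * (h n)^-1).
have lt n : (l n)%:R * h n <= t.
  rewrite -ler_pdivlMr// truncn_le mulr_ge0// invr_ge0 ltW//.
have cl : (l n)%:R * h n @[n --> \oo] --> t by exact: cvg_truncn_mul.
have [_ cA Az] := euler_before tT ttau lt cl.
have zA : z <= A t + k1 * (u - t) by apply: clock_ge_limit; [rewrite t0 ltW|rewrite tauu].
have ut : u - t = d by rewrite /t; ring.
have e8 : 0 < e / 8 by rewrite divr_gt0.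
have ek0 : 0 < e / 8 / (k0 + k1) by rewrite divr_gt0// addr_gt0.
near=> n.
have h1 : `|A t - (euler (h n) x0 W (l n)).2| <= e / 8.
  by near: n; move/cvgrPdist_le : cA => /(_ _ e8).
have h2 : `|s - (m n)%:R * h n| <= e / 8 / (k0 + k1).
  by near: n; move/cvgrPdist_le : cm => /(_ _ ek0).
have h3 : `|t - (l n)%:R * h n| <= e / 8 / (k0 + k1).
  by near: n; move/cvgrPdist_le : cl => /(_ _ ek0).
have h4 : t < (m n)%:R * h n.
  by near: n; apply: (cvgr_gt s) => //; lra.
have lm : (l n <= m n)%N.
  by rewrite -(ler_nat R) -(ler_pM2r (h0 n)) (le_trans (lt n))// ltW.
have mT : (m n)%:R * h n <= T by apply: le_trans (ms n) _.
have /andP[i1 i2] := euler_increment x0 W (h0 n) lm mT.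
move: h1; rewrite ler_norml => /andP[h11 h12].
rewrite mulrBl in i1 i2.
have kk' : 0 < k0 + k1 by rewrite addr_gt0.
move: h2 h3; rewrite (ler_pdivlMr _ _ kk') (ler_pdivlMr _ _ kk').
move: ((euler (h n) x0 W (m n)).2) ((euler (h n) x0 W (l n)).2) ((m n)%:R * h n) ((l n)%:R * h n) (ms n) (lt n) h4 h11 h12 i1 i2.
move=> am al tm tl tms tlt h4 h11 h12 i1 i2.
rewrite (ger0_norm (_ : 0 <= s - tm)) ?subr_ge0//.
rewrite (ger0_norm (_ : 0 <= t - tl)) ?subr_ge0// => h2 h3.
have zA' := zA; rewrite ut in zA'.
have p1 : 0 <= k0 * (s - tm) by rewrite mulr_ge0 ?subr_ge0// ltW.
have p2 : 0 <= k1 * (s - tm) by rewrite mulr_ge0 ?subr_ge0// ltW.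
have p3 : 0 <= k0 * (t - tl) by rewrite mulr_ge0 ?subr_ge0// ltW.
have p4 : 0 <= k1 * (t - tl) by rewrite mulr_ge0 ?subr_ge0// ltW.
have p5 : 0 <= d * k0 by rewrite mulr_ge0// ltW.
have p6 : 0 <= d * k1 by rewrite mulr_ge0// ltW.
have tE : t = u - d by [].
by apply/andP; split; rewrite tE in h3 p3 p4 *; lra.
Unshelve. all: by end_near. Qed.

End euler_limit.
End euler_scheme.

(** * Bounds and Lipschitz constants for the drift *)

Section coefficient_algebra.
Context (R : realType).

Lemma expRN_lipschitz (a b : R) : 0 <= a -> 0 <= b -> `|expR (- a) - expR (- b)| <= `|a - b|.
Proof.
have wlg (x y : R) : 0 <= x -> x <= y -> `|expR (- x) - expR (- y)| <= `|x - y|.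
  move=> x0 xy.
  have e1 : expR (- y) <= expR (- x) by rewrite ler_expR lerN2.
  rewrite ger0_norm ?subr_ge0// distrC ger0_norm ?subr_ge0//.
  have -> : expR (- y) = expR (- x) * expR (- (y - x)) by rewrite -expRD; congr expR; ring.
  have e2 : 1 - (y - x) <= expR (- (y - x)) := expR_ge1Dx _.
  have e3 : expR (- x) <= 1 by rewrite -expR0 ler_expR oppr_le0.
  have e4 := expR_gt0 (- x).
  have : expR (- x) * (1 - expR (- (y - x))) <= 1 * (y - x).
    have e5 : 0 <= 1 - expR (- (y - x)) by rewrite subr_ge0 -expR0 ler_expR oppr_le0 subr_ge0.
    have e6 : 1 - expR (- (y - x)) <= y - x by lra.
    by apply: ler_pM => //; exact: ltW.
  by rewrite mul1r mulrBr mulr1.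
move=> a0 b0; have [ab|/ltW ba] := leP a b; first exact: wlg.
by rewrite distrC (distrC a); exact: wlg.
Qed.

Lemma drift_bound_lipschitz (lam c0 phi0 phi1 m P Q : R) :
  0 < lam -> 0 < c0 -> 0 < phi0 -> 0 < m -> 0 <= Q ->
  (forall x : R, 0 <= x <= P -> m <= phi0 + phi1 * c0 * expR (- lam * x)) ->
  exists2 C : R, 0 <= C &
    (forall p q : R, 0 <= p <= P -> `|q| <= Q -> `|drift lam c0 phi0 phi1 p q| <= C) /\
    (forall p q p' q' : R, 0 <= p <= P -> `|q| <= Q -> 0 <= p' <= P -> `|q'| <= Q ->
      `|drift lam c0 phi0 phi1 p q - drift lam c0 phi0 phi1 p' q'| <=
        C * (`|p - p'| + `|q - q'|)).
Proof.
move=> lam0 c00 phi00 m0 Q0 mP.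
pose kap := `|phi1 * lam * c0|.
(* [C1] bounds the drift through its denominator, at least [m]; [C2] bounds a difference of two
   drifts over the product of denominators, at least [m ^+ 2]. *)
pose C1 := kap * Q / m.
pose C2 := kap * (phi0 * Q * lam + phi0 + `|phi1 * c0|) / m ^+ 2.
have kap0 : 0 <= kap by exact: normr_ge0.
have C10 : 0 <= C1 by rewrite /C1 divr_ge0 ?mulr_ge0// ltW.
have S0 : 0 <= phi0 * Q * lam + phi0 + `|phi1 * c0|.
  by rewrite !addr_ge0// ?mulr_ge0// ltW.
have C20 : 0 <= C2 by rewrite /C2 divr_ge0 ?mulr_ge0// ?exprn_ge0// ltW.
have Ele (p : R) : 0 <= p -> 0 <= expR (- lam * p) <= 1.
  by move=> p0; rewrite expR_ge0/= -expR0 ler_expR mulNr oppr_le0 mulr_ge0// ltW.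
have DE (p q : R) : drift lam c0 phi0 phi1 p q =
    - (phi1 * lam * c0) * ((expR (- lam * p) * q) / (phi0 + phi1 * c0 * expR (- lam * p))).
  by rewrite /drift; ring.
exists (C1 + C2); first exact: addr_ge0.
split=> [p q pP qQ|p q p' q' pP qQ p'P q'Q].
  have /andP[p0 _] := pP; have D0 := mP p pP; have /andP[E0 E1] := Ele p p0.
  have Dp := lt_le_trans m0 D0.
  rewrite DE normrM normrN -/kap (@le_trans _ _ C1)//; last by rewrite lerDl.
  have -> : C1 = kap * (Q * m^-1) by rewrite /C1 mulrA.
  rewrite ler_wpM2l// normrM normfV (gtr0_norm Dp).
  have h1 : 0 <= (phi0 + phi1 * c0 * expR (- lam * p))^-1 by rewrite invr_ge0 ltW.
  have h2 : `|expR (- lam * p) * q| <= Q.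
    by rewrite normrM (ger0_norm E0) -[leRHS]mul1r; apply: ler_pM.
  have h3 : (phi0 + phi1 * c0 * expR (- lam * p))^-1 <= m^-1 by rewrite lef_pV2 ?posrE.
  exact: ler_pM.
have /andP[p0 _] := pP; have D0 := mP p pP; have /andP[E0 E1] := Ele p p0.
have /andP[p'0 _] := p'P; have D0' := mP p' p'P; have /andP[E0' E1'] := Ele p' p'0.
have EL : `|expR (- lam * p) - expR (- lam * p')| <= lam * `|p - p'|.
  have lp : 0 <= lam * p by rewrite mulr_ge0// ltW.
  have lp' : 0 <= lam * p' by rewrite mulr_ge0// ltW.
  rewrite !mulNr; apply: le_trans (expRN_lipschitz lp lp') _.
  by rewrite -mulrBr normrM gtr0_norm.
rewrite !DE.
move: (expR (- lam * p)) (expR (- lam * p')) D0 E0 E1 D0' E0' E1' EL => E E' D0 E0 E1 D0' E0' E1' EL.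
have Dp := lt_le_trans m0 D0; have Dp' := lt_le_trans m0 D0'.
rewrite -mulrBr normrM normrN -/kap.
(* Over the common denominator, the [phi1 * c0] part retains only [q - q']; the difference of
   exponentials is multiplied by [phi0] alone. *)
have -> : E * q / (phi0 + phi1 * c0 * E) - E' * q' / (phi0 + phi1 * c0 * E') =
  (phi0 * ((E - E') * q + E' * (q - q')) + phi1 * c0 * (E * E' * (q - q'))) /
  ((phi0 + phi1 * c0 * E) * (phi0 + phi1 * c0 * E')).
  by field; rewrite !gt_eqF.
have dq0 := normr_ge0 (q - q'); have dp0 := normr_ge0 (p - p').
have N1 : `|(E - E') * q| <= lam * `|p - p'| * Q by rewrite normrM; apply: ler_pM.
have N2 : `|E' * (q - q')| <= `|q - q'|.
  by rewrite normrM (ger0_norm E0') ler_piMl.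
have N3 : `|E * E' * (q - q')| <= `|q - q'|.
  by rewrite normrM (ger0_norm (mulr_ge0 E0 E0')) ler_piMl// -[leRHS]mul1r ler_pM.
set N := phi0 * _ + _.
have NN : `|N| <= (phi0 * Q * lam + phi0 + `|phi1 * c0|) * (`|p - p'| + `|q - q'|).
  apply: le_trans (ler_normD _ _) _.
  have n1 : `|phi0 * ((E - E') * q + E' * (q - q'))| <= phi0 * (lam * `|p - p'| * Q + `|q - q'|).
    rewrite normrM (gtr0_norm phi00) ler_wpM2l//; first exact: ltW.
    by apply: le_trans (ler_normD _ _) _; exact: lerD.
  have n2 : `|phi1 * c0 * (E * E' * (q - q'))| <= `|phi1 * c0| * `|q - q'|.
    by rewrite normrM ler_wpM2l.
  apply: le_trans (lerD n1 n2) _.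
  have r1 : 0 <= phi0 * Q * lam * `|q - q'| by rewrite !mulr_ge0// ltW.
  have r2 : 0 <= phi0 * `|p - p'| by rewrite mulr_ge0// ltW.
  have r3 : 0 <= `|phi1 * c0| * `|p - p'| by rewrite mulr_ge0.
  rewrite !(mulrDl, mulrDr); move: r1 r2 r3.
  rewrite (_ : phi0 * (lam * `|p - p'| * Q) = phi0 * Q * lam * `|p - p'|); last by ring.
  move: (phi0 * Q * lam * `|q - q'|) (phi0 * `|p - p'|) (`|phi1 * c0| * `|p - p'|)
    (phi0 * Q * lam * `|p - p'|) (phi0 * `|q - q'|) (`|phi1 * c0| * `|q - q'|) => a1 a2 a3 a4 a5 a6.
  by move=> *; lra.
apply: (@le_trans _ _ (C2 * (`|p - p'| + `|q - q'|))); last first.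
  by rewrite ler_wpM2r ?addr_ge0// lerDr.
have DD0 : 0 < (phi0 + phi1 * c0 * E) * (phi0 + phi1 * c0 * E') by exact: mulr_gt0.
have mm : m ^+ 2 <= (phi0 + phi1 * c0 * E) * (phi0 + phi1 * c0 * E').
  by rewrite expr2; apply: ler_pM => //; exact: ltW.
have V0 : 0 <= ((phi0 + phi1 * c0 * E) * (phi0 + phi1 * c0 * E'))^-1 by rewrite invr_ge0 ltW.
have VV : ((phi0 + phi1 * c0 * E) * (phi0 + phi1 * c0 * E'))^-1 <= (m ^+ 2)^-1.
  by rewrite lef_pV2 ?posrE ?exprn_gt0.
have -> : C2 * (`|p - p'| + `|q - q'|) =
    kap * ((phi0 * Q * lam + phi0 + `|phi1 * c0|) * (`|p - p'| + `|q - q'|) * (m ^+ 2)^-1).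
  by rewrite /C2; field; rewrite gt_eqF.
by rewrite ler_wpM2l// normrM normfV (gtr0_norm DD0); apply: ler_pM.
Qed.

End coefficient_algebra.

(** * Regularity of the convolutions with [nu] and of their time integrals *)

Section coefficients.
Context (R : realType) (T : R) (d : measure_display) (Om : measurableType d)
  (P : probability Om R) (X : R -> Om -> R) (tau : Om -> \bar R).
Notation leb := (@lebesgue_measure R).
Context (T0 : 0 < T) (mX : forall t : R, 0 <= t <= T -> measurable_fun setT (X t))
  (mtau : measurable_fun setT tau).

Lemma measurable_alive (r : R) : measurable [set w | (r%:E < tau w)%E].
Proof.
by rewrite -[X in measurable X]setTI; exact: emeasurable_fun_o_infty.
Qed.

Lemma measurable_conv_integrand (g : R -> R) (r x : R) : 0 <= r <= T -> continuous g ->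
  measurable_fun setT (fun w => g (x - X r w)).
Proof.
move=> rT cg; apply: (@measurableT_comp _ _ _ _ _ _ g).
  exact: continuous_measurable_fun.
by apply: measurable_funB => //; exact: mX.
Qed.

Lemma conv_nu_bound (g : R -> R) (M r x : R) : 0 <= r <= T -> continuous g ->
  (forall y, `|g y| <= M) -> `|conv_nu P X tau g r x| <= M.
Proof.
move=> rT cg gM; apply: Rintegral_boundP => //.
- exact: le_trans (gM 0).
- exact: measurable_alive.
- by apply: measurable_funTS; exact: measurable_conv_integrand.
Qed.

Lemma conv_nu_lipschitz (g : R -> R) (M L r x y : R) : 0 <= r <= T -> continuous g ->
  (forall z, `|g z| <= M) -> lipschitz_const g L ->
  `|conv_nu P X tau g r x - conv_nu P X tau g r y| <= L * `|x - y|.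
Proof.
move=> rT cg gM gL.
have mA := measurable_alive r.
have mg z : measurable_fun [set w | (r%:E < tau w)%E] (fun w => g (z - X r w)).
  by apply: measurable_funTS; exact: measurable_conv_integrand.
have ig z : P.-integrable [set w | (r%:E < tau w)%E] (EFin \o (fun w => g (z - X r w))).
  exact: (@integrable_boundedP _ _ _ P _ _ M).
rewrite /conv_nu -RintegralB//; apply: Rintegral_boundP => //.
- exact: le_trans (gL x y).
- exact: measurable_funB.
- move=> w _; apply: le_trans (gL _ _) _.
  by rewrite (_ : x - X r w - (y - X r w) = x - y)//; ring.
Qed.

Lemma tconv_nu_bound (g : R -> R) (M s x : R) : 0 <= s <= T -> continuous g ->
  (forall y, `|g y| <= M) -> `|tconv_nu P X tau g s x| <= M * s.
Proof.
move=> /andP[s0 sT] cg gM; apply: Rintegral_lele_bound => // r /andP[r0 rs].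
by apply: conv_nu_bound => //; rewrite r0 (le_trans rs).
Qed.

Lemma tconv_nu_ge0 (g : R -> R) (s x : R) : (forall y, 0 <= g y) ->
  0 <= tconv_nu P X tau g s x.
Proof. by move=> g0; apply: Rintegral_ge0 => r _; exact: Rintegral_ge0. Qed.

Lemma tconv_nu_time_lipschitz (g : R -> R) (M s t x : R) : 0 <= s <= T -> 0 <= t <= T ->
  continuous g -> (forall y, `|g y| <= M) ->
  `|tconv_nu P X tau g s x - tconv_nu P X tau g t x| <= M * `|s - t|.
Proof.
move=> sT tT cg gM.
have wlg (q r : R) : 0 <= q -> q <= r -> r <= T ->
    `|tconv_nu P X tau g r x - tconv_nu P X tau g q x| <= M * `|r - q|.
  move=> q0 qr rT; rewrite [X in _ <= _ * X]ger0_norm ?subr_ge0//.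
  apply: Rintegral_lele_lipschitz => [|y /andP[y0 yr]]; first by rewrite q0.
  by apply: conv_nu_bound => //; rewrite y0 (le_trans yr).
case/andP: sT tT => s0 sT /andP[t0 tT]; have [st|/ltW ts] := leP s t.
  by rewrite distrC (distrC s); exact: wlg.
exact: wlg.
Qed.

Context (B : R) (W : R -> Om -> R) (X0 : Om -> R) (b : R -> R -> R).
Context (bB : forall s x : R, 0 <= s <= T -> `|b s x| <= B).
Context (cW : {ae P, forall w, {within `[0, +oo[, continuous (W^~ w)}}).
Context (XE : {ae P, forall w, forall t, 0 <= t <= T -> (t%:E < tau w)%E ->
     X t w = X0 w + \int[leb]_(s in [set s | 0 <= s <= t]) b s (X s w)
             + Num.sqrt 2 * W t w}).

Lemma within_W_segment (w : Om) : {within `[0, +oo[, continuous (W^~ w)} ->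
  {within `[0, T], continuous (W^~ w)}.
Proof.
apply: continuous_subspaceW => x /=; rewrite !in_itv/= andbT => /andP[] //.
Qed.

(** Limits are taken from the right: a path alive at [r] stays alive slightly longer and moves
    continuously, and a dead path stays dead, whereas from the left the restricted function may jump
    at [tau]. *)
Lemma alive_right_cvg (r : R) (r_ : nat -> R) (g : R -> R) (w : Om) :
  continuous g -> 0 <= r <= T -> (forall n, r <= r_ n <= T) -> r_ @ \oo --> r ->
  {within `[0, +oo[, continuous (W^~ w)} ->
  (forall t, 0 <= t <= T -> (t%:E < tau w)%E ->
     X t w = X0 w + \int[leb]_(s in [set s | 0 <= s <= t]) b s (X s w)
             + Num.sqrt 2 * W t w) ->
  ((fun w => g (X (r_ n) w)) \_ [set w | ((r_ n)%:E < tau w)%E]) w @[n --> \oo] -->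
  ((fun w => g (X r w)) \_ [set w | (r%:E < tau w)%E]) w.
Proof.
move=> cg rT rr cr cWw XEw; have /andP[r0 rT'] := rT.
have B0 : 0 <= B by apply: le_trans (bB 0 rT).
have [rtau|taur] := ltP r%:E (tau w); last first.
  rewrite {2}/patch memNset/=; last by apply/negP; rewrite -leNgt.
  apply: cvg_near_cst; apply: nearW => n; rewrite /patch memNset//=.
  apply/negP; rewrite -leNgt (le_trans taur)// lee_fin.
  by case/andP: (rr n).
rewrite {2}/patch mem_set//.
have near_alive : \forall n \near \oo, ((r_ n)%:E < tau w)%E.
  case E : (tau w) rtau => [u| |] //; last by move=> _; apply: nearW => n; rewrite ltry.
  rewrite lte_fin => ru; have H : \forall n \near \oo, r_ n < u by exact: (cvgr_lt r).
  by apply: filterS H => n; rewrite lte_fin.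
have cX : X (r_ n) w @[n --> \oo] --> X r w.
  apply/cvgrPdist_le => e e0.
  have := (subspace_continuousP _ _).1 (within_W_segment cWw) r.
  rewrite /= in_itv/= rT => /(_ isT)/cvgrPdist_le/(_ (e / 4)).
  rewrite divr_gt0// => /(_ isT)[del /= del0 delP].
  have eB : 0 < e / (2 * (B + 1)) by rewrite divr_gt0// mulr_gt0// ltr_wpDl.
  near=> n.
  have al : ((r_ n)%:E < tau w)%E by near: n.
  have rnT : 0 <= r_ n <= T by have /andP[rr1 ->] := rr n; rewrite (le_trans r0).
  have d1 : `|r - r_ n| < del by near: n; move/cvgrPdist_lt : cr => /(_ _ del0); apply: filterS.
  have d2 : `|r - r_ n| <= e / (2 * (B + 1)).
    by near: n; move/cvgrPdist_le : cr => /(_ _ eB); apply: filterS.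
  have := delP (r_ n) d1; rewrite in_itv/= rnT => /(_ isT) d3.
  have I := @solution_increment R b T B bB (X^~ w) (W^~ w) (X0 w) _ _ rnT rT
    (XEw _ rnT al) (XEw _ rT rtau).
  apply: le_trans I _.
  have : B * `|r - r_ n| <= e / 2.
    have -> : e / 2 = (B + 1) * (e / (2 * (B + 1))).
      by field; rewrite gt_eqF// ltr_wpDl.
    by apply: ler_pM => //; rewrite lerDl.
  lra.
apply: (@cvg_trans _ (g (X (r_ n) w) @[n --> \oo])); last first.
  by apply: (@cvg_comp _ _ _ (fun n => X (r_ n) w) g _ _ _ cX); exact: cg.
apply: near_eq_cvg; near=> n.
have al : ((r_ n)%:E < tau w)%E by near: n.
by rewrite /patch mem_set.
Unshelve. all: by end_near. Qed.

Lemma conv_nu_right_cvg (g : R -> R) (M r x : R) (r_ : nat -> R) : continuous g ->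
  (forall y, `|g y| <= M) ->
  0 <= r <= T -> (forall n, r <= r_ n <= T) -> r_ @ \oo --> r ->
  conv_nu P X tau g (r_ n) x @[n --> \oo] --> conv_nu P X tau g r x.
Proof.
move=> cg gM rT rr cr; have /andP[r0 _] := rT.
rewrite /conv_nu Rintegral_mkcond; under eq_fun do rewrite Rintegral_mkcond.
have rnT n : 0 <= r_ n <= T by have /andP[rr1 ->] := rr n; rewrite (le_trans r0).
have cgx : continuous (fun y => g (x - y)).
  move=> y; apply: (@cvg_comp _ _ _ (fun y => x - y) g); last exact: cg.
  by apply: cvgB; [exact: cvg_cst|exact: cvg_id].
apply: (@Rintegral_bounded_cvg _ _ _ P setT _ _ M) => //.
- by rewrite prob_fin.
- move=> n; apply/(measurable_restrictT _ (measurable_alive _)).1.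
  by apply: measurable_funTS; exact: measurable_conv_integrand.
- apply/(measurable_restrictT _ (measurable_alive _)).1.
  by apply: measurable_funTS; exact: measurable_conv_integrand.
- apply: filterS2 cW XE => w cWw XEw _.
  exact: (@alive_right_cvg r r_ (fun y => g (x - y))).
- move=> n w _; rewrite /patch; case: ifPn => // _.
  by rewrite normr0 (le_trans _ (gM 0)).
Qed.

Lemma measurable_conv_nu (g : R -> R) (M x : R) : continuous g -> (forall y, `|g y| <= M) ->
  measurable_fun [set r | 0 <= r <= T] (fun r => conv_nu P X tau g r x).
Proof.
move=> cg gM; apply: right_continuous_measurable; first exact: ltW.
by move=> r r_ rT rr cr; exact: (@conv_nu_right_cvg g M r x r_).
Qed.

(** Unlike the estimate in time, this one subtracts two time integrals under a single sign, which
    calls for measurability in [r] and thus for the path equation. *)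
Lemma tconv_nu_space_lipschitz (g : R -> R) (M L s x y : R) : 0 <= s <= T ->
  continuous g -> (forall z, `|g z| <= M) -> lipschitz_const g L ->
  `|tconv_nu P X tau g s x - tconv_nu P X tau g s y| <= T * L * `|x - y|.
Proof.
move=> /andP[s0 sT] cg gM gL.
have sub : [set r | 0 <= r <= s] `<=` [set r | 0 <= r <= T].
  by move=> r /= /andP[-> /le_trans]; exact.
have mc z : measurable_fun [set r | 0 <= r <= s] (fun r => conv_nu P X tau g r z).
  by apply: (measurable_funS _ sub (measurable_conv_nu z cg gM)); exact: measurable_lele.
have ic z : leb.-integrable [set r | 0 <= r <= s] (EFin \o (fun r => conv_nu P X tau g r z)).
  apply: (@integrable_bounded _ _ _ leb _ (fun r => conv_nu P X tau g r z) M).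
  - exact: measurable_lele.
  - exact: leb_cc_lty.
  - exact: mc.
  - by move=> r /sub rT; exact: conv_nu_bound.
have ms : measurable ([set r | 0 <= r <= s] : set (measurableTypeR R)) by exact: measurable_lele.
rewrite /tconv_nu -(RintegralB ms (ic x) (ic y)).
apply: (@le_trans _ _ (L * `|x - y| * fine (leb [set r | 0 <= r <= s]))).
  apply: Rintegral_bound.
  - exact: measurable_lele.
  - exact: leb_cc_lty.
  - by apply: measurable_funB; exact: mc.
  - by move=> r /sub rT; exact: (conv_nu_lipschitz _ _ rT cg gM).
rewrite leb_cc//= mulrC mulrA ler_wpM2r//.
have L0 : 0 <= L by have := gL 1 0; rewrite subr0 normr1 mulr1; exact: le_trans.
exact: ler_wpM2r.
Qed.

End coefficients.

(** * The exponential variable *)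

Section exponential_clock.
Context (R : realType) (d : measure_display) (Om : measurableType d)
  (P : probability Om R) (Z : Om -> R).
Notation leb := (@lebesgue_measure R).
Context (mZ : measurable_fun setT Z)
  (lawZ : forall B, measurable B -> P (Z @^-1` B) = exponential_prob 1 B).

Lemma exponential_clock_lt0 : P (Z @^-1` `]-oo, 0[) = 0%E.
Proof.
rewrite lawZ//; apply: integral0_eq => x /=; rewrite in_itv/= => x0.
by rewrite lt0_exponential_pdf.
Qed.

Lemma exponential_clock_le (a : R) : 0 <= a -> P (Z @^-1` `]-oo, a]) = (1 - expR (- a))%:E.
Proof.
move=> a0.
have mpre (i : interval R) : measurable (Z @^-1` [set` i]).
  by rewrite -[X in measurable X]setTI; exact: mZ.
have -> : Z @^-1` `]-oo, a] = Z @^-1` `]-oo, 0[ `|` Z @^-1` `[0, a].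
  apply/seteqP; split => w /=; rewrite !in_itv/=.
    by move=> Za; case: (ltP (Z w) 0) => Z0; [left|right]; rewrite ?in_itv/= ?Z0 ?Za.
  by move=> []; rewrite ?in_itv/=; [move=> /ltW Z0; exact: le_trans a0|move=> /andP[]].
pose N := Z @^-1` `]-oo, 0[; pose I := Z @^-1` `[0, a].
transitivity (P N + P I)%E.
  have NI : N `&` I = set0.
    apply/seteqP; split => // w /= []; rewrite /N /I/= !in_itv/= => Z0 /andP[].
    by move=> Z1; move: Z0; rewrite ltNge Z1.
  exact: (measureU P (mpre _) (mpre _) NI).
rewrite /N exponential_clock_lt0 add0e /I lawZ//.
move: a0; rewrite le_eqVlt => /predU1P[<-|a0].
  rewrite oppr0 expR0 subrr set_itv1.
  by rewrite /exponential_prob integral_set1.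
by rewrite exponential_prob_itv0c// EFinB mulN1r.
Qed.

Lemma exponential_clock_gt (a : R) : 0 <= a -> P [set w | a < Z w] = (expR (- a))%:E.
Proof.
move=> a0.
have mpre : measurable (Z @^-1` `]-oo, a]).
  by rewrite -[X in measurable X]setTI; exact: mZ.
have -> : [set w | a < Z w] = ~` (Z @^-1` `]-oo, a]).
  apply/seteqP; split => w /=; rewrite in_itv/=.
    by move=> aZ; rewrite leNgt aZ.
  by move=> /negP; rewrite -ltNge.
rewrite probability_setC// exponential_clock_le//.
by rewrite -EFinB; congr EFin; ring.
Qed.

Lemma exponential_clock_gt0 : {ae P, forall w, 0 < Z w}.
Proof.
exists (Z @^-1` `]-oo, 0]); split.
- by rewrite -[X in measurable X]setTI; exact: mZ.
- by rewrite exponential_clock_le// oppr0 expR0 subrr.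
- by move=> w /= /negP; rewrite -leNgt in_itv.
Qed.

(* The exponential variable integrates out a threshold that is independent of it. *)
Lemma Rintegral_clock (dU : measure_display) (TU : measurableType dU) (U : Om -> TU)
    (Phi c : TU -> R) (C : R) :
  measurable_fun setT U ->
  (forall A B, measurable A -> measurable B ->
    P (U @^-1` A `&` Z @^-1` B) = (P (U @^-1` A) * P (Z @^-1` B))%E) ->
  measurable_fun setT Phi -> (forall u, `|Phi u| <= C) ->
  measurable_fun setT c -> (forall u, 0 <= c u) ->
  \int[P]_w (Phi (U w) * (if c (U w) < Z w then 1 else 0)) =
  \int[P]_w (Phi (U w) * expR (- c (U w))).
Proof.
move=> mU indep mPhi PhiC mc c0.
pose Z' : {mfun Om >-> R} := HB.pack Z (isMeasurableFun.Build _ _ _ _ Z mZ).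
pose f (x : TU * R) := Phi x.1 * (if c x.1 < x.2 then 1 else 0).
have mf : measurable_fun setT f.
  apply: measurable_funM; first exact: measurableT_comp.
  apply: measurable_fun_ifT => //.
  by apply: measurable_fun_ltr; [exact: (measurableT_comp mc measurable_fst)|exact: measurable_snd].
have fC x : `|f x| <= C.
  rewrite /f normrM; case: ifP => _; first by rewrite normr1 mulr1.
  by rewrite normr0 mulr0; exact: le_trans (normr_ge0 _) (PhiC x.1).
have [H _] := @Rintegral_indep _ _ _ Om TU R R P U Z (distribution P Z') f C mU mZ
  (fun B _ => erefl) indep mf fC.
rewrite /f/= in H; rewrite H; apply: eq_Rintegral => w _.
have m1 : measurable [set y : R | c (U w) < y].
  have -> : [set y : R | c (U w) < y] = `]c (U w), +oo[%classic.
    by apply/seteqP; split => y /=; rewrite in_itv/= andbT.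
  exact: measurable_itv.
have -> : (fun y : R => Phi (U w) * (if c (U w) < y then 1 else 0)) =
    (fun y => Phi (U w) * \1_[set y : R | c (U w) < y] y).
  apply/funext => y; congr (_ * _); rewrite indicE; case: ifPn => cy.
    by rewrite mem_set.
  by rewrite memNset//=; exact/negP.
rewrite RintegralZl//; last first.
  apply: (@integrable_boundedP _ _ _ (distribution P Z') setT _ 1) => //.
  by move=> y _; rewrite indicE; case: (_ \in _); rewrite ?normr1 ?normr0.
congr (_ * _); rewrite /Rintegral integral_indic// setIT.
rewrite [X in fine X](_ : _ = (expR (- c (U w)))%:E)//.
exact: exponential_clock_gt.
Qed.

End exponential_clock.

(** * Measurability of the scheme for smaller sigma-algebras *)

Section sub_sigma_algebra.
Context (R : realType) (d : measure_display) (Om : measurableType d).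
Context (b k : R -> R -> R).

Lemma sub_sigma_algebra_preimage (dU : measure_display) (TU : measurableType dU)
    (G : set (set Om)) (U : Om -> TU) (B : set TU) : sigma_algebra setT G ->
  measurable_fun setT (U : g_sigma_algebraType G -> TU) -> measurable B -> G (U @^-1` B).
Proof.
move=> sG mU mB; have := mU measurableT B mB; rewrite setTI.
by rewrite /measurable/= sigma_algebra_id.
Qed.

Lemma measurable_sub_sigma_algebra (dU : measure_display) (TU : measurableType dU)
    (G : set (set Om)) (U : Om -> TU) : 
  (forall B, measurable B -> G (U @^-1` B)) ->
  measurable_fun setT (U : g_sigma_algebraType G -> TU).
Proof.
by move=> GU _ B mB; rewrite setTI; apply: sub_sigma_algebra; exact: GU.
Qed.

Context (T : R) (mb : forall s : R, 0 <= s <= T -> measurable_fun setT (b s))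
  (mk : forall s : R, 0 <= s <= T -> measurable_fun setT (k s)).

(** The measurable space is arbitrary, so one induction serves three times: for the ambient
    sigma-algebra, for [F (n%:R * h)] (adaptedness), and for the one generated by [X0] and [W]
    (independence from [Z]). *)
Lemma measurable_euler (d' : measure_display) (Om' : measurableType d') (X0 : Om' -> R)
    (W : R -> Om' -> R) (h : R) (n : nat) : 0 < h -> n%:R * h <= T ->
  measurable_fun setT X0 ->
  (forall t : R, 0 <= t <= n%:R * h -> measurable_fun setT (W t)) ->
  measurable_fun setT (fun w => euler b k h (X0 w) (W^~ w) n).
Proof.
move=> h0; elim: n => [|n IH] nT mX0 mW /=.
  by apply: measurable_fun_pair => //.
have t0 : 0 <= n%:R * h by rewrite mulr_ge0// ltW.
have tt : n%:R * h <= n.+1%:R * h by rewrite ler_wpM2r ?ler_nat// ltW.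
have tT : 0 <= n%:R * h <= T by rewrite t0 (le_trans tt).
have mE : measurable_fun setT (fun w => euler b k h (X0 w) (W^~ w) n).
  apply: IH => //; first exact: le_trans nT.
  by move=> t /andP[t0' tn]; apply: mW; rewrite t0' (le_trans tn).
have mY : measurable_fun setT (fun w => (euler b k h (X0 w) (W^~ w) n).1).
  exact: (measurableT_comp measurable_fst mE).
have mA : measurable_fun setT (fun w => (euler b k h (X0 w) (W^~ w) n).2).
  exact: (measurableT_comp measurable_snd mE).
have mW1 : measurable_fun setT (W (n%:R * h)) by apply: mW; rewrite t0.
have mW2 : measurable_fun setT (W (n.+1%:R * h)).
  by apply: mW; rewrite lexx (le_trans t0).
apply: measurable_fun_pair.
  apply: measurable_funD; last by apply: measurable_funM => //; exact: measurable_funB.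
  apply: measurable_funD => //; apply: measurable_funM => //.
  exact: (measurableT_comp (mb tT) mY).
apply: measurable_funD => //; apply: measurable_funM => //.
exact: (measurableT_comp (mk tT) mY).
Qed.

End sub_sigma_algebra.

(** * The killed diffusion with given coefficients: discounted expectations *)

Section killed_diffusion.
Context (R : realType) (T : R) (d : measure_display) (Om : measurableType d)
  (P : probability Om R) (F : R -> set (set Om)) (W : R -> Om -> R) (X0 Z : Om -> R)
  (b k : R -> R -> R) (B k0 k1 L : R) (X : R -> Om -> R) (tau : Om -> \bar R).
Notation leb := (@lebesgue_measure R).
Context (T0 : 0 < T) (L0 : 0 <= L) (B0 : 0 <= B) (k0_gt0 : 0 < k0) (k1_gt0 : 0 < k1).
Context (bB : forall s x : R, 0 <= s <= T -> `|b s x| <= B).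
Context (kB : forall s x : R, 0 <= s -> 0 <= k s x <= k1).
Context (kB0 : forall s x : R, 0 <= s <= T -> k0 <= k s x).
Context (bL : forall s s' x y : R, 0 <= s <= T -> 0 <= s' <= T ->
  `|b s x - b s' y| <= L * (`|s - s'| + `|x - y|)).
Context (kL : forall s s' x y : R, 0 <= s <= T -> 0 <= s' <= T ->
  `|k s x - k s' y| <= L * (`|s - s'| + `|x - y|)).
Context (filF : filtration F) (bmW : brownian_motion P F W)
  (mX0 : measurable_fun setT X0) (FX0 : forall B, measurable B -> F 0 (X0 @^-1` B))
  (mZ : measurable_fun setT Z)
  (lawZ : forall B, measurable B -> P (Z @^-1` B) = exponential_prob 1 B)
  (indepZ : indep_sets P (sigma_gen (fun _ : unit => Z))
    (sigma_gen (fun i : option {t : R | 0 <= t} =>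
                  match i with None => X0 | Some t => W (sval t) end)))
  (mX : forall t : R, 0 <= t <= T -> measurable_fun setT (X t))
  (mtau : measurable_fun setT tau)
  (XE : {ae P, forall w, forall t : R, 0 <= t <= T -> (t%:E < tau w)%E ->
     X t w = X0 w + \int[leb]_(s in [set s | 0 <= s <= t]) b s (X s w)
             + Num.sqrt 2 * W t w})
  (tauE : forall w, tau w = ereal_inf [set t%:E | t in [set t | 0 <= t /\
        Z w <= \int[leb]_(s in [set s | 0 <= s <= t]) k s (X s w)]]).
Notation eul h n w := (euler b k h (X0 w) (W^~ w) n).

Lemma lipschitz_space_continuous (g : R -> R -> R) (s : R) : 0 <= s <= T ->
  (forall s s' x y : R, 0 <= s <= T -> 0 <= s' <= T ->
    `|g s x - g s' y| <= L * (`|s - s'| + `|x - y|)) -> continuous (g s).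
Proof.
move=> sT gL x; apply/cvgrPdist_le => e e0.
have L1 : 0 < L + 1 by rewrite ltr_wpDl.
have eL : 0 < e / (L + 1) by rewrite divr_gt0.
near=> y.
apply: le_trans (gL _ _ _ _ sT sT) _; rewrite subrr normr0 add0r.
have xy : `|x - y| <= e / (L + 1).
  by near: y; have /cvgrPdist_le/(_ _ eL) := @cvg_id _ (nbhs x).
have -> : e = (L + 1) * (e / (L + 1)) by field; rewrite gt_eqF.
by apply: ler_pM => //; rewrite lerDl.
Unshelve. all: by end_near. Qed.

Lemma lipschitz_seq_cvg (g : R -> R -> R) (t u : nat -> R) (s x : R) :
  0 <= s <= T -> (forall n, 0 <= t n <= T) ->
  (forall s s' x y : R, 0 <= s <= T -> 0 <= s' <= T ->
    `|g s x - g s' y| <= L * (`|s - s'| + `|x - y|)) ->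
  t @ \oo --> s -> u @ \oo --> x -> g (t n) (u n) @[n --> \oo] --> g s x.
Proof.
move=> sT tT gL ct cu; apply/cvgrPdist_le => e e0.
have L1 : 0 < L + 1 by rewrite ltr_wpDl.
have eL : 0 < e / (2 * (L + 1)) by rewrite divr_gt0// mulr_gt0.
near=> n.
apply: le_trans (gL _ _ _ _ sT (tT n)) _.
have d1 : `|s - t n| <= e / (2 * (L + 1)).
  by near: n; move/cvgrPdist_le : ct => /(_ _ eL); apply: filterS.
have d2 : `|x - u n| <= e / (2 * (L + 1)).
  by near: n; move/cvgrPdist_le : cu => /(_ _ eL); apply: filterS.
have -> : e = (L + 1) * (e / (2 * (L + 1)) + e / (2 * (L + 1))) by field; rewrite gt_eqF.
by apply: ler_pM; [|rewrite addr_ge0|rewrite lerDl|exact: lerD].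
Unshelve. all: by end_near. Qed.

Lemma measurable_coeff (g : R -> R -> R) (s : R) : 0 <= s <= T ->
  (forall s s' x y : R, 0 <= s <= T -> 0 <= s' <= T ->
    `|g s x - g s' y| <= L * (`|s - s'| + `|x - y|)) -> measurable_fun setT (g s).
Proof. by move=> sT gL; apply: continuous_measurable_fun; exact: lipschitz_space_continuous. Qed.

Lemma integrable_P (f : Om -> R) (C : R) : measurable_fun setT f -> (forall w, `|f w| <= C) ->
  P.-integrable setT (EFin \o f).
Proof. by move=> mf fC; apply: (@integrable_boundedP _ _ _ P setT f C). Qed.

Lemma measurable_eul (h : R) (n : nat) : 0 < h -> n%:R * h <= T ->
  measurable_fun setT (fun w => eul h n w).
Proof.
move=> h0 nT; case: bmW => mW _ _ _ _.
apply: (@measurable_euler R b k T) => //.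
- by move=> s sT; exact: measurable_coeff.
- by move=> s sT; exact: measurable_coeff.
- by move=> t /andP[t0 _]; exact: mW.
Qed.

Lemma eul_adapted (h : R) (n : nat) (A : set (R * R)) : 0 < h -> n%:R * h <= T ->
  measurable A -> F (n%:R * h) ((fun w => eul h n w) @^-1` A).
Proof.
move=> h0 nT mA; case: bmW => _ FW _ _ _; case: filF => sF leF.
have t0 : 0 <= n%:R * h by rewrite mulr_ge0// ltW.
have [sigF _] := sF _ t0.
apply: sub_sigma_algebra_preimage => //.
apply: (@measurable_euler R b k T) => //.
- by move=> s sT; exact: measurable_coeff.
- by move=> s sT; exact: measurable_coeff.
- by apply: measurable_sub_sigma_algebra => D mD; apply: (leF 0) => //; exact: FX0.
- move=> t /andP[t0' tn]; apply: measurable_sub_sigma_algebra => D mD.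
  by apply: (leF t) => //; exact: FW.
Qed.

Lemma eul_indep_clock (h : R) (n : nat) (A : set (R * R)) (D : set R) : 0 < h -> n%:R * h <= T ->
  measurable A -> measurable D ->
  P ((fun w => eul h n w) @^-1` A `&` Z @^-1` D) =
  (P ((fun w => eul h n w) @^-1` A) * P (Z @^-1` D))%E.
Proof.
move=> h0 nT mA mD; rewrite setIC muleC; apply: indepZ.
  by apply: sub_sigma_algebra; exists tt, D.
apply: sub_sigma_algebra_preimage => //; first exact: smallest_sigma_algebra.
have gen (i : option {t : R | 0 <= t}) (D' : set R) : measurable D' ->
    sigma_gen (fun i : option {t : R | 0 <= t} =>
                  match i with None => X0 | Some t => W (sval t) end)
      ((match i with None => X0 | Some t => W (sval t) end) @^-1` D').
  by move=> mD'; apply: sub_sigma_algebra; exists i, D'.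
apply: (@measurable_euler R b k T) => //.
- by move=> s sT; exact: measurable_coeff.
- by move=> s sT; exact: measurable_coeff.
- by apply: measurable_sub_sigma_algebra => D' mD'; exact: (gen None).
- move=> t /andP[t0' tn]; apply: measurable_sub_sigma_algebra => D' mD'.
  exact: (gen (Some (exist _ t t0'))).
Qed.

Lemma eul_clock_ge0 (h : R) (n : nat) (w : Om) : 0 < h -> 0 <= (eul h n w).2.
Proof.
move=> h0; elim: n => [|n IH] //=; rewrite addr_ge0// mulr_ge0 ?(ltW h0)//.
by have /andP[] := kB (eul h n w).1 (mulr_ge0 (ler0n R n) (ltW h0)).
Qed.

Definition discounted (h : R) (n : nat) (Phi : R -> R) : R :=
  \int[P]_w (Phi (eul h n w).1 * expR (- (eul h n w).2)).

Lemma measurable_discounted (h : R) (n : nat) (Phi : R -> R) : 0 < h -> n%:R * h <= T ->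
  measurable_fun setT Phi ->
  measurable_fun setT (fun w => Phi (eul h n w).1 * expR (- (eul h n w).2)).
Proof.
move=> h0 nT mPhi; have mE := measurable_eul h0 nT.
apply: measurable_funM.
  exact: (measurableT_comp mPhi (measurableT_comp measurable_fst mE)).
have mN : measurable_fun setT (fun w => - (eul h n w).2).
  by apply: measurableT_comp => //; exact: (measurableT_comp measurable_snd mE).
exact: (measurableT_comp (@measurable_expR R) mN).
Qed.

Lemma discounted_integrand_bound (h : R) (n : nat) (Phi : R -> R) (C : R) (w : Om) : 0 < h ->
  (forall x, `|Phi x| <= C) -> `|Phi (eul h n w).1 * expR (- (eul h n w).2)| <= C.
Proof.
move=> h0 PhiC; rewrite normrM (ger0_norm (expR_ge0 _)) -[leRHS]mulr1.
apply: ler_pM => //.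
by rewrite -expR0 ler_expR oppr_le0; exact: eul_clock_ge0.
Qed.

Lemma discounted_bound (h : R) (n : nat) (Phi : R -> R) (C : R) : 0 < h -> n%:R * h <= T ->
  measurable_fun setT Phi -> (forall x, `|Phi x| <= C) -> `|discounted h n Phi| <= C.
Proof.
move=> h0 nT mPhi PhiC; apply: Rintegral_boundP => //.
- exact: le_trans (normr_ge0 _) (PhiC 0).
- exact: measurable_discounted.
- by move=> w _; exact: discounted_integrand_bound.
Qed.

(** The threshold [c] is a free function of state and clock, so that the clock shifted up or down by
    [eps] can be compared with [Z] too. *)
Lemma discounted_clock (h : R) (n : nat) (Phi : R -> R) (c : R * R -> R) (C : R) :
  0 < h -> n%:R * h <= T -> measurable_fun setT Phi -> (forall x, `|Phi x| <= C) ->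
  measurable_fun setT c -> (forall x, 0 <= c x) ->
  \int[P]_w (Phi (eul h n w).1 * (if c (eul h n w) < Z w then 1 else 0)) =
  \int[P]_w (Phi (eul h n w).1 * expR (- c (eul h n w))).
Proof.
move=> h0 nT mPhi PhiC mc c0.
apply: (@Rintegral_clock R d Om P Z mZ lawZ _ _ (fun w => eul h n w)
  (fun x : R * R => Phi x.1) c C) => //.
- exact: measurable_eul.
- by move=> A D mA mD; exact: eul_indep_clock.
- exact: (measurableT_comp mPhi measurable_fst).
Qed.

Lemma measurable_max0 : measurable_fun setT (fun x : R * R => Num.max 0 x.2).
Proof. by apply: measurable_maxr => //; exact: measurable_snd. Qed.

Lemma discountedE (h : R) (n : nat) (Phi : R -> R) (C : R) :
  0 < h -> n%:R * h <= T -> measurable_fun setT Phi -> (forall x, `|Phi x| <= C) ->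
  discounted h n Phi =
  \int[P]_w (Phi (eul h n w).1 * (if (eul h n w).2 < Z w then 1 else 0)).
Proof.
move=> h0 nT mPhi PhiC.
(* A threshold must be nonnegative on all pairs; clipping the clock at zero ensures this and changes
   nothing along the scheme. *)
have mE w : Num.max 0 (eul h n w).2 = (eul h n w).2.
  by apply/max_idPr; exact: eul_clock_ge0.
have := @discounted_clock h n Phi (fun x => Num.max 0 x.2) C h0 nT mPhi PhiC
  measurable_max0 (fun x => _).
rewrite /discounted => H.
transitivity (\int[P]_w (Phi (eul h n w).1 * expR (- Num.max 0 (eul h n w).2))).
  by apply: eq_Rintegral => w _; rewrite mE.
rewrite -H; last by move=> x; rewrite le_max lexx.
by apply: eq_Rintegral => w _; rewrite mE.
Qed.

(** * Killing at a fixed time is null; convergence of discounted expectations *)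

Section paths.
Context (h : nat -> R) (h0 : forall n, 0 < h n) (ch : h @ \oo --> 0).

Lemma good_paths : {ae P, forall w, [/\ 0 < Z w, W 0 w = 0,
  {within `[0, +oo[, continuous (W^~ w)} &
  forall t : R, 0 <= t <= T -> (t%:E < tau w)%E ->
     X t w = X0 w + \int[leb]_(s in [set s | 0 <= s <= t]) b s (X s w)
             + Num.sqrt 2 * W t w]}.
Proof.
case: bmW => _ _ W0 cW _.
have Z0 := exponential_clock_gt0 mZ lawZ.
have H1 : {ae P, forall w, 0 < Z w /\ W 0 w = 0} by apply: filterS2 Z0 W0.
have H2 : {ae P, forall w, {within `[0, +oo[, continuous (W^~ w)} /\
  forall t : R, 0 <= t <= T -> (t%:E < tau w)%E ->
     X t w = X0 w + \int[leb]_(s in [set s | 0 <= s <= t]) b s (X s w)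
             + Num.sqrt 2 * W t w} by apply: filterS2 cW XE.
by apply: filterS2 H1 H2 => w [? ?] [? ?].
Qed.

Context (s : R) (m : nat -> nat) (sT : 0 <= s <= T)
  (ms : forall n, (m n)%:R * h n <= s) (cm : (m n)%:R * h n @[n --> \oo] --> s).

Lemma mT n : (m n)%:R * h n <= T.
Proof. by apply: le_trans (ms n) _; case/andP: sT. Qed.

(** On this event the Euler clock at time [s] converges to [Z], so eventually [Z] lies in a window
    of half-width [eps] around it. The clock is independent of [Z] and [expR (- a)] is 1-Lipschitz
    for [a >= 0], so the window has probability at most [2 * eps]. *)
Lemma tau_atomless : P [set w | tau w = s%:E] = 0%E.
Proof.
have mS : measurable [set w | tau w = s%:E].
  rewrite -[X in measurable X]setTI.
  exact: (measurable_eqe measurableT mtau (measurable_cst _)).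
apply/eqP; rewrite eq_le measure_ge0 andbT; apply/lee_addgt0Pr => e e0; rewrite add0e.
pose eps := e / 2.
have eps0 : 0 < eps by rewrite divr_gt0.
pose cm' (x : R * R) := Num.max 0 (x.2 - eps).
pose cp (x : R * R) := Num.max 0 x.2 + eps.
have mcm : measurable_fun setT cm'.
  apply: measurable_maxr => //; apply: measurable_funB => //; exact: measurable_snd.
have mcp : measurable_fun setT cp by apply: measurable_funD => //; exact: measurable_max0.
have cm0 x : 0 <= cm' x by rewrite /cm' le_max lexx.
have cp0 x : 0 <= cp x by rewrite /cp addr_ge0 ?le_max ?lexx// ltW.
have cmp x : cm' x <= cp x.
  by rewrite /cm' /cp; case: (leP 0 x.2) => ?; case: (leP 0 (x.2 - eps)) => ?; lra.
have cpm x : cp x - cm' x <= 2 * eps.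
  by rewrite /cm' /cp; case: (leP 0 x.2) => ?; case: (leP 0 (x.2 - eps)) => ?; lra.
pose I (c : R * R -> R) n w : R := if c (eul (h n) (m n) w) < Z w then 1 else 0.
have mI (c : R * R -> R) n : measurable_fun setT c -> measurable_fun setT (I c n).
  move=> mc; apply: measurable_fun_ifT => //.
  apply: measurable_fun_ltr => //.
  exact: (measurableT_comp mc (measurable_eul (h0 n) (mT n))).
have I01 (c : R * R -> R) n w : `|I c n w| <= 1 by rewrite /I; case: ifP; rewrite ?normr1 ?normr0.
have iI (c : R * R -> R) n : measurable_fun setT c -> P.-integrable setT (EFin \o I c n).
  by move=> mc; apply: (@integrable_P _ 1); [exact: mI|exact: I01].
have EI (c : R * R -> R) n : measurable_fun setT c -> (forall x : R * R, 0 <= c x) ->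
    \int[P]_w I c n w = \int[P]_w expR (- c (eul (h n) (m n) w)).
  move=> mc c0; have := @discounted_clock (h n) (m n) (cst 1) c 1 (h0 n) (mT n) _ _ mc c0.
  rewrite /= => H; transitivity (\int[P]_w (1 * I c n w)).
    by apply: eq_Rintegral => w _; rewrite mul1r.
  rewrite H//; last by move=> _; rewrite normr1.
  by apply: eq_Rintegral => w _; rewrite mul1r.
(* The indicator of [cm' < Z <= cp], written as a difference so that each term can be integrated
   against the exponential law. *)
pose N n w := I cm' n w - I cp n w.
have N0 n w : 0 <= N n w <= 1.
  rewrite /N /I; have := cmp (eul (h n) (m n) w).
  case: ifP => [a|/negbT a]; case: ifP => [a'|/negbT a']; rewrite ?subrr ?subr0 ?lexx ?ler01//.
  by move=> H; rewrite (le_lt_trans H a') in a.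
have mN n : measurable_fun setT (N n) by apply: measurable_funB; exact: mI.
have EN n : \int[P]_w N n w <= 2 * eps.
  have mexp (c : R * R -> R) : measurable_fun setT c ->
      measurable_fun setT (fun w => expR (- c (eul (h n) (m n) w))).
    move=> mc; apply: (measurableT_comp (@measurable_expR R)).
    apply: measurableT_comp => //.
    exact: (measurableT_comp mc (measurable_eul (h0 n) (mT n))).
  have iexp (c : R * R -> R) : measurable_fun setT c -> (forall x : R * R, 0 <= c x) ->
      P.-integrable setT (EFin \o (fun w => expR (- c (eul (h n) (m n) w)))).
    move=> mc c0; apply: (@integrable_P _ 1); first exact: mexp.
    by move=> w; rewrite ger0_norm ?expR_ge0// -expR0 ler_expR oppr_le0.
  rewrite /N RintegralB//; [|exact: iI|exact: iI].
  rewrite !EI// -RintegralB//; [|exact: iexp|exact: iexp].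
  apply: le_trans (ler_norm _) _; apply: Rintegral_boundP => //.
  - by rewrite mulr_ge0// ltW.
  - by apply: measurable_funB; exact: mexp.
  - move=> w _; apply: le_trans (expRN_lipschitz (cm0 _) (cp0 _)) _.
    by rewrite distrC ger0_norm ?subr_ge0.
have cvgN : \int[P]_(w in [set w | tau w = s%:E]) N n w @[n --> \oo] -->
    \int[P]_(w in [set w | tau w = s%:E]) cst 1 w.
  apply: (@Rintegral_bounded_cvg _ _ _ P _ N (cst 1) 1) => //.
  - exact: prob_fin.
  - by move=> n; exact: measurable_funTS.
  - apply: filterS good_paths => w [Z0 W0 cW XEw] taus.
    have taus' := taus; rewrite /= tauE in taus'.
    have s0 : 0 < s.
      rewrite -lte_fin -taus'.
      exact: (@tau_gt0 R k k1 k1_gt0 kB (X^~ w) (Z w) Z0).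
    have eps2 : 0 < eps / 2 by rewrite divr_gt0.
    have s1 : 0 < s <= s by rewrite s0 lexx.
    have sT' : s <= T by case/andP: sT.
    have XE' := XEw; rewrite tauE in XE'.
    have := @euler_after R b k T B k0 k1 L L0 B0 k0_gt0 k1_gt0 bB kB kB0 bL kL
      (X^~ w) (W^~ w) (X0 w) W0 (within_W_segment cW) h h0 ch (Z w) XE' s s (eps / 2) m
      s1 sT' taus' ms cm eps2.
    rewrite subrr !mulr0 !addr0 => H.
    apply: cvg_near_cst; apply: filterS H => n /andP[H1 H2].
    rewrite /N /I /cm' /cp.
    have -> : Num.max 0 (eul (h n) (m n) w).2 = (eul (h n) (m n) w).2.
      by apply/max_idPr; exact: eul_clock_ge0.
    rewrite ifT; last by rewrite gt_max Z0/=; lra.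
    by rewrite ifF ?subr0//; apply/negbTE; rewrite -leNgt; lra.
  - by move=> n w _; have /andP[N1 N2] := N0 n w; rewrite ger0_norm.
have le1 : fine (P [set w | tau w = s%:E]) <= e.
  have -> : fine (P [set w | tau w = s%:E]) = \int[P]_(w in [set w | tau w = s%:E]) cst 1 w.
    by rewrite Rintegral_cst// mul1r.
  have -> : e = 2 * eps by rewrite /eps; field.
  rewrite -(cvg_lim _ cvgN)//; apply: limr_le; first by apply/cvg_ex; eexists; exact: cvgN.
  apply: nearW => n; apply: le_trans (EN n).
  rewrite Rintegral_mkcond; apply: le_Rintegral => //.
  - apply: (@integrable_P _ 1); first by apply/(measurable_restrictT _ mS).1; exact: measurable_funTS.
    move=> w; rewrite /patch; case: ifP; rewrite ?normr0// => _.
    by have /andP[N1 N2] := N0 n w; rewrite ger0_norm.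
  - apply: (@integrable_P _ 1) => // w.
    by have /andP[N1 N2] := N0 n w; rewrite ger0_norm.
  - by move=> w _; rewrite /patch; case: ifP => // _; case/andP: (N0 n w).
by rewrite -(fineK (fin_num_measure P _ mS)) lee_fin.
Qed.

(** The test function depends on [n] and converges continuously, because the approximate generator
    depends on the mesh and on the grid time. *)
Lemma discounted_cvg (Phi : R -> R) (Phi_ : nat -> R -> R) (C : R) :
  measurable_fun setT Phi -> (forall n, measurable_fun setT (Phi_ n)) ->
  (forall x, `|Phi x| <= C) -> (forall n x, `|Phi_ n x| <= C) ->
  (forall (u : nat -> R) (x : R), u @ \oo --> x -> Phi_ n (u n) @[n --> \oo] --> Phi x) ->
  discounted (h n) (m n) (Phi_ n) @[n --> \oo] -->
  \int[P]_(w in [set w | (s%:E < tau w)%E]) Phi (X s w).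
Proof.
move=> mPhi mPhi_ PhiC Phi_C cPhi.
have C0 : 0 <= C by exact: le_trans (normr_ge0 _) (PhiC 0).
under eq_fun do rewrite (discountedE (h0 _) (mT _) (mPhi_ _) (Phi_C _)).
rewrite Rintegral_mkcond.
apply: (@Rintegral_bounded_cvg _ _ _ P setT _ _ C) => //.
- by rewrite prob_fin.
- move=> n; have mE := measurable_eul (h0 n) (mT n).
  apply: measurable_funM.
    exact: (measurableT_comp (mPhi_ n) (measurableT_comp measurable_fst mE)).
  apply: measurable_fun_ifT => //; apply: measurable_fun_ltr => //.
  exact: (measurableT_comp measurable_snd mE).
- apply/(measurable_restrictT _ (measurable_alive mtau s)).1.
  by apply: measurable_funTS; exact: (measurableT_comp mPhi (mX sT)).
- have notau : {ae P, forall w, tau w != s%:E}.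
    exists [set w | tau w = s%:E]; split.
    + by rewrite -[X in measurable X]setTI; exact: (measurable_eqe measurableT mtau (measurable_cst _)).
    + exact: tau_atomless.
    + by move=> w /= /negP; rewrite negbK => /eqP.
  apply: filterS2 good_paths notau => w [Z0 W0 cW XEw] taus _.
  have XE' := XEw; rewrite tauE in XE'.
  have cWT := within_W_segment (T := T) cW.
  have [stau|taus'] := ltP s%:E (tau w).
    rewrite /patch mem_set//.
    have stau' := stau; rewrite tauE in stau'.
    have [cY cA Az] := @euler_before R b k T B k1 L L0 B0 k1_gt0 bB kB bL kL
      (X^~ w) (W^~ w) (X0 w) W0 cWT h h0 ch (Z w) XE' s m sT stau' ms cm.
    have H : \forall n \near \oo, (eul (h n) (m n) w).2 < Z w.
      exact: (cvgr_lt _ cA).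
    apply: (@cvg_trans _ (Phi_ n (eul (h n) (m n) w).1 @[n --> \oo])); last exact: cPhi.
    by apply: near_eq_cvg; apply: filterS H => n ->; rewrite mulr1.
  have taus'' : (tau w < s%:E)%E by rewrite lt_neqAle taus.
  rewrite /patch memNset/=; last by apply/negP; rewrite -leNgt.
  have tau0 : (0%:E < tau w)%E by rewrite tauE; exact: (@tau_gt0 R k k1 k1_gt0 kB (X^~ w) (Z w) Z0).
  case E : (tau w) taus'' tau0 => [u| |]//; rewrite !lte_fin => us u0.
  have us' : 0 < u <= s by rewrite u0 ltW.
  have sT' : s <= T by case/andP: sT.
  have E' := E; rewrite tauE in E'.
  (* Half of the guaranteed overrun [k0 * (s - u)] is given up as error; the other half keeps the
     discrete clock above [Z]. *)
  have e0 : 0 < k0 * (s - u) / 2 by rewrite divr_gt0// mulr_gt0// subr_gt0.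
  have := @euler_after R b k T B k0 k1 L L0 B0 k0_gt0 k1_gt0 bB kB kB0 bL kL
      (X^~ w) (W^~ w) (X0 w) W0 cWT h h0 ch (Z w) XE' s u _ m
      us' sT' E' ms cm e0 => H.
  apply: cvg_near_cst; apply: filterS H => n /andP[H1 _].
  rewrite ifF ?mulr0//; apply/negbTE; rewrite -leNgt.
  lra.
- move=> n w _; rewrite normrM -[leRHS]mulr1; apply: ler_pM => //.
  by case: ifP; rewrite ?normr1 ?normr0.
Qed.

End paths.

(** * Telescoping over the scheme and Dynkin's formula *)

Section generator_step.
Context (f : R -> R) (C : R).
Context (df : forall x, derivable f x 1) (ddf : forall x, derivable (derive1 f) x 1).
Context (cddf : continuous (derive1n 2 f)).
Context (fC : forall x, `|f x| <= C) (dfC : forall x, `|derive1 f x| <= C)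
  (ddfC : forall x, `|derive1n 2 f x| <= C).
Notation phi := (@normal_pdf R 0 1).

(** The approximate generator of mesh [h], with the coefficients frozen at [(t, y)]; it tends to
    [generator] as [h] vanishes. *)
Definition step_generator (h t y : R) : R :=
  \int[leb]_z (quotient f h (b t y) (k t y) y z * phi z).

Let kappaB (t y : R) : 0 <= t <= T -> 0 <= k t y <= k1.
Proof. by move=> /andP[t0 _]; exact: kB. Qed.

Lemma shifted_bound (h beta kappa u y : R) : 0 <= kappa * h ->
  `|shifted f h beta kappa u y| <= C.
Proof.
move=> kh; rewrite /shifted normrM (ger0_norm (expR_ge0 _)) -[leRHS]mul1r.
apply: ler_pM => //; first by rewrite -expR0 ler_expR oppr_le0.
Qed.

Lemma normal_shifted (h t y : R) : 0 < h <= 1 -> 0 <= t <= T ->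
  \int[normal_prob 0 (Num.sqrt h)]_x shifted f h (b t y) (k t y) y x =
  f y + h * step_generator h t y.
Proof.
move=> hh tT; have /andP[h0 h1] := hh; have /andP[kt0 kt1] := kappaB y tT.
rewrite (@Rintegral_normal_scale R _ C h h0).
- exact: (one_stepE df ddf fC dfC ddfC y hh (bB y tT) (kappaB y tT)).
- exact: continuous_shifted.
- by move=> x; apply: shifted_bound; rewrite mulr_ge0// ltW.
Qed.

(** Payoff after one step as a function of ((state, clock), increment). Clipping the clock at zero
    makes it bounded on the whole space, as integrating out the increment requires. *)
Let transition (h t : R) (x : (R * R) * R) : R :=
  expR (- Num.max 0 x.1.2) * shifted f h (b t x.1.1) (k t x.1.1) x.1.1 x.2.

Let measurable_transition (h t : R) : 0 <= t <= T -> measurable_fun setT (transition h t).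
Proof.
move=> tT.
have m11 : measurable_fun setT (fun x : (R * R) * R => x.1.1).
  exact: (measurableT_comp measurable_fst measurable_fst).
have m12 : measurable_fun setT (fun x : (R * R) * R => x.1.2).
  exact: (measurableT_comp measurable_snd measurable_fst).
have m2 : measurable_fun setT (fun x : (R * R) * R => x.2) by exact: measurable_snd.
have mb : measurable_fun setT (fun x : (R * R) * R => b t x.1.1).
  exact: (measurableT_comp (measurable_coeff tT bL) m11).
have mk : measurable_fun setT (fun x : (R * R) * R => k t x.1.1).
  exact: (measurableT_comp (measurable_coeff tT kL) m11).
have mf : measurable_fun setT f.
  by apply: continuous_measurable_fun; exact: derivable_continuous.
apply: measurable_funM.
  apply: (measurableT_comp (@measurable_expR R)); apply: measurableT_comp => //.
  exact: (measurableT_comp measurable_max0 measurable_fst).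
apply: measurable_funM.
  apply: (measurableT_comp (@measurable_expR R)); apply: measurableT_comp => //.
  exact: measurable_funM.
apply: (measurableT_comp mf); apply: measurable_funD.
  by apply: measurable_funD => //; exact: measurable_funM.
exact: measurable_funM.
Qed.

Let transition_bound (h t : R) (x : (R * R) * R) : 0 < h -> 0 <= t <= T -> `|transition h t x| <= C.
Proof.
move=> h0 tT; rewrite /transition normrM (ger0_norm (expR_ge0 _)) -[leRHS]mul1r.
apply: ler_pM => //.
  by rewrite -expR0 ler_expR oppr_le0 le_max lexx.
apply: shifted_bound; have /andP[kt0 _] := kappaB x.1.1 tT.
by rewrite mulr_ge0// ltW.
Qed.

Let Rintegral_transition (h t : R) (x : R * R) : 0 < h <= 1 -> 0 <= t <= T ->
  \int[normal_prob 0 (Num.sqrt h)]_y transition h t (x, y) =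
  expR (- Num.max 0 x.2) * (f x.1 + h * step_generator h t x.1).
Proof.
move=> hh tT; have /andP[h0 h1] := hh.
rewrite -normal_shifted// /transition/= RintegralZl//.
apply: (@integrable_boundedP _ _ _ (normal_prob 0 (Num.sqrt h)) setT _ C) => //.
  by apply: continuous_measurable_fun; exact: continuous_shifted.
move=> y _; apply: shifted_bound; have /andP[kt0 _] := kappaB x.1 tT.
by rewrite mulr_ge0// ltW.
Qed.

(** The increment of [W] is independent of [F (n%:R * h)], to which the scheme is adapted, so it can
    be averaged with state and clock held fixed. *)
Lemma euler_transition (h : R) (n : nat) : 0 < h <= 1 -> n.+1%:R * h <= T ->
  measurable_fun setT (step_generator h (n%:R * h)) /\
  discounted h n.+1 f = discounted h n (fun y => f y + h * step_generator h (n%:R * h) y).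
Proof.
move=> hh nT; have /andP[h0 h1] := hh.
have t0 : 0 <= n%:R * h by rewrite mulr_ge0// ltW.
have tt : n.+1%:R * h = n%:R * h + h by rewrite -natr1 mulrDl mul1r.
have nT' : n%:R * h <= T by rewrite (le_trans _ nT)// tt lerDl ltW.
have tT : 0 <= n%:R * h <= T by rewrite t0.
have t't : n%:R * h < n.+1%:R * h by rewrite tt ltrDl.
have [mW _ _ _ incr] := bmW.
have [lawW indW] := incr _ _ t0 t't.
pose V w := W (n.+1%:R * h) w - W (n%:R * h) w.
have mV : measurable_fun setT V.
  by apply: measurable_funB; apply: mW => //; rewrite mulr_ge0// ltW.
have lawV D : measurable D -> P (V @^-1` D) = normal_prob 0 (Num.sqrt h) D.
  by move=> mD; rewrite -(_ : n.+1%:R * h - n%:R * h = h) ?lawW//; rewrite tt; ring.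
have indV A D : measurable A -> measurable D ->
    P ((fun w => eul h n w) @^-1` A `&` V @^-1` D) =
    (P ((fun w => eul h n w) @^-1` A) * P (V @^-1` D))%E.
  move=> mA mD; apply: indW; first exact: eul_adapted.
  by apply: sub_sigma_algebra; exists Datatypes.tt, D.
have [H1 H2] := @Rintegral_indep _ _ _ Om _ (measurableTypeR R) R P (fun w => eul h n w) V
  (normal_prob 0 (Num.sqrt h)) (transition h (n%:R * h)) C (measurable_eul h0 nT') mV lawV indV
  (measurable_transition h tT) (fun x => transition_bound x h0 tT).
have mf : measurable_fun setT f.
  by apply: continuous_measurable_fun; exact: derivable_continuous.
split.
  have m0 : measurable_fun setT (fun y : R => (y, 0 : R)) by exact: measurable_fun_pair.
  have := measurableT_comp H2 m0 => m1.
  (* Solving the averaged transition at clock value 0 for the generator transfers the measurability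
     supplied by Fubini. *)
  have -> : step_generator h (n%:R * h) = (fun y =>
      ((((fun x => \int[normal_prob 0 (Num.sqrt h)]_y transition h (n%:R * h) (x, y)) \o
         (fun y : R => (y, 0 : R))) y) - f y) * h^-1).
    apply/funext => y; rewrite /= Rintegral_transition//= maxxx oppr0 expR0 mul1r.
    by field; rewrite gt_eqF.
  by apply: measurable_funM => //; exact: measurable_funB.
rewrite /discounted.
transitivity (\int[P]_w transition h (n%:R * h) (eul h n w, V w)).
  apply: eq_Rintegral => w _; rewrite /transition /shifted /=.
  rewrite (_ : Num.max 0 _ = (eul h n w).2); last by apply/max_idPr; exact: eul_clock_ge0.
  by rewrite opprD expRD /V mulrC mulrA.
rewrite H1; apply: eq_Rintegral => w _; rewrite Rintegral_transition//=.
by rewrite (_ : Num.max 0 _ = (eul h n w).2) ?(mulrC (expR _))//; apply/max_idPr; exact: eul_clock_ge0.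
Qed.

Let CG := C * (k1 + B + B ^+ 2) + 2 * C.

Lemma step_generator_bound (h t y : R) : 0 < h <= 1 -> 0 <= t <= T ->
  `|step_generator h t y| <= CG.
Proof.
by move=> hh tT; exact: (generator_bound df ddf fC dfC ddfC y hh (bB y tT) (kappaB y tT)).
Qed.

(** Each transition is an exact identity, so the telescoped sum carries no error; the approximation
    lies entirely in [step_generator]. *)
Lemma discounted_sum (h : R) (n : nat) : 0 < h <= 1 -> n%:R * h <= T ->
  discounted h n f = \int[P]_w f (X0 w) +
    h * \sum_(i < n) discounted h i (step_generator h (i%:R * h)).
Proof.
move=> hh; have /andP[h0 h1] := hh.
have mf : measurable_fun setT f.
  by apply: continuous_measurable_fun; exact: derivable_continuous.
elim: n => [|n IH] nT.
  rewrite big_ord0 mulr0 addr0 /discounted; apply: eq_Rintegral => w _ /=.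
  by rewrite oppr0 expR0 mulr1.
have t0 : 0 <= n%:R * h by rewrite mulr_ge0// ltW.
have nT' : n%:R * h <= T by rewrite (le_trans _ nT)// ler_wpM2r ?ler_nat// ltW.
have tT : 0 <= n%:R * h <= T by rewrite t0.
have [mg ->] := euler_transition hh nT.
rewrite big_ord_recr/= mulrDr addrA -IH//.
have i1 := integrable_P (measurable_discounted h0 nT' mf)
  (fun w => discounted_integrand_bound n w h0 fC).
have i2 := integrable_P (measurable_discounted h0 nT' mg)
  (fun w => discounted_integrand_bound n w h0 (fun y => step_generator_bound y hh tT)).
rewrite /discounted -(RintegralZl h measurableT i2).
rewrite -(RintegralD measurableT i1 (integrableZl measurableT h i2)).
by apply: eq_Rintegral => w _; ring.
Qed.

Definition killed_mean (Phi : R -> R -> R) (s : R) : R :=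
  \int[P]_(w in [set w | (s%:E < tau w)%E]) Phi s (X s w).

Lemma killed_mean_bound (Phi : R -> R -> R) (D s : R) : 0 <= s <= T ->
  measurable_fun setT (Phi s) -> (forall x, `|Phi s x| <= D) -> `|killed_mean Phi s| <= D.
Proof.
move=> sT mPhi PhiD; apply: Rintegral_boundP => //.
- exact: le_trans (normr_ge0 _) (PhiD 0).
- exact: measurable_alive.
- by apply: measurable_funTS; exact: (measurableT_comp mPhi (mX sT)).
Qed.

(** At every [s] the Euler expectations at the last grid time before [s] converge to the killed
    mean; as functions of [s] they are step functions. *)
Lemma measurable_killed_mean (Phi : R -> R -> R) (D : R) :
  (forall s : R, 0 <= s <= T -> measurable_fun setT (Phi s)) ->
  (forall s x : R, 0 <= s <= T -> `|Phi s x| <= D) ->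
  (forall (t u : nat -> R) (s x : R), (forall n, 0 <= t n <= T) -> 0 <= s <= T ->
    t @ \oo --> s -> u @ \oo --> x -> Phi (t n) (u n) @[n --> \oo] --> Phi s x) ->
  measurable_fun [set s | 0 <= s <= T] (killed_mean Phi).
Proof.
move=> mPhi PhiD cPhi.
pose h n : R := T / n.+1%:R.
have h0 n : 0 < h n by rewrite divr_gt0.
have ch : h @ \oo --> (0 : R).
  by rewrite -(mulr0 T); apply: cvgnM; [exact: cvgn_cst|exact: cvg_harmonic].
pose step n i := discounted (h n) i (Phi (i%:R * h n)).
pose steps n (s : R) := step n (Num.truncn (s * (h n)^-1)).
have msteps n : measurable_fun [set s | 0 <= s <= T] (steps n).
  by apply: measurable_funTS; exact: measurable_step.
refine (measurable_fun_cvg msteps _) => s /= sT; have /andP[s0 sT'] := sT.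
have ms n : (Num.truncn (s * (h n)^-1))%:R * h n <= s.
  by rewrite -ler_pdivlMr// truncn_le mulr_ge0// invr_ge0 ltW.
have ms0 n : 0 <= (Num.truncn (s * (h n)^-1))%:R * h n by rewrite mulr_ge0// ltW.
have mT' n : 0 <= (Num.truncn (s * (h n)^-1))%:R * h n <= T by rewrite ms0 (le_trans (ms n)).
have cm : (Num.truncn (s * (h n)^-1))%:R * h n @[n --> \oo] --> s by exact: cvg_truncn_mul.
apply: (@discounted_cvg h h0 ch s (fun n => Num.truncn (s * (h n)^-1)) sT ms cm
  (Phi s) (fun n => Phi ((Num.truncn (s * (h n)^-1))%:R * h n)) D) => //.
- exact: mPhi.
- by move=> n; exact: mPhi.
- by move=> x; exact: PhiD.
- by move=> n x; exact: PhiD.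
- by move=> u x cu; apply: cPhi.
Qed.

(** With the grid index kept at 0, the discounted expectation is the mean of [Phi 0 (X0 w)] for
    every mesh, hence so is its limit. *)
Lemma killed_mean0 (Phi : R -> R -> R) (D : R) : continuous (Phi 0) ->
  (forall x, `|Phi 0 x| <= D) -> killed_mean Phi 0 = \int[P]_w Phi 0 (X0 w).
Proof.
move=> cPhi PhiD.
pose h n : R := T / n.+1%:R.
have h0 n : 0 < h n by rewrite divr_gt0.
have ch : h @ \oo --> (0 : R).
  by rewrite -(mulr0 T); apply: cvgnM; [exact: cvgn_cst|exact: cvg_harmonic].
have mPhi : measurable_fun setT (Phi 0) by exact: continuous_measurable_fun.
have s0 : 0 <= (0 : R) <= T by apply/andP; split; [exact: lexx|exact: ltW].
have ms n : 0%:R * h n <= 0 by rewrite mul0r.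
have cm : (0%:R : R) * h n @[n --> \oo] --> (0 : R).
  by under eq_fun do rewrite mul0r; exact: cvgn_cst.
have H := @discounted_cvg h h0 ch 0 (fun=> 0%N) s0 ms cm (Phi 0) (fun=> Phi 0) D mPhi
  (fun=> mPhi) PhiD (fun=> PhiD) (fun u x cu => cvg_comp _ _ cu (cPhi x)).
have E : (fun n => discounted (h n) 0 (Phi 0)) = (fun=> \int[P]_w Phi 0 (X0 w)).
  apply/funext => n; rewrite /discounted; apply: eq_Rintegral => w _ /=.
  by rewrite oppr0 expR0 mulr1.
rewrite E in H.
transitivity (limn (fun _ : nat => \int[P]_w Phi 0 (X0 w))).
  by apply/esym; exact: (cvg_lim _ H).
exact: (cvg_lim _ (cvgn_cst (\int[P]_w Phi 0 (X0 w)))).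
Qed.

Definition generator (s x : R) : R :=
  (- k s x * f x + derive1 f x * b s x) + derive1n 2 f x.

Lemma dynkin (t : R) : 0 < t <= T ->
  killed_mean (fun=> f) t = \int[P]_w f (X0 w) +
    \int[leb]_(s in [set s | 0 <= s <= t]) killed_mean generator s.
Proof.
move=> /andP[t0 tT].
have tT' : 0 <= t <= T by rewrite ltW.
(* At least [t] steps, so the mesh is at most 1, and [N n] of them end exactly at [t]. *)
pose N n := (n + Num.truncn t).+1.
pose h n : R := t / (N n)%:R.
have N0 n : 0 < (N n)%:R :> R by rewrite ltr0n.
have h0 n : 0 < h n by rewrite divr_gt0.
have h1 n : h n <= 1.
  rewrite ler_pdivrMr// mul1r; apply: le_trans (ltW (truncnS_gt t)) _.
  by rewrite ler_nat ltnS leq_addl.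
have hh n : 0 < h n <= 1 by rewrite h0 h1.
have Nh n : (N n)%:R * h n = t by rewrite /h mulrC divfK// gt_eqF.
have ch : h @ \oo --> (0 : R).
  apply: (@squeeze_cvgr _ _ _ _ (fun=> 0) (fun n => t * n.+1%:R^-1)).
  - apply: nearW => n; rewrite (ltW (h0 n))/=; apply: ler_wpM2l; first exact: ltW.
    by rewrite lef_pV2 ?posrE ?ltr0n// ler_nat ltnS leq_addr.
  - exact: cvgn_cst.
  - by rewrite -(mulr0 t); apply: cvgnM; [exact: cvgn_cst|exact: cvg_harmonic].
have cf := derivable_continuous df.
have cdf := derivable_continuous ddf.
have mf : measurable_fun setT f := continuous_measurable_fun cf.
have mdf : measurable_fun setT (derive1 f) := continuous_measurable_fun cdf.
have mddf : measurable_fun setT (derive1n 2 f) := continuous_measurable_fun cddf.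
have C0 : 0 <= C by exact: le_trans (normr_ge0 _) (fC 0).
have CG0 : 0 <= CG.
  by rewrite /CG addr_ge0 ?mulr_ge0// addr_ge0 ?sqr_ge0// addr_ge0// ltW.
have L1 : discounted (h n) (N n) f @[n --> \oo] --> killed_mean (fun=> f) t.
  apply: (@discounted_cvg h h0 ch t N tT' _ _ f (fun=> f) C mf (fun=> mf) fC (fun=> fC)).
  - by move=> n; rewrite Nh.
  - by under eq_fun do rewrite Nh; exact: cvgn_cst.
  - move=> u x cu; exact: (@cvg_comp _ _ _ u f _ _ _ cu (cf x)).
pose sg n i := step_generator (h n) (i%:R * h n).
have iT n i : (i < N n)%N -> i.+1%:R * h n <= T.
  by move=> iN; rewrite (le_trans _ tT)// -(Nh n) ler_wpM2r ?ler_nat// ltW.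
have iT0 n i : (i < N n)%N -> 0 <= i%:R * h n <= T.
  move=> iN; rewrite mulr_ge0 ?(ltW (h0 n))//= (le_trans _ (iT n i iN))//.
  by rewrite ler_wpM2r ?ler_nat// ltW.
have msg n i : (i < N n)%N -> measurable_fun setT (sg n i).
  by move=> iN; have [] := euler_transition (hh n) (iT n i iN).
have sgC n i y : (i < N n)%N -> `|sg n i y| <= CG.
  by move=> iN; exact: step_generator_bound (hh n) (iT0 n i iN).
(* Padding by zero gives a bound for all indices; past [N n] the grid may leave [[0, T]]. *)
pose u n i : R := if (i < N n)%N then discounted (h n) i (sg n i) else 0.
have uC n i : `|u n i| <= CG.
  rewrite /u; case: ifPn => [iN|_]; last by rewrite normr0.
  apply: discounted_bound => //; [by case/andP: (iT0 n i iN)|exact: msg|by move=> x; exact: sgC].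
have sumE n : discounted (h n) (N n) f = \int[P]_w f (X0 w) +
    \int[leb]_(s in [set s | 0 <= s <= t]) u n (Num.truncn (s * (h n)^-1)).
  rewrite discounted_sum ?Nh//; congr (_ + _).
  rewrite -{1}(Nh n) (Rintegral_step (N n) (h0 n) (uC n)); congr (_ * _).
  by apply: eq_bigr => i _; rewrite /u ltn_ord.
have msteps n : measurable_fun [set s | 0 <= s <= t] (fun s => u n (Num.truncn (s * (h n)^-1))).
  by apply: measurable_funTS; exact: measurable_step.
have mgen (s : R) : 0 <= s <= T -> measurable_fun setT (generator s).
  move=> sT; have mks := measurable_coeff sT kL; have mbs := measurable_coeff sT bL.
  have mN : measurable_fun setT (fun x => - k s x) by exact: measurableT_comp.
  exact: (measurable_funD (measurable_funD (measurable_funM mN mf) (measurable_funM mdf mbs)) mddf).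
have genC (s x : R) : 0 <= s <= T -> `|generator s x| <= CG.
  move=> sT; have /andP[ks0 ks1] := kappaB x sT.
  have g1 : `|- k s x * f x| <= k1 * C.
    by rewrite normrM normrN; apply: ler_pM => //; rewrite ger0_norm.
  have g2 : `|derive1 f x * b s x| <= C * B by rewrite normrM; apply: ler_pM => //; exact: bB.
  have g3 := ddfC x.
  have g4 : 0 <= C * B ^+ 2 by rewrite mulr_ge0// sqr_ge0.
  rewrite /generator /CG; apply: le_trans (ler_normD _ _) _.
  apply: le_trans (lerD (ler_normD _ _) (lexx _)) _; lra.
have cgen (tt uu : nat -> R) (s x : R) : (forall n, 0 <= tt n <= T) -> 0 <= s <= T ->
    tt @ \oo --> s -> uu @ \oo --> x -> generator (tt n) (uu n) @[n --> \oo] --> generator s x.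
  move=> ttT sT ct cu.
  have cfu (g : R -> R) : continuous g -> g (uu n) @[n --> \oo] --> g x.
    by move=> cg; apply: (@cvg_comp _ _ _ uu g _ _ _ cu); exact: cg.
  have cb := lipschitz_seq_cvg sT ttT bL ct cu.
  have ck := lipschitz_seq_cvg sT ttT kL ct cu.
  have cNk : (fun n => - k (tt n) (uu n)) @ \oo --> - k s x by exact: cvgN.
  exact: (cvgnD (cvgnD (cvgnM cNk (cfu _ cf)) (cvgnM (cfu _ cdf) cb)) (cfu _ cddf)).
have mkm : measurable_fun [set s | 0 <= s <= t] (killed_mean generator).
  apply: (measurable_funS _ _ (measurable_killed_mean mgen genC cgen)).
    exact: measurable_lele.
  by move=> s /= /andP[-> st]; exact: le_trans tT.
have L2 : \int[leb]_(s in [set s | 0 <= s <= t]) u n (Num.truncn (s * (h n)^-1)) @[n --> \oo] -->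
    \int[leb]_(s in [set s | 0 <= s <= t]) killed_mean generator s.
  apply: (@Rintegral_bounded_cvg _ _ _ leb _ (fun n s => u n (Num.truncn (s * (h n)^-1)))
    (killed_mean generator) CG) => //.
  - exact: measurable_lele.
  - by apply: leb_cc_lty; exact: ltW.
  (* The time [s = t] is discarded as a null set: its index is [N n], where [u] is the padding. *)
  - exists [set t]; split; [exact: measurable_set1|exact: lebesgue_measure_set1|].
    move=> s /= ns; apply: contrapT => st; apply: ns => /andP[s0 st'].
    have {st st'}st : s < t by rewrite lt_neqAle st' andbT; apply/eqP.
    have sT : 0 <= s <= T by rewrite s0 (le_trans (ltW st)).
    have mN n : (Num.truncn (s * (h n)^-1) < N n)%N.
      rewrite truncn_lt_nat; last by rewrite mulr_ge0// invr_ge0 ltW.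
      by rewrite ltr_pdivrMr// Nh.
    have ms n : (Num.truncn (s * (h n)^-1))%:R * h n <= s.
      by rewrite -ler_pdivlMr// truncn_le mulr_ge0// invr_ge0 ltW.
    have cm : (Num.truncn (s * (h n)^-1))%:R * h n @[n --> \oo] --> s by exact: cvg_truncn_mul.
    rewrite /u; under eq_fun do rewrite mN.
    apply: (@discounted_cvg h h0 ch s (fun n => Num.truncn (s * (h n)^-1)) sT ms cm
      (generator s) (fun n => sg n (Num.truncn (s * (h n)^-1))) CG) => //.
    + exact: mgen.
    + by move=> n; exact: msg.
    + by move=> x; exact: genC.
    + by move=> n x; exact: sgC.
    + move=> w x cw; rewrite /sg /step_generator /generator.
      apply: (@generator_cvg R f C df ddf cddf fC dfC ddfC B k1 h _ _ w (b s x) (k s x) x) => //.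
      * by move=> n; apply: bB; exact: iT0.
      * by move=> n; apply: kappaB; exact: iT0.
      * by apply: lipschitz_seq_cvg => // n; exact: iT0.
      * by apply: lipschitz_seq_cvg => // n; exact: iT0.
have L3 : discounted (h n) (N n) f @[n --> \oo] --> \int[P]_w f (X0 w) +
    \int[leb]_(s in [set s | 0 <= s <= t]) killed_mean generator s.
  by under eq_fun do rewrite sumE; apply: cvgnD => //; exact: cvgn_cst.
by rewrite -(cvg_lim _ L1)// (cvg_lim _ L3).
Qed.

Lemma dynkin_terms (t : R) : 0 < t <= T ->
  killed_mean (fun=> f) t = \int[P]_w f (X0 w)
  + \int[leb]_(s in [set s | 0 <= s <= t]) killed_mean (fun=> derive1n 2 f) s
  + \int[leb]_(s in [set s | 0 <= s <= t]) killed_mean (fun s x => derive1 f x * b s x) s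
  - \int[leb]_(s in [set s | 0 <= s <= t]) killed_mean (fun s x => f x * k s x) s.
Proof.
move=> tT0; have /andP[t0 tT] := tT0.
have C0 : 0 <= C := le_trans (normr_ge0 _) (fC 0).
have cf : continuous f by exact: derivable_continuous.
have cdf : continuous (derive1 f) := derivable_continuous ddf.
pose Phi2 (s x : R) := derive1 f x * b s x.
pose Phi3 (s x : R) := f x * k s x.
have mPhi1 : measurable_fun setT (derive1n 2 f) by exact: continuous_measurable_fun.
have mPhi2 (s : R) : 0 <= s <= T -> measurable_fun setT (Phi2 s).
  move=> sT; apply: measurable_funM; first exact: continuous_measurable_fun.
  exact: (measurable_coeff sT bL).
have mPhi3 (s : R) : 0 <= s <= T -> measurable_fun setT (Phi3 s).
  move=> sT; apply: measurable_funM; first exact: continuous_measurable_fun.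
  exact: (measurable_coeff sT kL).
have Phi2B (s x : R) : 0 <= s <= T -> `|Phi2 s x| <= C * B.
  by move=> sT; rewrite normrM; apply: ler_pM => //; exact: bB.
have Phi3B (s x : R) : 0 <= s <= T -> `|Phi3 s x| <= C * k1.
  move=> /andP[s0 _]; have /andP[k0' k1'] := kB x s0.
  by rewrite normrM; apply: ler_pM => //; rewrite ger0_norm.
have mA (s : R) : measurable [set w | (s%:E < tau w)%E] := measurable_alive mtau s.
have iP (s : R) (Psi : R -> R) (D : R) : 0 <= s <= T -> measurable_fun setT Psi ->
    (forall x, `|Psi x| <= D) ->
    P.-integrable [set w | (s%:E < tau w)%E] (EFin \o (fun w => Psi (X s w))).
  move=> sT mPsi PsiD; apply: (@integrable_boundedP _ _ _ P _ (fun w => Psi (X s w)) D) => //.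
  by apply: measurable_funTS; exact: (measurableT_comp mPsi (mX sT)).
have genE (s : R) : 0 <= s <= T -> killed_mean generator s =
    killed_mean (fun=> derive1n 2 f) s + killed_mean Phi2 s - killed_mean Phi3 s.
  move=> sT.
  have i1 := @iP s (derive1n 2 f) C sT mPhi1 ddfC.
  have i2 := @iP s (Phi2 s) (C * B) sT (mPhi2 s sT) (fun x => Phi2B s x sT).
  have i3 := @iP s (Phi3 s) (C * k1) sT (mPhi3 s sT) (fun x => Phi3B s x sT).
  have i12 : P.-integrable [set w | (s%:E < tau w)%E]
      (EFin \o (fun w => derive1n 2 f (X s w) + Phi2 s (X s w))).
    apply: (@iP s (fun x => derive1n 2 f x + Phi2 s x) (C + C * B)) => //.
      by apply: measurable_funD => //; exact: mPhi2.
    by move=> x; apply: le_trans (ler_normD _ _) _; apply: lerD => //; exact: Phi2B.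
  rewrite /killed_mean -(RintegralD (mA s) i1 i2) -(RintegralB (mA s) i12 i3).
  by apply: eq_Rintegral => w _; rewrite /generator /Phi2 /Phi3; ring.
have sub : [set s : R | 0 <= s <= t] `<=` [set s | 0 <= s <= T].
  by move=> s /= /andP[-> /le_trans]; exact.
have ms : measurable ([set s | 0 <= s <= t] : set (measurableTypeR R)) by exact: measurable_lele.
have il (Psi : R -> R -> R) (D : R) : (forall s : R, 0 <= s <= T -> measurable_fun setT (Psi s)) ->
    (forall s x : R, 0 <= s <= T -> `|Psi s x| <= D) ->
    (forall (t u : nat -> R) (s x : R), (forall n, 0 <= t n <= T) -> 0 <= s <= T ->
      t @ \oo --> s -> u @ \oo --> x -> Psi (t n) (u n) @[n --> \oo] --> Psi s x) ->
    leb.-integrable [set s | 0 <= s <= t] (EFin \o killed_mean Psi).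
  move=> mPsi PsiD cPsi.
  have mk := measurable_killed_mean mPsi PsiD cPsi.
  apply: (@integrable_bounded _ _ _ leb _ (killed_mean Psi) D).
  - exact: measurable_lele.
  - by apply: leb_cc_lty; exact: ltW.
  - by apply: (measurable_funS _ sub mk); exact: measurable_lele.
  - by move=> s /sub sT; exact: (killed_mean_bound sT (mPsi s sT) (fun x => PsiD s x sT)).
have I1 : leb.-integrable [set s | 0 <= s <= t] (EFin \o killed_mean (fun=> derive1n 2 f)).
  apply: (@il _ C) => // t_ u s x _ _ _ cu.
  exact: (cvg_comp _ _ cu (cddf (x:=x))).
have c2 (t_ u : nat -> R) (s x : R) : (forall n, 0 <= t_ n <= T) -> 0 <= s <= T ->
    t_ @ \oo --> s -> u @ \oo --> x -> Phi2 (t_ n) (u n) @[n --> \oo] --> Phi2 s x.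
  move=> tn sT ct cu; apply: cvgnM; first exact: (cvg_comp _ _ cu (cdf x)).
  exact: (lipschitz_seq_cvg sT tn bL ct cu).
have I2 : leb.-integrable [set s | 0 <= s <= t] (EFin \o killed_mean Phi2).
  exact: (il _ _ mPhi2 Phi2B c2).
have I3 : leb.-integrable [set s | 0 <= s <= t] (EFin \o killed_mean Phi3).
  apply: (il _ _ mPhi3 Phi3B) => t_ u s x tn sT ct cu.
  apply: cvgnM; first exact: (cvg_comp _ _ cu (cf x)).
  exact: (lipschitz_seq_cvg sT tn kL ct cu).
have I12 : leb.-integrable [set s | 0 <= s <= t]
    (EFin \o (fun s => killed_mean (fun=> derive1n 2 f) s + killed_mean Phi2 s)).
  have -> : EFin \o (fun s => killed_mean (fun=> derive1n 2 f) s + killed_mean Phi2 s) =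
      (EFin \o killed_mean (fun=> derive1n 2 f)) \+ (EFin \o killed_mean Phi2) by [].
  exact: (integrableD ms I1 I2).
rewrite dynkin// -!addrA; congr (_ + _); rewrite addrA.
rewrite -(RintegralD ms I1 I2) -(RintegralB ms I12 I3).
by apply: eq_Rintegral => s /set_mem /= /sub sT; rewrite genE.
Qed.

End generator_step.
End killed_diffusion.

(** * The weak equation for the densities *)

Unset Implicit Arguments. Set Strict Implicit. Set Printing Implicit Defensive.

Theorem theorem3p2
  (R : realType) (T : R)
  (d : measure_display) (Om : measurableType d) (P : probability Om R)
  (F : R -> set (set Om)) (W : R -> Om -> R) (X0 : Om -> R) (rho0 : R -> R)
  (Z : Om -> R)
  (K : R -> R) (MK MK' MK'' LK LK' : R)
  (lam c0 phi0 phi1 : R)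
  (X : R -> Om -> R) (tau : Om -> \bar R) (v : R -> R -> R) :
  (* time horizon *)
  0 < T ->
  (* filtered probability space with a Brownian motion *)
  filtration F ->
  brownian_motion P F W ->
  (* initial condition *)
  measurable_fun setT X0 ->
  (forall B, measurable B -> F 0 (X0 @^-1` B)) ->
  indep_sets P (sigma_gen (fun _ : unit => X0)) (sigma_gen (fun t : {t : R | 0 <= t} => W (sval t))) ->
  (\int[P]_w ((X0 w) ^+ 2)%:E < +oo)%E ->
  measurable_fun setT rho0 ->
  (forall B, measurable B ->
     P (X0 @^-1` B) = (\int[lebesgue_measure]_(x in B) (rho0 x)%:E)%E) ->
  (\int[lebesgue_measure]_x ((rho0 x) ^+ 2)%:E < +oo)%E ->
  continuous rho0 ->
  (exists C, forall x, `|rho0 x| <= C) ->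
  (* exponential clock *)
  measurable_fun setT Z ->
  (forall B, measurable B -> P (Z @^-1` B) = exponential_prob 1 B) ->
  indep_sets P (sigma_gen (fun _ : unit => Z))
    (sigma_gen (fun i : option {t : R | 0 <= t} =>
                  match i with None => X0 | Some t => W (sval t) end)) ->
  (* mollifier *)
  (forall x, 0 <= K x) ->
  smooth K ->
  (forall x, `|K x| <= MK) ->
  (forall x, `|derive1 K x| <= MK') ->
  (forall x, `|derive1n 2 K x| <= MK'') ->
  lipschitz_const K LK ->
  lipschitz_const (derive1 K) LK' ->
  (\int[lebesgue_measure]_x (K x)%:E = 1)%E ->
  (* parameters *)
  0 < lam -> 0 < c0 -> 0 < phi0 ->
  (exists m M, 0 < m /\ m <= M /\
     forall x, 0 <= x <= MK * T ->
       m <= phi0 + phi1 * c0 * expR (- lam * x) <= M) ->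
  (* (X, tau) solves the killed McKean--Vlasov equation *)
  (forall t, 0 <= t <= T -> measurable_fun setT (X t)) ->
  measurable_fun setT tau ->
  {ae P, forall w, forall t, 0 <= t <= T -> (t%:E < tau w)%E ->
     X t w = X0 w
             + \int[lebesgue_measure]_(s in [set s | 0 <= s <= t])
                  drift lam c0 phi0 phi1
                    (tconv_nu P X tau K s (X s w))
                    (tconv_nu P X tau (derive1 K) s (X s w))
             + Num.sqrt 2 * W t w} ->
  (forall w, tau w =
     ereal_inf [set t%:E | t in [set t | 0 <= t /\
        Z w <= \int[lebesgue_measure]_(s in [set s | 0 <= s <= t])
                  (lam * c0 * expR (- lam * tconv_nu P X tau K s (X s w)))]]) ->
  (* v(t, .) is a Lebesgue density of nu_t for t in (0, T], v(0, .) = rho0 *)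
  (forall t, 0 < t <= T -> measurable_fun setT (v t) /\
     forall A, measurable A ->
       nu_kill P X tau t A = (\int[lebesgue_measure]_(x in A) (v t x)%:E)%E) ->
  v 0 = rho0 ->
  (* conclusion: weak form of the PDE *)
  forall f : R -> R, Cb2 f ->
  forall t, 0 <= t <= T ->
    \int[lebesgue_measure]_(x in setT) (f x * v t x)
    = \int[lebesgue_measure]_(x in setT) (f x * rho0 x)
      + \int[lebesgue_measure]_(s in [set s | 0 <= s <= t])
          \int[lebesgue_measure]_(x in setT) (derive1n 2 f x * v s x)
      + \int[lebesgue_measure]_(s in [set s | 0 <= s <= t])
          \int[lebesgue_measure]_(x in setT)
            (derive1 f x * drift lam c0 phi0 phi1 (tconv_v v K s x)
                              (tconv_v v (derive1 K) s x) * v s x)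
      - \int[lebesgue_measure]_(s in [set s | 0 <= s <= t])
          \int[lebesgue_measure]_(x in setT)
            (f x * lam * c0 * expR (- lam * tconv_v v K s x) * v s x).
Proof.
move=> T0 filF bmW mX0 FX0 _ _ mrho lawX0 _ _ _ mZ lawZ indepZ K0 sK KM K'M _ KL K'L _
  lam0 c00 phi00 [m [M [m0 [mM mP]]]] mX mtau XE tauE vE v0 f [df ddf cddf [C fC]] t tT.
pose p := tconv_nu P X tau K.
pose q := tconv_nu P X tau (derive1 K).
pose b (s x : R) := drift lam c0 phi0 phi1 (p s x) (q s x).
pose k (s x : R) := lam * c0 * expR (- lam * p s x).
have cK : continuous K := derivable_continuous (sK 0%N).
have cK' : continuous (derive1 K) := derivable_continuous (sK 1%N).
have MK0 : 0 <= MK := le_trans (normr_ge0 _) (KM 0).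
have MK'0 : 0 <= MK' := le_trans (normr_ge0 _) (K'M 0).
have LK0 : 0 <= LK by have := KL 1 0; rewrite subr0 normr1 mulr1; exact: le_trans.
have LK'0 : 0 <= LK' by have := K'L 1 0; rewrite subr0 normr1 mulr1; exact: le_trans.
have T0' := ltW T0.
have pP (s x : R) : 0 <= s <= T -> 0 <= p s x <= MK * T.
  move=> sT; rewrite tconv_nu_ge0//=; have /andP[_ sT'] := sT.
  apply: le_trans (ler_norm _) (le_trans (tconv_nu_bound P mX mtau x sT cK KM) _).
  by rewrite ler_wpM2l.
have qQ (s x : R) : 0 <= s <= T -> `|q s x| <= MK' * T.
  move=> sT; have /andP[_ sT'] := sT.
  apply: le_trans (tconv_nu_bound P mX mtau x sT cK' K'M) _.
  by rewrite ler_wpM2l.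
have MT0 : 0 <= MK' * T by rewrite mulr_ge0.
have mP' (x : R) : 0 <= x <= MK * T -> m <= phi0 + phi1 * c0 * expR (- lam * x).
  by move=> /mP /andP[].
have [CD CD0 [driftB driftL]] := drift_bound_lipschitz lam0 c00 phi00 m0 MT0 mP'.
have bB (s x : R) : 0 <= s <= T -> `|b s x| <= CD.
  by move=> sT; apply: driftB; [exact: pP|exact: qQ].
have kap0 : 0 < lam * c0 by rewrite mulr_gt0.
have kB (s x : R) : 0 <= s -> 0 <= k s x <= lam * c0.
  move=> s0; rewrite /k mulr_ge0 ?expR_ge0 ?(ltW kap0)//=.
  rewrite -[leRHS]mulr1 ler_wpM2l ?(ltW kap0)// -expR0 ler_expR mulNr oppr_le0.
  by rewrite mulr_ge0 ?(ltW lam0)// tconv_nu_ge0.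
(* On [[0, T]] the occupation integral [p] is at most [MK * T], so the rate cannot drop below this
   positive value. *)
pose k0 := lam * c0 * expR (- lam * (MK * T)).
have k0_gt0 : 0 < k0 by rewrite mulr_gt0 ?expR_gt0.
have kB0 (s x : R) : 0 <= s <= T -> k0 <= k s x.
  move=> sT; have /andP[_ pT] := pP s x sT; rewrite /k /k0 ler_wpM2l ?(ltW kap0)// ler_expR !mulNr lerN2.
  by rewrite ler_wpM2l ?(ltW lam0).
have cW : {ae P, forall w, {within `[0, +oo[, continuous (W^~ w)}} by case: bmW.
pose Lp := MK + T * LK.
pose Lq := MK' + T * LK'.
have Lp0 : 0 <= Lp by rewrite addr_ge0// mulr_ge0.
have Lq0 : 0 <= Lq by rewrite addr_ge0// mulr_ge0.
have pL (g : R -> R) (N l s s' x y : R) : 0 <= N -> 0 <= l -> continuous g ->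
    (forall z, `|g z| <= N) -> lipschitz_const g l ->
    0 <= s <= T -> 0 <= s' <= T ->
    `|tconv_nu P X tau g s x - tconv_nu P X tau g s' y| <=
      (N + T * l) * (`|s - s'| + `|x - y|).
  move=> N0 l0 cg gN gl sT s'T.
  have H1 := tconv_nu_time_lipschitz P mX mtau x sT s'T cg gN.
  have H2 := tconv_nu_space_lipschitz T0 mX mtau bB cW XE x y s'T cg gN gl.
  apply: le_trans (ler_distD (tconv_nu P X tau g s' x) _ _) _.
  apply: le_trans (lerD H1 H2) _; rewrite mulrDl !mulrDr.
  have n1 : 0 <= N * `|x - y| by rewrite mulr_ge0.
  have n2 : 0 <= T * l * `|s - s'| by rewrite !mulr_ge0.
  by lra.
(* One Lipschitz constant for both coefficients: the first summand serves [b], the second [k]. *)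
pose L := CD * (Lp + Lq) + lam * c0 * (lam * Lp).
have L1_ge0 : 0 <= CD * (Lp + Lq) := mulr_ge0 CD0 (addr_ge0 Lp0 Lq0).
have L2_ge0 : 0 <= lam * c0 * (lam * Lp) := mulr_ge0 (ltW kap0) (mulr_ge0 (ltW lam0) Lp0).
have L0 : 0 <= L := addr_ge0 L1_ge0 L2_ge0.
have bL (s s' x y : R) : 0 <= s <= T -> 0 <= s' <= T ->
    `|b s x - b s' y| <= L * (`|s - s'| + `|x - y|).
  move=> sT s'T.
  have H1 := pL K MK LK s s' x y MK0 LK0 cK KM KL sT s'T.
  have H2 := pL (derive1 K) MK' LK' s s' x y MK'0 LK'0 cK' K'M K'L sT s'T.
  apply: le_trans (driftL _ _ _ _ (pP s x sT) (qQ s x sT) (pP s' y s'T) (qQ s' y s'T)) _.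
  apply: (@le_trans _ _ (CD * (Lp + Lq) * (`|s - s'| + `|x - y|))); last first.
    by rewrite ler_wpM2r ?addr_ge0// lerDl.
  by rewrite -mulrA ler_wpM2l// mulrDl; exact: lerD.
have kL (s s' x y : R) : 0 <= s <= T -> 0 <= s' <= T ->
    `|k s x - k s' y| <= L * (`|s - s'| + `|x - y|).
  move=> sT s'T.
  have H1 := pL K MK LK s s' x y MK0 LK0 cK KM KL sT s'T.
  have /andP[p0 _] := pP s x sT; have /andP[p0' _] := pP s' y s'T.
  have lp : 0 <= lam * p s x by rewrite mulr_ge0 ?(ltW lam0).
  have lp' : 0 <= lam * p s' y by rewrite mulr_ge0 ?(ltW lam0).
  apply: (@le_trans _ _ (lam * c0 * (lam * Lp) * (`|s - s'| + `|x - y|))); last first.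
    by rewrite ler_wpM2r ?addr_ge0// lerDr.
  rewrite /k -mulrBr normrM (gtr0_norm kap0) -mulrA ler_wpM2l ?(ltW kap0)//.
  rewrite !mulNr; apply: le_trans (expRN_lipschitz lp lp') _.
  by rewrite -mulrBr normrM (gtr0_norm lam0) -mulrA ler_wpM2l ?(ltW lam0).
have VT (s : R) (phi : R -> R) (D : R) : 0 <= s <= T -> continuous phi ->
    (forall x, `|phi x| <= D) ->
    \int[lebesgue_measure]_x (phi x * v s x) =
    \int[P]_(w in [set w | (s%:E < tau w)%E]) phi (X s w).
  move=> /andP[s0 sT] cphi phiD.
  have mphi : measurable_fun setT phi by exact: continuous_measurable_fun.
  have [s_gt0|s_le0] := ltP 0 s.
    have sT0 : 0 < s <= T by rewrite s_gt0.
    have [mv nuE] := vE s sT0.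
    apply: (@Rintegral_law_density _ _ _ (measurableTypeR R) _ _ lebesgue_measure _ _ _ _ D) => //.
    - exact: measurable_alive.
    - by apply: mX; rewrite s0.
  (* At time 0 the density is that of the law of [X0]; the killed mean at 0 is identified with the
     mean under that law. *)
  have -> : s = 0 by apply/le_anti; rewrite s_le0 s0.
  have := killed_mean0 T0 L0 CD0 k0_gt0 kap0 bB kB kB0 bL kL bmW mX0 mZ lawZ indepZ
    mX mtau XE tauE (Phi := fun=> phi) cphi phiD.
  rewrite {1}/killed_mean v0 => ->.
  apply: (@Rintegral_law_density _ _ _ (measurableTypeR R) _ _ lebesgue_measure setT X0 _ _ D) => //.
  by move=> A mA; rewrite setIT lawX0.
have convE (g : R -> R) (N s x : R) : continuous g -> (forall y, `|g y| <= N) -> 0 <= s <= T ->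
    tconv_v v g s x = tconv_nu P X tau g s x.
  move=> cg gN /andP[s0 sT]; apply: eq_Rintegral => r /set_mem /= /andP[r0 rs].
  apply: (VT r (fun y => g (x - y)) N) => //; first by rewrite r0 (le_trans rs).
  move=> y; apply: (@cvg_comp _ _ _ (fun y => x - y) g); last exact: cg.
  by apply: cvgB; [exact: cvg_cst|exact: cvg_id].
have cf : continuous f := derivable_continuous df.
have cdf : continuous (derive1 f) := derivable_continuous ddf.
have fC0 x : `|f x| <= C by have [] := fC x.
have fC1 x : `|derive1 f x| <= C by have [_ []] := fC x.
have fC2 x : `|derive1n 2 f x| <= C by have [_ []] := fC x.
have /andP[t0 tT'] := tT.
have [t_gt0|t_le0] := ltP 0 t; last first.
  (* At [t = 0] all time integrals run over a single point and vanish. *)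
  have -> : t = 0 by apply/le_anti; rewrite t_le0 t0.
  have -> : [set s : R | 0 <= s <= 0] = [set 0].
    by apply/seteqP; split => s /=; [move=> /le_anti|move=> ->; rewrite lexx].
  by rewrite !Rintegral_set1 !addr0 subr0 v0.
have tT0 : 0 < t <= T by rewrite t_gt0.
have sT (s : R) : s \in [set s | 0 <= s <= t] -> 0 <= s <= T.
  by move=> /set_mem /= /andP[-> /le_trans]; exact.
rewrite (VT t f C tT cf fC0).
have := dynkin_terms T0 L0 CD0 k0_gt0 kap0 bB kB kB0 bL kL filF bmW mX0 FX0 mZ lawZ indepZ
  mX mtau XE tauE df ddf cddf fC0 fC1 fC2 tT0.
rewrite {1}/killed_mean => ->.
congr (_ + _ + _ - _).
- have zT : 0 <= (0 : R) <= T by rewrite lexx.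
  rewrite -v0 (VT 0 f C zT cf fC0).
  exact/esym/(killed_mean0 T0 L0 CD0 k0_gt0 kap0 bB kB kB0 bL kL bmW mX0 mZ lawZ indepZ
    mX mtau XE tauE (Phi := fun=> f) cf fC0).
- by apply: eq_Rintegral => s /sT sT0; rewrite (VT s _ C sT0 cddf fC2).
- apply: eq_Rintegral => s /sT sT0.
  have cb : continuous (fun x => derive1 f x * b s x).
    move=> x; apply: cvgM; first exact: cdf.
    exact: (lipschitz_space_continuous L0 sT0 bL).
  rewrite /killed_mean -(VT s (fun x => derive1 f x * b s x) (C * CD) sT0 cb).
    apply: eq_Rintegral => x _.
    by rewrite (convE K MK s x cK KM sT0) (convE (derive1 K) MK' s x cK' K'M sT0).
  by move=> x; rewrite normrM; apply: ler_pM => //; exact: bB.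
- apply: eq_Rintegral => s /sT sT0; have /andP[s0 _] := sT0.
  have ck : continuous (fun x => f x * k s x).
    move=> x; apply: cvgM; first exact: cf.
    exact: (lipschitz_space_continuous L0 sT0 kL).
  rewrite /killed_mean -(VT s (fun x => f x * k s x) (C * (lam * c0)) sT0 ck).
    apply: eq_Rintegral => x _.
    by rewrite (convE K MK s x cK KM sT0) /k !mulrA.
  move=> x; have /andP[k0' k1'] := kB s x s0.
  by rewrite normrM; apply: ler_pM => //; rewrite ger0_norm.
Qed.
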